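(* For an $SU(n)$-structure on a $2n$-manifold $M$, $n\ge2$, the $\mathcal W_5$-part $\eta$ of the intrinsic torsion can be identified with $-\eta\psi_+=-n\,I\eta\otimes\psi_-$ or with $-\eta\psi_-=n\,I\eta\otimes\psi_+$, where $\eta$ is a one-form such that $$\ast\left(\ast d\psi_+\wedge\psi_++\ast d\psi_-\wedge\psi_-\right)=n2^{n-1}\eta+2^{n-2}I\,d^*\omega,$$ or $$\ast\left(\ast d\psi_+\wedge\psi_--\ast d\psi_-\wedge\psi_+\right)=n2^{n-1}I\eta-2^{n-2}d^*\omega.$$ Furthermore, if $n\ge3$, then $\ast d\psi_+\wedge\psi_+=\ast d\psi_-\wedge\psi_-$ and $\ast d\psi_+\wedge\psi_-=-\ast d\psi_-\wedge\psi_+$.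
   Context: An $SU(n)$-structure (special almost Hermitian structure) on a $2n$-manifold $M$ consists of a Riemannian metric $\langle\cdot,\cdot\rangle$, an orthogonal almost complex structure $I$, and a complex volume form $\Psi=\psi_++i\psi_-$ of unit length; vectors are identified with one-forms by $x\mapsto\langle\cdot,x\rangle$, and locally there are orthonormal (adapted) frames $e_1,\dots,e_n,Ie_1,\dots,Ie_n$ with $\Psi=(e_1+iIe_1)\wedge\dots\wedge(e_n+iIe_n)$. Kähler form: $\omega(x,y)=\langle x,Iy\rangle$. For a one-form $\mu$, $(I\mu)(X)=-\mu(IX)$. The real volume form $Vol$ is fixed by $(-1)^{n(n+1)/2}n!\,Vol=\omega^n$, $\ast$ is the associated Hodge star ($\alpha\wedge\ast\beta=\langle\alpha,\beta\rangle Vol$, with $\langle a,b\rangle=\frac1{p!}\sum a(e_{i_1},\dots,e_{i_p})b(e_{i_1},\dots,e_{i_p})$), and $d^*=-\ast d\ast$ is the coderivative. $\ast d\psi_\pm\wedge\psi_\pm$ means $(\ast d\psi_\pm)\wedge\psi_\pm$. The intrinsic torsion is $\eta+\xi$, where $\overline\nabla=\nabla+\eta+\xi$ is the minimal $SU(n)$-connection ($\nabla$ the Levi-Civita connection; $\overline\nabla$ preserves the metric, $\omega$, $\psi_+$, $\psi_-$), with $\xi_XY=-\frac12I(\nabla_XI)Y$ and $\eta_XY=(I\eta)(X)\,IY$ for a one-form denoted by the same letter $\eta$; this $\eta\in T^*M\cong\mathcal W_5$ is the $\mathcal W_5$-part. $\eta$ and $\xi$ act on forms as derivations, so $\nabla\psi_\pm=-\eta\psi_\pm-\xi\psi_\pm$.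 *)

(* Defs.v *)
From HB Require Import structures.
From mathcomp Require Import all_boot all_order all_algebra.
From mathcomp Require Import perm complex.
From mathcomp Require Import all_classical all_reals all_analysis.
Import Order.TTheory GRing.Theory Num.Theory.
Import numFieldNormedType.Exports.

Set Implicit Arguments.
Unset Strict Implicit.
Unset Printing Implicit Defensive.

Local Open Scope classical_set_scope.
Local Open Scope ring_scope.

(** * Multilinear algebra at a point

A covariant p-tensor on V is a function on sequences of vectors that vanishes
on the sequences whose length is not p, so that forms of all degrees live in
the same type and no cast between degrees is needed; for the same reason the
operations below take the degrees of their arguments as parameters. *)

Definition covariant (V : Type) (F : Type) := seq V -> F.

Section Exterior.
Variables (V : zmodType) (F : fieldType).
Implicit Types a b : covariant V F.

Definition wedge (p q : nat) a b : covariant V F := fun s =>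
  if size s == (p + q)%N then
    ((p`! * q`!)%:R)^-1 * \sum_(sigma : 'S_(p + q))
      (let t := [seq s`_(sigma i) | i <- enum 'I_(p + q)] in
       (-1) ^+ sigma * (a (take p t) * b (drop p t)))
  else 0.

Definition form1 : covariant V F := fun s => (s == [::])%:R.

Fixpoint wedge_exp (p : nat) a (k : nat) : covariant V F :=
  if k is k'.+1 then wedge p (p * k') a (wedge_exp p a k') else form1.

Fixpoint wedge_oneforms (l : seq (covariant V F)) : covariant V F :=
  if l is a :: l' then wedge 1 (size l') a (wedge_oneforms l') else form1.

End Exterior.

Section Pointwise.
Variables (R : realType) (m : nat).
Local Notation V := 'rV[R]_m.
Implicit Types (a b : covariant V R) (G B : 'M[R]_m).

Definition is_form (p : nat) a : Prop :=
  [/\ forall s, size s <> p -> a s = 0,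
      forall s1 s2 (k : R) u v, (size s1 + size s2).+1 = p ->
        a (s1 ++ (k *: u + v) :: s2) = k * a (s1 ++ u :: s2) + a (s1 ++ v :: s2)
    & forall s1 s2 s3 u, a (s1 ++ u :: s2 ++ u :: s3) = 0].

Definition dot G (u v : V) : R := (u *m G *m v^T) 0 0.

Definition orthonormal_basis G (e : 'I_m -> V) : Prop :=
  forall i j, dot G (e i) (e j) = (i == j)%:R.

Definition form_dot (e : 'I_m -> V) (p : nat) a b : R :=
  (p`!%:R)^-1 * \sum_(t : p.-tuple 'I_m) a (map e t) * b (map e t).

Definition is_hodge G (vol : covariant V R) (p : nat) b c : Prop :=
  is_form (m - p) c /\
  forall e, orthonormal_basis G e -> forall a, is_form p a ->
    wedge p (m - p) a c = form_dot e p a b *: vol.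

(* The value 0 is never used when b is a p-form with p <= m. *)
Definition hodge G vol p b : covariant V R := xget 0 [set c | is_hodge G vol p b c].

(* Endomorphisms are matrices acting on the right of row vectors; they act on
   covariant tensors as derivations. *)
Definition derivation B a : covariant V R := fun s =>
  - \sum_(i < size s) a (set_nth 0 s i (s`_i *m B)).

Definition skew G B : Prop := forall u v, dot G (u *m B) v + dot G u (v *m B) = 0.

End Pointwise.

(** * Smooth manifolds, tensor fields and forms *)

Fixpoint Ck_on (R : realType) (V W : normedModType R) (k : nat) (U : set V)
    (f : V -> W) : Prop :=
  if k is k'.+1 then
    (forall x, U x -> differentiable f x) /\
    (forall v : V, Ck_on k' U (fun x => 'D_v f x))
  else forall x, U x -> {for x, continuous f}.

Definition smooth_on (R : realType) (V W : normedModType R) (U : set V)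
  (f : V -> W) : Prop := forall k, Ck_on k U f.

Record smooth_manifold (R : realType) (m : nat) := SmoothManifold {
  carrier : topologicalType;
  carrier_hausdorff : hausdorff_space carrier;
  carrier_second_countable : @second_countable carrier;
  chart_index : Type;
  dom : chart_index -> set carrier;
  chart : chart_index -> carrier -> 'rV[R]_m;
  chart_inv : chart_index -> 'rV[R]_m -> carrier;
  dom_open : forall c, open (dom c);
  dom_cover : forall p, exists c, dom c p;
  img_open : forall c, open (chart c @` dom c);
  chartK : forall c p, dom c p -> chart_inv c (chart c p) = p;
  chart_continuous : forall c p, dom c p -> {for p, continuous (chart c)};
  chart_inv_continuous : forall c x, (chart c @` dom c) x ->
    {for x, continuous (chart_inv c)};
  transition_smooth : forall c c',
    smooth_on (chart c @` (dom c `&` dom c')) (chart c' \o chart_inv c) }.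

Section Manifold.
Variables (R : realType) (m : nat) (M : smooth_manifold R m).
Local Notation V := 'rV[R]_m.

Definition img (c : chart_index M) : set V := chart c @` dom c.

Definition overlap (c c' : chart_index M) : set V :=
  chart c @` (dom c `&` dom c').

Definition transition (c c' : chart_index M) : V -> V := chart c' \o chart_inv c.

Definition tangent_transition c c' (x v : V) : V := 'D_v (transition c c') x.

(* Tensor fields are given by their expressions in all charts; only the values
   at the points of img c are meaningful. *)
Definition tensor_field := chart_index M -> V -> covariant V R.
Definition matrix_field := chart_index M -> V -> 'M[R]_m.
(* End(TM)-valued one-forms, and also the connection forms of linear
   connections: the endomorphism at x for the direction X is B c x X. *)
Definition endo_one_form := chart_index M -> V -> V -> 'M[R]_m.

Implicit Types (a b : tensor_field) (g J : matrix_field) (B : endo_one_form).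

Definition field_eq a b : Prop := forall c x, img c x -> a c x = b c x.

Definition differential_form (p : nat) a : Prop :=
  [/\ forall c x, img c x -> is_form p (a c x),
      forall c s, smooth_on (img c) (fun x => a c x s : R)
    & forall c c' x s, overlap c c' x ->
        a c x s = a c' (transition c c' x) (map (tangent_transition c c' x) s)].

Definition riemannian_metric g : Prop :=
  [/\ forall c, smooth_on (img c) (g c),
      forall c x, img c x -> (g c x)^T = g c x /\
        forall u : V, u != 0 -> 0 < dot (g c x) u u
    & forall c c' x u v, overlap c c' x ->
        dot (g c x) u v = dot (g c' (transition c c' x))
          (tangent_transition c c' x u) (tangent_transition c c' x v)].

Definition almost_complex_structure J : Prop :=
  [/\ forall c, smooth_on (img c) (J c),
      forall c x, img c x -> J c x *m J c x = - 1%:M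
    & forall c c' x u, overlap c c' x ->
        tangent_transition c c' x (u *m J c x) =
        tangent_transition c c' x u *m J c' (transition c c' x)].

Definition wedge_field p q a b : tensor_field := fun c x => wedge p q (a c x) (b c x).

(* (mu (x) a)(X, Y_1, ..., Y_p) = mu(X) a(Y_1, ..., Y_p) for a one-form mu. *)
Definition tensor_one mu a : tensor_field := fun c x s =>
  mu c x (take 1 s) * a c x (drop 1 s).

(* Invariant formula for d on the coordinate (hence commuting) vector fields
   of the chart. *)
Definition ext_d (p : nat) a : tensor_field := fun c x s =>
  if size s == p.+1 then
    \sum_(i < p.+1) (-1) ^+ i *
      'D_(s`_i) (fun y => a c y (take i s ++ drop i.+1 s) : R) x
  else 0.

Definition metric_tensor g : tensor_field := fun c x s =>
  if s is [:: u; v] then dot (g c x) u v else 0.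

(* Christoffel symbols: Y *m christoffel g c x X is nabla_X Y at x, for Y with
   constant components. Entry (j, k) of the first factor is
   <nabla_X d_j, d_k> = (X<d_j,d_k> + d_j<X,d_k> - d_k<X,d_j>) / 2. *)
Definition christoffel g : endo_one_form := fun c x X =>
  (\matrix_(j, k) (2^-1 * (('D_X (g c) x) j k
      + (X *m 'D_(delta_mx 0 j) (g c) x) 0 k
      - (X *m 'D_(delta_mx 0 k) (g c) x) 0 j))) *m invmx (g c x).

(* (B a)(X, Y_1, ..., Y_p) = (B_X a)(Y_1, ..., Y_p) *)
Definition act B a : tensor_field := fun c x s =>
  if s is X :: s' then derivation (B c x X) (a c x) s' else 0.

Definition covariant_derivative B a : tensor_field := fun c x s =>
  if s is X :: s' then
    'D_X (fun y => a c y s' : R) x + derivation (B c x X) (a c x) s'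
  else 0.

(* Covariant derivative of a field of endomorphisms. *)
Definition covariant_derivative_endo B J : endo_one_form := fun c x X =>
  'D_X (J c) x + (J c x *m B c x X - B c x X *m J c x).

End Manifold.

Notation "a =M b" := (field_eq a b) (at level 70, no associativity).

(** * SU(n)-structures *)

Section SUStructure.
Variables (R : realType) (n : nat) (M : smooth_manifold R (2 * n)).
Local Notation V := 'rV[R]_(2 * n).

(* The one-form e + i Ie, vectors being identified with one-forms by the
   metric. *)
Definition adapted_one_form (G J : 'M[R]_(2 * n)) (e : V) : covariant V R[i] :=
  fun s => if s is [:: u] then (dot G u e +i* dot G u (e *m J))%C else 0.

Definition adapted_frame (G J : 'M[R]_(2 * n)) (psip psim : covariant V R)
    (e : 'I_n -> V) : Prop :=
  [/\ forall i j, dot G (e i) (e j) = (i == j)%:R,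
      forall i j, dot G (e i *m J) (e j *m J) = (i == j)%:R,
      forall i j, dot G (e i) (e j *m J) = 0
    & forall s, (psip s +i* psim s)%C =
        wedge_oneforms [seq adapted_one_form G J (e i) | i <- enum 'I_n] s].

(* Psi has type (n, 0) and unit length at a point iff it has an adapted basis
   there; smooth local adapted frames then exist by smoothness of the tensors. *)
Record SU_structure := SUStructure {
  metric : matrix_field M;
  acs : matrix_field M;
  psi_plus : tensor_field M;
  psi_minus : tensor_field M;
  metric_riemannian : riemannian_metric metric;
  acs_almost_complex : almost_complex_structure acs;
  acs_orthogonal : forall c x, img c x -> forall u v,
    dot (metric c x) (u *m acs c x) (v *m acs c x) = dot (metric c x) u v;
  psi_plus_form : differential_form n psi_plus;
  psi_minus_form : differential_form n psi_minus;
  adapted_frame_exists : forall c x, img c x -> exists e,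
    adapted_frame (metric c x) (acs c x) (psi_plus c x) (psi_minus c x) e }.

Variable S : SU_structure.
Implicit Types (a mu eta : tensor_field M) (B tau : endo_one_form M).

Definition kaehler : tensor_field M := fun c x s =>
  if s is [:: u; v] then dot (metric S c x) u (v *m acs S c x) else 0.

(* (-1)^(n(n+1)/2) n! vol = omega^n *)
Definition vol : tensor_field M := fun c x =>
  ((-1) ^+ (n * n.+1)./2 / n`!%:R) *: wedge_exp 2 (kaehler c x) n.

Definition star (p : nat) a : tensor_field M := fun c x =>
  hodge (metric S c x) (vol c x) p (a c x).

Definition codiff (p : nat) a : tensor_field M :=
  - star (2 * n - p).+1 (ext_d (2 * n - p) (star p a)).

Definition I_one mu : tensor_field M := fun c x s =>
  - mu c x [seq u *m acs S c x | u <- s].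

Definition levi_civita : endo_one_form M := christoffel (metric S).

(* xi_X Y = - 1/2 I ((nabla_X I) Y) *)
Definition xi_tensor : endo_one_form M := fun c x X =>
  - 2^-1 *: (covariant_derivative_endo levi_civita (acs S) c x X *m acs S c x).

(* eta_X Y = (I eta)(X) I Y *)
Definition eta_tensor eta : endo_one_form M := fun c x X =>
  I_one eta c x [:: X] *: acs S c x.

Definition SU_connection B : Prop :=
  [/\ covariant_derivative B (metric_tensor (metric S)) =M 0,
      covariant_derivative B kaehler =M 0,
      covariant_derivative B (psi_plus S) =M 0
    & covariant_derivative B (psi_minus S) =M 0].

Definition in_su c (x : V) (A : 'M[R]_(2 * n)) : Prop :=
  [/\ skew (metric S c x) A,
      A *m acs S c x = acs S c x *m A,
      derivation A (psi_plus S c x) = 0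
    & derivation A (psi_minus S c x) = 0].

(* On skew endomorphisms the trace form is, up to sign, the inner product
   defining the orthogonal complement of su(n) in so(2n). *)
Definition in_su_orthogonal c (x : V) (A : 'M[R]_(2 * n)) : Prop :=
  skew (metric S c x) A /\ forall A', in_su c x A' -> \tr (A *m A') = 0.

(* levi_civita + tau is then the minimal SU(n)-connection; its difference with
   the Levi-Civita connection takes values in the orthogonal of su(n). *)
Definition intrinsic_torsion tau : Prop :=
  SU_connection (levi_civita + tau) /\
  forall c x X, img c x -> in_su_orthogonal c x (tau c x X).

Definition W5_part eta : Prop :=
  differential_form 1 eta /\ intrinsic_torsion (eta_tensor eta + xi_tensor).

End SUStructure.

(* Main.v *)
(** Contracting the formula for [*] gives, for an [(n+1)]-form [delta] and an
[n]-form [psi] in dimension [2n],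
  [*( *delta /\ psi)(u) = - <psi, u _| delta>].
Since the Levi-Civita connection is torsion-free and [nabla + tau], with
[tau = eta + xi], preserves [psi_b], one has
[d psi_b = - sum_i e_i /\ tau_{e_i} psi_b], so [<psi_a, u _| d psi_b>] is made of
[<psi_a, tau_u psi_b>] and [<e_i _| psi_a, u _| tau_{e_i} psi_b>].  Commuting [u _|]
with the derivation [tau_{e_i}] leaves the products [<X _| psi_a, Y _| psi_b>],
which are [2^(n-2) <X, Y>] for [a = b] and [+- 2^(n-2) <IX, Y>] otherwise, and the
numbers [<e_i _| psi_a, xi_{e_i} (u _| psi_b)>].  As [xi] anticommutes with [I], the
latter cancel in the combinations (++) + (--) and (+-) - (-+); when [n >= 3] there
is a slot left in which to rotate by [I], so that they also agree individually.
On the other side [*omega] is a constant multiple of [omega^(n-1)], hence parallel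
for [nabla + tau], and this yields [(d^*omega)(u) = 2 sum_i <I e_i, u xi_{e_i}>]. *)
Require Import Defs.
From mathcomp Require Import all_boot all_order all_algebra.
From mathcomp Require Import fingroup perm complex.
From mathcomp Require Import all_classical all_reals all_analysis.
From mathcomp Require Import ring lra zify.
Import Order.TTheory GRing.Theory Num.Theory.
Import numFieldNormedType.Exports.

Set Implicit Arguments.
Unset Strict Implicit.
Unset Printing Implicit Defensive.

Local Open Scope ring_scope.

(** * Exterior algebra by contraction *)

Section Contraction.
Variables (V : zmodType) (F : numFieldType).
Implicit Types a b c : covariant V F.

(** The factor 2^(n-2) starts from the complex identity <X _| Psi, Y _| Psi> = 2^(n-1) h(X, Y):
    pairing [e + i Ie] with a complex linear form counts the form twice. Its real part only gives
    the sum of the (++) and (--) products; when n >= 2 a free slot remains, and rotating the frame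
    by I there shows that the two halves are equal. The factor n comes from I acting on Psi, as a
    derivation, by the scalar -in, one -i for each slot. Two definitions resist direct use. [hodge]
    is a choice, so it is replaced by the contraction of [vol] with the form, computed in any
    orthonormal basis; the sign of the double star then rests on the vanishing of forms of degree m
    + 1. And d^*omega differentiates a star chosen separately at each point; this works because
    throughout a chart the star of omega is a fixed constant times a wedge power of omega, a
    polynomial in the entries of the metric and of I. Connection forms are not assumed linear in the
    direction, so where linearity is wanted it is recovered from that of a derivative. *)

Definition contract (u : V) a : covariant V F := fun s => a (u :: s).

Definition skewsym a : Prop := forall s1 u v s2,
  a (s1 ++ u :: v :: s2) = - a (s1 ++ v :: u :: s2).

Definition of_degree (p : nat) a : Prop := forall s, size s <> p -> a s = 0.

Lemma skewsym_contract u a : skewsym a -> skewsym (contract u a).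
Proof. by move=> ha s1 x y s2; apply: (ha (u :: s1)). Qed.

Lemma of_degree_contract p u a : of_degree p a -> of_degree p.-1 (contract u a).
Proof.
move=> ha s hs; apply: ha => /= hp; apply: hs; by rewrite -hp.
Qed.

Lemma skewsym_front a s1 u s2 : skewsym a ->
  a (s1 ++ u :: s2) = (-1) ^+ size s1 * a (u :: s1 ++ s2).
Proof.
move=> ha; elim: s1 a ha => [|x s1 IH] a ha /=; first by rewrite mul1r.
have := IH (contract x a) (skewsym_contract x ha); rewrite /contract => ->.
by rewrite (ha [::] x u) exprS mulrN mulN1r mulNr.
Qed.

Lemma skewsym_block a s1 s2 : skewsym a ->
  a (s1 ++ s2) = (-1) ^+ (size s1 * size s2) * a (s2 ++ s1).
Proof.
move=> ha; elim: s1 a ha s2 => [|u s1 IH] a ha s2; first by rewrite cats0 mul1r.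
have /= := IH (contract u a) (skewsym_contract u ha) s2.
rewrite /contract => ->; rewrite (skewsym_front s2 u s1 ha) /= mulSn exprD mulrA.
by congr (_ * _); rewrite mulrAC -signr_odd -expr2 sqrr_sign mul1r.
Qed.

(** The wedge sum without its factorials, with the total degree [N] decoupled from [p + q]: the
    recursion on [N] then needs no cast between symmetric groups. *)
Definition alt_sum (N p : nat) a b : covariant V F := fun s =>
  \sum_(sigma : 'S_N)
      (let t := [seq s`_(sigma i) | i <- enum 'I_N] in
       (-1) ^+ sigma * (a (take p t) * b (drop p t))).

(** [lift_perm i ord0 sigma] sends [i] to [ord0] and acts as [sigma] on the other points, so reading
    [u :: s] through it inserts [u] at position [i] of the word permuted by [sigma]. *)
Lemma seq_lift_perm N (i : 'I_N.+1) (sigma : 'S_N) (u : V) s :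
  [seq (u :: s)`_(lift_perm i ord0 sigma k) | k <- enum 'I_N.+1] =
  take i [seq s`_(sigma k) | k <- enum 'I_N] ++
  u :: drop i [seq s`_(sigma k) | k <- enum 'I_N].
Proof.
set t' := [seq s`_(sigma k) | k <- enum 'I_N].
have szt : size t' = N by rewrite size_map size_enum_ord.
have ltiN : (i <= N)%N by rewrite -ltnS.
apply: (@eq_from_nth _ 0).
  rewrite size_map size_enum_ord size_cat /= size_drop size_takel szt //; lia.
move=> k; rewrite size_map size_enum_ord => ltkN.
have nt j (ltj : (j < N)%N) : t'`_j = s`_(sigma (Ordinal ltj)).
  rewrite (nth_map (Ordinal ltj)) ?size_enum_ord //.
  by rewrite (nth_ord_enum (Ordinal ltj) (Ordinal ltj)).
rewrite (nth_map ord0) ?size_enum_ord // (nth_ord_enum ord0 (Ordinal ltkN)).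
rewrite nth_cat size_takel ?szt //.
case: (unliftP i (Ordinal ltkN)) => [j|] ek.
  rewrite ek lift_perm_lift /=.
  have {ek}: k = bump i j by rewrite -[k]/(val (Ordinal ltkN)) ek.
  rewrite /bump; case: (leqP i j) => ij /= ek.
    have {ek}-> : k = j.+1 by rewrite ek.
    rewrite ltnNge (leqW ij) /= subSn //= nth_drop subnKC //.
    by rewrite nt; congr (s`_(sigma _)); apply: val_inj.
  have {ek}-> : k = j by rewrite ek.
  rewrite ij nth_take // nt; congr (s`_(sigma _)); exact: val_inj.
rewrite ek lift_perm_id.
have -> : k = i :> nat by rewrite -ek.
by rewrite ltnn subnn.
Qed.

(** Permutations are sorted by the preimage [i] of [ord0]; removing that point leaves an arbitrary
    permutation of the [N] others. *)
Lemma sum_lift_perm N (f : 'S_N.+1 -> F) :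
  \sum_sigma f sigma = \sum_(i < N.+1) \sum_(sigma : 'S_N) f (lift_perm i ord0 sigma).
Proof.
rewrite (partition_big (fun s : 'S_N.+1 => (s^-1)%g ord0) xpredT) //=.
apply: eq_bigr => i _.
have ulP (s : 'S_N.+1) : (s^-1)%g ord0 == i -> s i = ord0.
  by move=> /eqP <-; rewrite permKV.
pose ulf (s : 'S_N.+1) k := odflt k (unlift ord0 (s (lift i k))).
have ulfK (s : 'S_N.+1) : s i = ord0 -> forall k, lift ord0 (ulf s k) = s (lift i k).
  move=> si k; rewrite /ulf; have:= neq_lift i k.
  by rewrite -(can_eq (permK s)) si => /unlift_some[] ? ? ->.
have ulf_inj (s : 'S_N.+1) : s i = ord0 -> injective (ulf s).
  move=> si k1 k2 /(congr1 (lift ord0)); rewrite !ulfK //.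
  by move=> /perm_inj; apply: lift_inj.
(* [perm] wants injectivity for every [s], so outside the class [s i = ord0] the identity is
   substituted. *)
have inj' (s : 'S_N.+1) : injective (fun k => if s i == ord0 then ulf s k else k).
  by case: eqP => [/ulf_inj//|_]; apply: inj_id.
rewrite (reindex (lift_perm i ord0)); last first.
  exists (fun s => perm (inj' s)) => s.
    by move=> _; apply/permP => k; rewrite permE /ulf lift_perm_id eqxx lift_perm_lift
      liftK.
  rewrite inE => /ulP si; apply/permP => k.
  case: (unliftP i k) => [k'|] ->; rewrite ?lift_perm_id //.
  by rewrite lift_perm_lift permE si eqxx ulfK.
apply: eq_bigl => s; rewrite lift_permV lift_perm_id; exact: eqxx.
Qed.

(** Each of the [p] positions of [u] in the block of [a] gives the same sum, because the sign of
    [lift_perm] is that of bringing [u] to the front. In the block of [b] the two signs differ by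
    (-1)^p, the cost of crossing the slots of [a]. *)
Lemma alt_sum_cons N p a b u s : skewsym a -> skewsym b -> size s = N ->
    (p <= N.+1)%N ->
  alt_sum N.+1 p a b (u :: s) = p%:R * alt_sum N p.-1 (contract u a) b s
     + (N.+1 - p)%:R * ((-1) ^+ p * alt_sum N p a (contract u b) s).
Proof.
move=> ha hb szs lepN; rewrite /alt_sum sum_lift_perm.
set A := \sum_(_ : 'S_N) _; set B := \sum_(_ : 'S_N) _.
transitivity (\sum_(i < N.+1) if (i < p)%N then A else (-1) ^+ p * B).
  apply: eq_bigr => i _; rewrite /A /B mulr_sumr.
  case: ifPn => [ltip|]; last rewrite -leqNgt => lepi; apply: eq_bigr => sigma _ /=;
    rewrite seq_lift_perm odd_lift_perm signr_addb addbF signr_odd;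
    set t := [seq s`_(sigma k) | k <- enum 'I_N];
    have szt : size t = N by [rewrite size_map size_enum_ord];
    have leiN : (i <= N)%N by [rewrite -ltnS];
    [|]; last first.
    rewrite takel_cat ?size_takel ?szt // take_takel //.
    have -> : drop p (take i t ++ u :: drop i t) =
              take (i - p) (drop p t) ++ u :: drop (i - p) (drop p t).
      rewrite drop_cat size_takel ?szt // take_drop drop_drop subnK //.
      (* At the boundary [i = p] the inserted vector is the first argument of [b]. *)
      case: ltnP => // leip; have /eqP epi : p == i by rewrite eqn_leq lepi leip.
      have epi0 : (p - i)%N = 0%N by rewrite epi subnn.
      by rewrite epi0 drop0 [X in _ = X ++ _]drop_oversize // size_takel ?szt // -epi.
    rewrite (skewsym_front _ u _ hb) cat_take_drop.
    rewrite size_takel; last by rewrite size_drop szt leq_sub2r.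
    rewrite /contract.
    have -> : (-1) ^+ i = (-1) ^+ p * (-1) ^+ (i - p) :> F by rewrite -exprD subnKC.
    have := sqrr_sign F (i - p); rewrite expr2.
    move: ((-1) ^+ (i - p)) ((-1) ^+ p) ((-1) ^+ sigma) (a _) (b _) => x y z v w e.
    transitivity (x * x * (y * z * (v * w))); first by ring.
    by rewrite e; ring.
  rewrite take_cat drop_cat size_takel ?szt // ltnNge (ltnW ltip) /=.
  have -> : (p - i)%N = (p.-1 - i).+1 by lia.
  rewrite /= (skewsym_front _ u _ ha) size_takel ?szt // take_drop subnK; last by lia.
  have -> : take i t = take i (take p.-1 t) by rewrite take_takel //; lia.
  rewrite cat_take_drop drop_drop subnK; last by lia.
  have := sqrr_sign F i; rewrite expr2 /contract.
  move: ((-1) ^+ i) ((-1) ^+ sigma) (a _) (b _) => x y z v e.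
  transitivity (x * x * (y * (z * v))); first by ring.
  by rewrite e; ring.
rewrite -(big_mkord xpredT (fun i => if (i < p)%N then A else (-1) ^+ p * B)).
rewrite (big_cat_nat (leq0n p) lepN) /=; congr (_ + _).
  rewrite -[p in _ = p%:R * _]subn0 -sumr_const_nat mulr_suml.
  by apply: eq_big_nat => i /andP[_ ->]; rewrite mul1r.
rewrite -sumr_const_nat mulr_suml; apply: eq_big_nat => i /andP[lpi _].
by rewrite ltnNge lpi mul1r.
Qed.
End Contraction.

Section Wedge.
Variables (V : zmodType) (F : numFieldType).
Implicit Types a b c : covariant V F.

Lemma wedgeE p q a b s : size s = (p + q)%N ->
  wedge p q a b s = ((p`! * q`!)%:R)^-1 * alt_sum (p + q) p a b s.
Proof. by move=> hs; rewrite /wedge hs eqxx. Qed.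

Lemma of_degree_wedge p q a b : of_degree (p + q) (wedge p q a b).
Proof. by move=> s /eqP; rewrite /wedge => /negPf ->. Qed.

Lemma wedge00 a b : wedge 0 0 a b [::] = a [::] * b [::].
Proof.
rewrite wedgeE //= /alt_sum mul1n invr1 mul1r (bigD1 (1%g : 'S_0)) //=.
rewrite big1 ?addr0; last by move=> s /eqP[]; apply/permP => -[].
rewrite odd_perm1 mul1r; congr (a _ * b _).
  by rewrite take0.
by rewrite drop0 (size0nil (s := map _ _)) // size_map size_enum_ord.
Qed.

(* The Leibniz rule for contraction.  Every later fact about [wedge] follows from it
   by induction on the degree, without permutations. *)
Lemma wedge_cons p q a b u s : skewsym a -> skewsym b ->
  wedge p q a b (u :: s) = (0 < p)%N%:R * wedge p.-1 q (contract u a) b s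
    + (0 < q)%N%:R * ((-1) ^+ p * wedge p q.-1 a (contract u b) s).
Proof.
move=> ha hb; have [e|ne] := eqVneq (size s).+1 (p + q)%N; last first.
  rewrite of_degree_wedge; last by apply/eqP.
  case: p q ne => [|p] [|q] ne /=; rewrite ?mul0r ?addr0 ?add0r ?mul1r //.
  - by rewrite of_degree_wedge ?mulr0 //; move=> e; rewrite e eqxx in ne.
  - by rewrite of_degree_wedge //; move=> e; rewrite e !addn0 eqxx in ne.
  rewrite !of_degree_wedge ?mulr0 ?addr0 //; move=> e; move: ne;
    by rewrite e ?addSn ?addnS eqxx.
rewrite wedgeE // -e alt_sum_cons //; last by rewrite e leq_addr.
rewrite mulrDr; congr (_ + _).
  case: p e => [|p] e /=; first by rewrite !mul0r mulr0.
  rewrite wedgeE; last by apply: succn_inj; rewrite e.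
  have -> : size s = (p + q)%N by apply: succn_inj; rewrite e.
  rewrite mul1r mulrA factS; congr (_ * _).
  rewrite -mulnA natrM invfM mulrAC mulVf ?mul1r ?pnatr_eq0 //.
rewrite e addKn.
case: q e => [|q] e /=; first by rewrite !mul0r mulr0.
rewrite wedgeE; last by apply: succn_inj; rewrite e addnS.
have -> : size s = (p + q)%N by apply: succn_inj; rewrite e addnS.
rewrite mul1r factS !natrM; move: ((-1) ^+ p) (alt_sum _ _ _ _ _) => x W.
have hp : p`!%:R != 0 :> F by rewrite pnatr_eq0 -lt0n fact_gt0.
have hq : q`!%:R != 0 :> F by rewrite pnatr_eq0 -lt0n fact_gt0.
have hq1 : q.+1%:R != 0 :> F by rewrite pnatr_eq0.
by move: hp hq hq1; move: (p`!%:R) (q`!%:R) (q.+1%:R) => y z w *; field; apply/and3P.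
Qed.

Lemma wedgeDl p q a a' b s :
  wedge p q (fun t => a t + a' t) b s = wedge p q a b s + wedge p q a' b s.
Proof.
rewrite /wedge; case: ifP => _; last by rewrite addr0.
rewrite -mulrDr -big_split /=; congr (_ * _); apply: eq_bigr => sigma _.
by rewrite mulrDl mulrDr.
Qed.

Lemma wedgeDr p q a b b' s :
  wedge p q a (fun t => b t + b' t) s = wedge p q a b s + wedge p q a b' s.
Proof.
rewrite /wedge; case: ifP => _; last by rewrite addr0.
rewrite -mulrDr -big_split /=; congr (_ * _); apply: eq_bigr => sigma _.
by rewrite -!mulrDr.
Qed.

Lemma wedgeZl p q k a b s : wedge p q (fun t => k * a t) b s = k * wedge p q a b s.
Proof.
rewrite /wedge; case: ifP => _; last by rewrite mulr0.
rewrite mulrCA; congr (_ * _); rewrite mulr_sumr; apply: eq_bigr => sigma _.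
by rewrite -mulrA mulrCA.
Qed.

Lemma wedgeZr p q k a b s : wedge p q a (fun t => k * b t) s = k * wedge p q a b s.
Proof.
rewrite /wedge; case: ifP => _; last by rewrite mulr0.
rewrite mulrCA; congr (_ * _); rewrite mulr_sumr; apply: eq_bigr => sigma _.
by rewrite [a _ * _]mulrCA [LHS]mulrCA.
Qed.

Lemma wedgeNl p q a b s : wedge p q (fun t => - a t) b s = - wedge p q a b s.
Proof.
rewrite -mulN1r -wedgeZl; congr (wedge _ _ _ _ _).
by apply/funext => t; rewrite mulN1r.
Qed.

Lemma wedgeNr p q a b s : wedge p q a (fun t => - b t) s = - wedge p q a b s.
Proof.
rewrite -mulN1r -wedgeZr; congr (wedge _ _ _ _ _).
by apply/funext => t; rewrite mulN1r.
Qed.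

Lemma wedge0r p q a s : wedge p q a (fun=> 0) s = 0.
Proof.
rewrite /wedge; case: ifP => _ //; rewrite big1 ?mulr0 // => sigma _.
by rewrite !mulr0.
Qed.

Lemma contract_swap a u v : skewsym a -> contract u (contract v a) = fun s => - contract
  v (contract u a) s.
Proof. by move=> ha; apply/funext => s; apply: (ha [::] v u s). Qed.

Lemma skewsym_cons a : (forall u, skewsym (contract u a)) ->
  (forall u v s, a (u :: v :: s) = - a (v :: u :: s)) -> skewsym a.
Proof. by move=> h1 h2 [|x s1] u v s2; [apply: h2 | apply: (h1 x s1)]. Qed.

Lemma skewsymD a b : skewsym a -> skewsym b -> skewsym (fun s => a s + b s).
Proof. by move=> ha hb s1 u v s2; rewrite (ha s1 u v) (hb s1 u v) opprD. Qed.

Lemma skewsymZ k a : skewsym a -> skewsym (fun s => k * a s).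
Proof. by move=> ha s1 u v s2; rewrite (ha s1 u v) mulrN. Qed.

Lemma skewsym_if (P : bool) a : (P -> skewsym a) -> skewsym (fun s => P%:R * a s).
Proof.
by case: P => [/(_ isT)/(skewsymZ 1)//|_] s1 u v s2; rewrite !mul0r oppr0.
Qed.

Lemma contract_wedge p q a b u : skewsym a -> skewsym b ->
  contract u (wedge p q a b) = fun s => (0 < p)%N%:R * wedge p.-1 q (contract u a) b s
    + (0 < q)%N%:R * ((-1) ^+ p * wedge p q.-1 a (contract u b) s).
Proof. by move=> ha hb; apply/funext => s; apply: wedge_cons. Qed.

(** Two contractions leave mixed terms with one vector in each factor; their signs (-1)^p and
    (-1)^(p-1) are opposite, which gives antisymmetry in the first two slots. The induction is on
    [p + q] since either degree may drop. *)
Lemma skewsym_wedge p q a b : skewsym a -> skewsym b -> skewsym (wedge p q a b).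
Proof.
have [N] := ubnP (p + q); elim: N p q a b => // N IH p q a b leN ha hb.
apply: skewsym_cons => [u|u v s].
  rewrite contract_wedge //; apply: skewsymD; apply: skewsym_if => h.
    by apply: IH; [lia | exact: skewsym_contract | ].
  by apply: skewsymZ; apply: IH; [lia | | exact: skewsym_contract].
have hia w := skewsym_contract w ha; have hib w := skewsym_contract w hb.
rewrite !wedge_cons // (contract_swap v u ha) (contract_swap v u hb) wedgeNl wedgeNr.
case: p {leN} => [|[|p]]; case: q => [|[|q]];
  rewrite /= ?exprS ?expr0 ?mulN1r; ring.
Qed.

Lemma wedge0l q a b s : of_degree q b -> skewsym a -> skewsym b ->
  wedge 0 q a b s = a [::] * b s.
Proof.
move=> hq ha hb; have [e|/eqP ne] := eqVneq (size s) q; last first.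
  by rewrite of_degree_wedge // hq ?mulr0.
elim: q b s hq hb e => [|r IH] c s hq hb /eqP.
  by rewrite size_eq0 => /eqP ->; rewrite wedge00.
case: s => // x s /eqP [e]; rewrite wedge_cons //= mul0r !mul1r add0r.
by rewrite IH //; [exact: (of_degree_contract (p := r.+1)) | exact: skewsym_contract].
Qed.

Lemma wedge_sumr p q a (I : finType) (b : I -> covariant V F) s :
  wedge p q a (fun t => \sum_i b i t) s = \sum_i wedge p q a (b i) s.
Proof.
rewrite /wedge; case: ifP => _; last by rewrite big1.
rewrite -mulr_sumr exchange_big; congr (_ * _); apply: eq_bigr => sigma _.
by rewrite !mulr_sumr.
Qed.

End Wedge.

(** * Alternation of a family of forms over its direction *)

Section Alternation.
Variables (V : zmodType) (F : numFieldType).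
Implicit Types (a b c : covariant V F) (f : V -> covariant V F).

(* [sum_i e_i /\ f (e_i)], the shape of [ext_d]. *)
Definition alt1 (p : nat) f : covariant V F := fun s =>
  if size s == p.+1 then
    \sum_(i < p.+1) (-1) ^+ i * f s`_i (take i s ++ drop i.+1 s)
  else 0.

Lemma of_degree_alt1 p f : of_degree p.+1 (alt1 p f).
Proof. by move=> s /eqP; rewrite /alt1 => /negPf ->. Qed.

(** The counterpart of [wedge_cons] for [alt1]: the term i = 0 splits off, and the others acquire a
    minus sign from the shift of the index. *)
Lemma alt1_cons p f u s : (forall v, of_degree p (f v)) ->
  alt1 p f (u :: s) = f u s - (0 < p)%N%:R * alt1 p.-1 (fun v => contract u (f v)) s.
Proof.
move=> hf; rewrite /alt1 /= eqSS; case: eqP => [e|ne]; last first.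
  rewrite hf // sub0r; case: p ne {hf} => [|p] ne /=; first by rewrite mul0r oppr0.
  by case: eqP => [e|]; [case: ne | rewrite mulr0 oppr0].
rewrite big_ord_recl /= mul1r drop0; congr (_ + _).
case: p e {hf} => [|p] e /=; first by rewrite big_ord0 mul0r oppr0.
rewrite e eqxx mul1r -sumrN; apply: eq_bigr => i _.
by rewrite /contract /= exprS mulN1r mulNr.
Qed.

Lemma eq_alt1 p f g s : (forall v t, f v t = g v t) -> alt1 p f s = alt1 p g s.
Proof. by move=> h; rewrite /alt1; case: ifP => // _; apply: eq_bigr => i _;
  rewrite h. Qed.

Lemma alt1D p f g s : alt1 p (fun v t => f v t + g v t) s = alt1 p f s + alt1 p g s.
Proof.
rewrite /alt1; case: ifP => _; last by rewrite addr0.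
by rewrite -big_split; apply: eq_bigr => i _; rewrite mulrDr.
Qed.

Lemma alt1Z p k f s : alt1 p (fun v t => k * f v t) s = k * alt1 p f s.
Proof.
rewrite /alt1; case: ifP => _; last by rewrite mulr0.
by rewrite mulr_sumr; apply: eq_bigr => i _; rewrite mulrCA.
Qed.

(** Euler's identity: bringing any one of the p + 1 slots to the front gives back [a]. *)
Lemma alt1_contract p a s : skewsym a -> of_degree p.+1 a ->
  alt1 p (fun v => contract v a) s = p.+1%:R * a s.
Proof.
move=> ha hp; rewrite /alt1; case: eqP => [e|ne]; last by rewrite hp ?mulr0.
have -> : p.+1%:R * a s = \sum_(i < p.+1) a s.
  by rewrite sumr_const card_ord mulr_natl.
apply: eq_bigr => i _; have lti : (i < size s)%N by rewrite e.
rewrite -[in RHS](cat_take_drop i s) (drop_nth 0 lti) skewsym_front //.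
by rewrite size_takel // ltnW.
Qed.

Lemma skewsym_alt1 p f : (forall v, skewsym (f v)) -> (forall v, of_degree p (f v)) ->
  skewsym (alt1 p f).
Proof.
elim: p f => [|p IH] f hs hd; apply: skewsym_cons => [u|u v s].
- by move=> s1 x y s2; rewrite /contract !of_degree_alt1 ?oppr0 //= size_cat /=; lia.
- by rewrite !of_degree_alt1 ?oppr0.
- have -> : contract u (alt1 p.+1 f) =
     fun s => f u s + (-1) * alt1 p (fun v => contract u (f v)) s.
    by apply/funext => s; rewrite /contract alt1_cons // mul1r mulN1r.
  apply: skewsymD => //; apply: skewsymZ; apply: IH => v; first exact: skewsym_contract.
  exact: (of_degree_contract (p := p.+1)).
have hd' w x : of_degree p (contract w (f x))
  by exact: (of_degree_contract (p := p.+1)).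
rewrite !(alt1_cons _ _ hd) !mul1r !(alt1_cons _ _ (hd' _)).
have -> : alt1 p.-1 (fun x => contract u (contract v (f x))) s =
  - alt1 p.-1 (fun x => contract v (contract u (f x))) s.
  rewrite -mulN1r -alt1Z; apply: eq_alt1 => x t.
  by rewrite (contract_swap u v (hs x)) mulN1r.
by rewrite /contract; ring.
Qed.

Lemma wedge_alt1 q a b s : of_degree q b -> skewsym a -> skewsym b ->
  wedge 1 q a b s = alt1 q (fun v t => a [:: v] * b t) s.
Proof.
move=> hq ha hb; elim: q b hq hb s => [|q IH] b hq hb [|u s].
- by rewrite of_degree_wedge // of_degree_alt1.
- rewrite wedge_cons // alt1_cons; last by move=> v t /hq ->; rewrite mulr0.
  rewrite /= !mul1r !mul0r addr0 subr0.
  case: s => [|x s]; last by rewrite of_degree_wedge // hq ?mulr0.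
  by rewrite wedge00.
- by rewrite of_degree_wedge // of_degree_alt1.
rewrite wedge_cons // alt1_cons; last by move=> v t /hq ->; rewrite mulr0.
rewrite /= !mul1r expr1 mulN1r IH;
  [ | exact: (of_degree_contract (p := q.+1)) | exact: skewsym_contract].
congr (_ - _).
by rewrite wedge0l //; exact: skewsym_contract.
Qed.

Lemma alt1_sum p (I : finType) (f : I -> V -> covariant V F) s :
  alt1 p (fun v t => \sum_i f i v t) s = \sum_i alt1 p (f i) s.
Proof.
rewrite /alt1; case: ifP => _; last by rewrite big1.
by rewrite exchange_big; apply: eq_bigr => i _; rewrite mulr_sumr.
Qed.

End Alternation.

(** * Inner product of forms as iterated sums over a frame *)

Section FrameSums.
Variables (V : zmodType) (F : numFieldType) (m : nat) (E : 'I_m -> V).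
Implicit Types (a b c : covariant V F) (f g : seq V -> F).

(* [form_dot] with its sum over tuples iterated, which allows induction on the degree. *)
Fixpoint tsum (p : nat) f : F :=
  if p is p'.+1 then \sum_i tsum p' (fun s => f (E i :: s)) else f [::].

Definition fdot p a b : F := (p`!%:R)^-1 * tsum p (fun s => a s * b s).

Lemma eq_tsum p f g : (forall s, size s = p -> f s = g s) -> tsum p f = tsum p g.
Proof.
elim: p f g => [|p IH] f g h /=; first exact: h.
by apply: eq_bigr => i _; apply: IH => s e; apply: h; rewrite /= e.
Qed.

Lemma tsumD p f g : tsum p (fun s => f s + g s) = tsum p f + tsum p g.
Proof.
elim: p f g => //= p IH f g; rewrite -big_split; apply: eq_bigr => i _; exact: IH.
Qed.

Lemma tsumZ p k f : tsum p (fun s => k * f s) = k * tsum p f.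
Proof.
elim: p f => //= p IH f; rewrite mulr_sumr; apply: eq_bigr => i _; exact: IH.
Qed.

Lemma tsum_sum p (I : finType) (f : I -> seq V -> F) :
  tsum p (fun s => \sum_i f i s) = \sum_i tsum p (f i).
Proof.
elim: p f => //= p IH f; rewrite exchange_big; apply: eq_bigr => i _; exact: IH.
Qed.

Lemma tsum_exchange p q (f : seq V -> seq V -> F) :
  tsum p (fun s => tsum q (fun t => f s t)) = tsum q (fun t => tsum p (fun s => f s t)).
Proof.
elim: p f => //= p IH f; rewrite tsum_sum; apply: eq_bigr => i _; exact: IH.
Qed.

Lemma fdotC p a b : fdot p a b = fdot p b a.
Proof. by rewrite /fdot; apply: congr1; apply: eq_tsum => s _; rewrite mulrC. Qed.

Lemma fdot0 a b : fdot 0 a b = a [::] * b [::].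
Proof. by rewrite /fdot /= invr1 mul1r. Qed.

Lemma fdotS p a b :
  fdot p.+1 a b = p.+1%:R^-1 * \sum_i fdot p (contract (E i) a) (contract (E i) b).
Proof. by rewrite /fdot /= factS natrM invfM -mulr_sumr mulrA. Qed.

Lemma eq_fdot p a a' b b' : (forall s, size s = p -> a s = a' s) ->
  (forall s, size s = p -> b s = b' s) -> fdot p a b = fdot p a' b'.
Proof. by move=> h1 h2; rewrite /fdot; apply: congr1; apply: eq_tsum => s e;
  rewrite h1 ?h2. Qed.

Lemma fdotDr p a b c : fdot p a (fun s => b s + c s) = fdot p a b + fdot p a c.
Proof.
rewrite /fdot -mulrDr -tsumD; apply: congr1; apply: eq_tsum => s _; exact: mulrDr.
Qed.

Lemma fdotDl p a b c : fdot p (fun s => a s + b s) c = fdot p a c + fdot p b c.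
Proof. by rewrite fdotC fdotDr !(fdotC _ c). Qed.

Lemma fdotZr p k a b : fdot p a (fun s => k * b s) = k * fdot p a b.
Proof.
rewrite /fdot [RHS]mulrCA -[in RHS]tsumZ; apply: congr1; apply: eq_tsum => s _;
  exact: mulrCA.
Qed.

Lemma fdotZl p k a b : fdot p (fun s => k * a s) b = k * fdot p a b.
Proof. by rewrite fdotC fdotZr fdotC. Qed.

Lemma fdot0r p a : fdot p a (fun=> 0) = 0.
Proof.
by rewrite -[RHS](mul0r (fdot p a (fun=> 0))) -fdotZr; apply: eq_fdot => // s _;
  rewrite mul0r.
Qed.

Lemma fdotNr p a b : fdot p a (fun s => - b s) = - fdot p a b.
Proof. by rewrite -mulN1r -fdotZr; apply: eq_fdot => // s _; rewrite mulN1r. Qed.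

Lemma fdotNl p a b : fdot p (fun s => - a s) b = - fdot p a b.
Proof. by rewrite fdotC fdotNr fdotC. Qed.

Lemma fdot_sumr p a (I : finType) (b : I -> covariant V F) :
  fdot p a (fun s => \sum_i b i s) = \sum_i fdot p a (b i).
Proof.
rewrite /fdot -mulr_sumr -tsum_sum; apply: congr1; apply: eq_tsum => s _.
exact: mulr_sumr.
Qed.

Lemma fdot_exchange p q a b (c : seq V -> seq V -> F) :
  fdot p a (fun s => fdot q b (fun t => c s t)) =
  fdot q b (fun t => fdot p a (fun s => c s t)).
Proof.
rewrite /fdot.
under [X in _ * X = _]eq_tsum => s _ do rewrite mulrCA -tsumZ.
under [X in _ = _ * X]eq_tsum => s _ do rewrite mulrCA -tsumZ.
rewrite !tsumZ mulrCA; congr (_ * (_ * _)); rewrite tsum_exchange.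
by apply: eq_tsum => s _; apply: eq_tsum => t _; rewrite mulrCA.
Qed.

Lemma sum_fdot_contract p a b :
  \sum_i fdot p (contract (E i) a) (contract (E i) b) = p.+1%:R * fdot p.+1 a b.
Proof. by rewrite fdotS mulrA mulfV ?mul1r // pnatr_eq0. Qed.

(** Wedging with [a] is adjoint to inserting [a] into the first slots. The first slot of the product
    goes to [a] or to [b]; the induction hypothesis weights these cases by p and q, which add up to
    the p + q of [fdotS]. *)
Lemma fdot_wedge p q a b c : skewsym a -> skewsym b -> skewsym c ->
  fdot (p + q) (wedge p q a b) c =
  fdot p a (fun s => fdot q b (fun t => c (s ++ t))).
Proof.
have [N] := ubnP (p + q); elim: N p q a b c => // N IH p q a b c leN ha hb hc.
have [e|pos] := posnP (p + q).
  by case: p q e {leN} => [|p] [|q] //= _; rewrite !fdot0 wedge00 mulrA.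
have [M eM] : exists M, M.+1 = (p + q)%N by exists (p + q).-1; rewrite prednK.
move: {pos} leN; rewrite -eM fdotS => leN.
have pq1 : (p + q)%:R != 0 :> F by rewrite pnatr_eq0 -eM.
apply: (canLR (mulKf _)); first by rewrite eM.
rewrite eM natrD mulrDl.
under eq_bigr => i _ do rewrite contract_wedge // fdotDl !fdotZl.
have e2 (x y z : F) (f g : 'I_m -> F) :
    \sum_i (x * f i + y * (z * g i)) = x * \sum_i f i + y * (z * \sum_i g i).
  by rewrite big_split /= !mulr_sumr.
rewrite {}e2; congr (_ + _).
  case: p eM leN pq1 => [|p] eM leN pq1 /=; first by rewrite !mul0r.
  rewrite mul1r -sum_fdot_contract; apply: eq_bigr => i _.
  have -> : M = (p + q)%N by apply: succn_inj; rewrite eM.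
  by rewrite IH //; try exact: skewsym_contract; lia.
case: q eM leN pq1 => [|q] eM leN pq1 /=; first by rewrite !mul0r.
rewrite mul1r fdot_exchange -sum_fdot_contract mulr_sumr; apply: eq_bigr => i _.
have -> : M = (p + q)%N by apply: succn_inj; rewrite eM addnS.
rewrite IH //; try exact: skewsym_contract; last by lia.
rewrite fdot_exchange -fdotZr; apply: eq_fdot => // t _.
rewrite -fdotZr; apply: eq_fdot => // s es; rewrite /contract.
by rewrite skewsym_front // es.
Qed.

(** Contraction as the adjoint of exterior multiplication. In the inductive step to degree p + 2 the
    first slot yields the wanted sum once, and the remaining slots, after exchanging two
    contractions of [c], yield it p + 1 times more. *)
Lemma fdot_alt1 p (f : V -> covariant V F) c : (forall v, of_degree p (f v)) ->
  skewsym c -> fdot p.+1 (alt1 p f) c = \sum_i fdot p (f (E i)) (contract (E i) c).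
Proof.
elim: p f c => [|p IH] f c hf hc; rewrite fdotS.
  rewrite invr1 mul1r; apply: eq_bigr => i _; apply: eq_fdot => // s _.
  by rewrite /contract alt1_cons // mul0r subr0.
apply: (canLR (mulKf _)); first by rewrite pnatr_eq0.
transitivity (\sum_i fdot p.+1 (f (E i)) (contract (E i) c) -
              \sum_i fdot p.+1 (alt1 p (fun v => contract (E i) (f v)))
                (contract (E i) c)).
  rewrite -sumrB; apply: eq_bigr => i _; rewrite -fdotNl -fdotDl.
  by apply: eq_fdot => // s _; rewrite {1}/contract alt1_cons // mul1r.
have e i : fdot p.+1 (alt1 p (fun v => contract (E i) (f v))) (contract (E i) c) =
    - \sum_j fdot p (contract (E i) (f (E j))) (contract (E i) (contract (E j) c)).
  rewrite IH;
    [|by move=> v; exact: (of_degree_contract (p := p.+1))|exact: skewsym_contract].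
  by rewrite -sumrN; apply: eq_bigr => j _; rewrite (contract_swap (E j) (E i) hc)
    fdotNr.
under [X in _ - X]eq_bigr => i _ do rewrite e.
rewrite sumrN opprK exchange_big /=.
under [X in _ + X]eq_bigr => i _ do rewrite sum_fdot_contract.
by rewrite -[p.+2]add1n natrD mulrDl mul1r mulr_sumr.
Qed.

End FrameSums.

(** * Alternating forms and the derivations given by endomorphisms *)

Section Forms.
Variables (R : realType) (m : nat).
Local Notation V := 'rV[R]_m.
Implicit Types (a b c : covariant V R) (A G : 'M[R]_m).

Definition lin1 (f : V -> R) : Prop := forall k u v, f (k *: u + v) = k * f u + f v.

Lemma lin1_0 f : lin1 f -> f 0 = 0.
Proof. by move=> /(_ (-1) 0 0); rewrite scaler0 addr0 mulN1r addNr. Qed.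

Lemma lin1D f u v : lin1 f -> f (u + v) = f u + f v.
Proof. by move=> /(_ 1 u v); rewrite scale1r mul1r. Qed.

Lemma lin1Z f k u : lin1 f -> f (k *: u) = k * f u.
Proof. by move=> h; have := h k u 0; rewrite addr0 (lin1_0 h) addr0. Qed.

Lemma lin1N f u : lin1 f -> f (- u) = - f u.
Proof. by move=> h; rewrite -scaleN1r lin1Z // mulN1r. Qed.

Lemma lin1_sum f (I : finType) (g : I -> V) : lin1 f -> f (\sum_i g i) = \sum_i f (g i).
Proof.
move=> h; apply: (big_morph f); last exact: lin1_0.
by move=> u v; apply: lin1D.
Qed.

Lemma lin1_scale f l : lin1 f -> lin1 (fun u => l * f u).
Proof. by move=> h c u v; rewrite h mulrDr mulrCA. Qed.

Lemma lin1_opp f : lin1 f -> lin1 (fun u => - f u).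
Proof. by move=> h c u v; rewrite h opprD mulrN. Qed.

Lemma form_of_degree p a : is_form p a -> of_degree p a.
Proof. by case. Qed.

Lemma form_lin1 p a s1 s2 : is_form p a -> lin1 (fun u => a (s1 ++ u :: s2)).
Proof.
case=> h1 h2 _ k u v; have [e|/eqP ne] := eqVneq (size s1 + size s2).+1 p.
  exact: h2.
by rewrite !h1 ?mulr0 ?addr0 // size_cat /= addnS.
Qed.

Lemma form_lin1_hd p a s : is_form p a -> lin1 (fun u => a (u :: s)).
Proof. exact: (form_lin1 [::]). Qed.

Lemma form_lin1_snd p a u s : is_form p a -> lin1 (fun v => a (u :: v :: s)).
Proof. exact: (form_lin1 [:: u]). Qed.

Lemma form_skewsym p a : is_form p a -> skewsym a.
Proof.
move=> ha s1 u v s2; case: (ha) => _ _ h3.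
have := h3 s1 [::] s2 (u + v) => /=.
rewrite (lin1D _ _ (form_lin1 s1 (u + v :: s2) ha)).
have l w := form_lin1 (rcons s1 w) s2 ha.
have := lin1D u v (l u); have := lin1D u v (l v); rewrite /= !cat_rcons => -> ->.
have /= -> := h3 s1 [::] s2 u; have /= -> := h3 s1 [::] s2 v.
by rewrite add0r addr0 => /eqP; rewrite addr_eq0 => /eqP.
Qed.

Lemma form_contract p u a : is_form p.+1 a -> is_form p (contract u a).
Proof.
case=> h1 h2 h3; split => [s hs|s1 s2 k x y hs|s1 s2 s3 x].
- by apply: h1 => -[].
- by apply: (h2 (u :: s1)); rewrite /= addSn hs.
exact: (h3 (u :: s1)).
Qed.

(** The criterion used to build forms by induction on the degree. Vanishing on two equal leading
    vectors gives the sign under exchange of the first two slots; this moves a repeated vector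
    behind the first slot, where the contraction takes over. *)
Lemma is_form_cons p a : of_degree p.+1 a -> (forall u, is_form p (contract u a)) ->
  (forall s, lin1 (fun u => a (u :: s))) -> (forall u s, a (u :: u :: s) = 0) ->
  is_form p.+1 a.
Proof.
move=> hd hi hl h0; split => // [[|x s1] s2 k u v hs /=|].
- exact: hl.
- by case: (hi x) => _ h _; apply: h; case: hs.
case=> [|x s1] s2 s3 u /=; last by case: (hi x) => _ _; apply.
case: s2 => [|x s2] /=; first exact: h0.
have sw v w s : a (v :: w :: s) = - a (w :: v :: s).
  have := h0 (v + w) s; rewrite (lin1D v w (hl _)).
  have lw y : lin1 (fun z => a (y :: z :: s)) by exact: (form_lin1_hd s (hi y)).
  rewrite (lin1D v w (lw v)) (lin1D v w (lw w)) !h0 add0r addr0 => /eqP.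
  by rewrite addr_eq0 => /eqP.
by rewrite sw; case: (hi x) => _ _ /(_ [::] s2 s3 u) /=; rewrite /contract => ->;
  rewrite oppr0.
Qed.

Lemma is_form_cst p : is_form p ((fun=> 0) : covariant V R).
Proof. by split=> // *; rewrite mulr0 addr0. Qed.

Lemma is_formD p a b : is_form p a -> is_form p b -> is_form p (fun s => a s + b s).
Proof.
case=> h1 h2 h3 [g1 g2 g3]; split=> [s hs|s1 s2 k u v hs|s1 s2 s3 u].
- by rewrite h1 ?g1 ?addr0.
- by rewrite h2 ?g2 // mulrDr addrACA.
by rewrite h3 g3 addr0.
Qed.

Lemma is_formZ p k a : is_form p a -> is_form p (fun s => k * a s).
Proof.
case=> h1 h2 h3; split=> [s hs|s1 s2 l u v hs|s1 s2 s3 u].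
- by rewrite h1 ?mulr0.
- by rewrite h2 // mulrDr mulrCA.
by rewrite h3 mulr0.
Qed.

Lemma is_formN p a : is_form p a -> is_form p (fun s => - a s).
Proof.
move=> /(is_formZ (-1)); have -> // : (fun s => -1 * a s) = (fun s => - a s).
by apply/funext => s; rewrite mulN1r.
Qed.

Lemma is_form0 a : of_degree 0 a -> is_form 0 a.
Proof. by move=> h; split=> // s1 s2 s3 u; rewrite h // size_cat /= addnS. Qed.

Lemma is_form_wedge p q a b : is_form p a -> is_form q b ->
  is_form (p + q) (wedge p q a b).
Proof.
have [N] := ubnP (p + q); elim: N p q a b => // N IH p q a b leN ha hb.
have hsa := form_skewsym ha; have hsb := form_skewsym hb.
have hd := @of_degree_wedge _ _ p q a b.
have [e|pos] := posnP (p + q); first by move: hd; rewrite e; apply: is_form0.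
have [M eM] : exists M, (p + q)%N = M.+1 by exists (p + q).-1; rewrite prednK.
have ifF (P : bool) r c : (P -> is_form r c) -> is_form r (fun s => P%:R * c s).
  case: P => [/(_ isT)/(is_formZ 1) //|_].
  by have := is_form_cst r; congr is_form; apply/funext => s; rewrite mul0r.
rewrite eM; apply: is_form_cons; first by rewrite -eM.
- move=> u; rewrite contract_wedge //; apply: is_formD; apply: ifF => h.
    have -> : M = (p.-1 + q)%N by lia.
    by apply: IH => //; [lia | apply: form_contract; rewrite prednK].
  apply: is_formZ; have -> : M = (p + q.-1)%N by lia.
  by apply: IH => //; [lia | apply: form_contract; rewrite prednK].
- move=> s k u v; rewrite !wedge_cons //.
  have -> : contract (k *: u + v) a = fun s => k * contract u a s + contract v a s.
    by apply/funext => t; apply: (form_lin1_hd t ha).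
  have -> : contract (k *: u + v) b = fun s => k * contract u b s + contract v b s.
    by apply/funext => t; apply: (form_lin1_hd t hb).
  rewrite wedgeDl wedgeZl wedgeDr wedgeZr.
  by case: (0 < p)%N; case: (0 < q)%N; rewrite /=; move: ((-1) ^+ p) => x; ring.
move=> u s; have /(_ [::] u u s) /= := skewsym_wedge p q hsa hsb.
by move=> /eqP; rewrite -addr_eq0 -mulr2n mulrn_eq0 /= => /eqP.
Qed.

Lemma is_form_alt1 p (f : V -> covariant V R) : (forall v, is_form p (f v)) ->
  (forall s, lin1 (fun v => f v s)) -> is_form p.+1 (alt1 p f).
Proof.
elim: p f => [|p IH] f hf hl.
  apply: is_form_cons; first exact: of_degree_alt1.
  - move=> u; apply: is_form0 => s hs; rewrite /contract of_degree_alt1 //=.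
    by move=> -[].
  - move=> s k u v; rewrite !alt1_cons ?mul0r ?subr0; try by move=> w;
    apply: form_of_degree.
    exact: hl.
  - by move=> u s; rewrite of_degree_alt1.
have hd v : of_degree p.+1 (f v) by exact: form_of_degree.
have hs := skewsym_alt1 (fun v => form_skewsym (hf v)) hd.
apply: is_form_cons; first exact: of_degree_alt1.
- move=> u; have -> : contract u (alt1 p.+1 f) =
     fun s => f u s + (-1) * alt1 p (fun v => contract u (f v)) s.
    by apply/funext => s; rewrite /contract alt1_cons // mul1r mulN1r.
  apply: is_formD => //; apply: is_formZ; apply: IH => [v|s].
    exact: form_contract.
  exact: (hl (u :: s)).
- move=> s k u v; rewrite !alt1_cons //= !mul1r hl.
  have -> : alt1 p (fun w => contract (k *: u + v) (f w)) s =
    alt1 p (fun w t => k * contract u (f w) t + contract v (f w) t) s.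
    by apply: eq_alt1 => w t; apply: (form_lin1_hd t (hf w)).
  by rewrite alt1D alt1Z; ring.
move=> u s; have /= := hs [::] u u s.
by move=> /eqP; rewrite -addr_eq0 -mulr2n mulrn_eq0 /= => /eqP.
Qed.

(** Contraction by [u] commutes with the derivation up to contraction by [u *m A]; this is the rule
    that carries u _| past the torsion. *)
Lemma derivation_cons A a u s :
  derivation A a (u :: s) = derivation A (contract u a) s - a (u *m A :: s).
Proof. by rewrite /derivation /= big_ord_recl /= opprD addrC. Qed.

Lemma derivation_nil A a : derivation A a [::] = 0.
Proof. by rewrite /derivation big_ord0 oppr0. Qed.

Lemma derivationDr A a b s :
  derivation A (fun t => a t + b t) s = derivation A a s + derivation A b s.
Proof. by rewrite /derivation big_split opprD. Qed.

Lemma derivationZr A k a s : derivation A (fun t => k * a t) s = k * derivation A a s.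
Proof. by rewrite /derivation -mulr_sumr mulrN. Qed.

Lemma derivation0 A s : derivation A (fun=> 0 : R) s = 0.
Proof. by rewrite /derivation big1 ?oppr0. Qed.

Lemma of_degree_derivation p A a : of_degree p a -> of_degree p (derivation A a).
Proof.
move=> h s hs; rewrite /derivation big1 ?oppr0 // => i _; apply: h.
by rewrite size_set_nth (maxn_idPr _).
Qed.

Lemma derivation_lin p a s : is_form p a -> forall k A A',
  derivation (k *: A + A') a s = k * derivation A a s + derivation A' a s.
Proof.
move=> ha k A A'; elim: s p a ha => [|u s IH] p a ha.
  by rewrite !derivation_nil mulr0 addr0.
rewrite !derivation_cons mulmxDr -scalemxAr (form_lin1_hd s ha k).
case: p ha => [|p] ha; last by rewrite (IH p) ?mulrBr ?opprD;
  [exact: addrACA | exact: form_contract].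
(* In degree 0 nothing is left to contract: every value on a nonempty sequence is the default 0. *)
have z t : t <> [::] -> a t = 0 by move=> ht; apply: (form_of_degree ha) => /size0nil.
have zi : contract u a = fun=> 0 by apply/funext => t; apply: z.
by rewrite zi !derivation0 !z // !subr0 mulr0 addr0 subr0.
Qed.

Lemma is_form_derivation p A a : is_form p a -> is_form p (derivation A a).
Proof.
elim: p a => [|p IH] a ha.
  by apply: is_form0; apply: of_degree_derivation; exact: form_of_degree.
apply: is_form_cons.
- by apply: of_degree_derivation; exact: form_of_degree.
- move=> u; have -> : contract u (derivation A a) =
     fun s => derivation A (contract u a) s + (-1) * contract (u *m A) a s.
    by apply/funext => s; rewrite /contract derivation_cons mulN1r.
  by apply: is_formD; [apply: IH | apply: is_formZ]; apply: form_contract.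
- move=> s k u v; rewrite !derivation_cons mulmxDl -scalemxAl (form_lin1_hd s ha).
  have -> : contract (k *: u + v) a = fun s => k * contract u a s + contract v a s.
    by apply/funext => t; apply: (form_lin1_hd t ha).
  by rewrite derivationDr derivationZr; ring.
move=> u s; rewrite !derivation_cons /contract.
have -> : derivation A (fun t => a (u :: u :: t)) s = 0.
  rewrite /derivation big1 ?oppr0 // => i _; by case: ha => _ _ /(_ [::] [::]) /= ->.
by rewrite (form_skewsym ha [::] u) /=; ring.
Qed.

(** Contraction reduces the Leibniz rule to lower degree: the terms with [u *m A] in one factor,
    produced by [derivation_cons], match those of [wedge_cons] applied at [u *m A]. *)
Lemma derivation_wedge p q A a b s : is_form p a -> is_form q b ->
  derivation A (wedge p q a b) s =
  wedge p q (derivation A a) b s + wedge p q a (derivation A b) s.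
Proof.
elim: s p q a b => [|u s IH] p q a b ha hb.
  have [e|/eqP ne] := eqVneq 0%N (p + q)%N; last first.
    by rewrite derivation_nil !of_degree_wedge ?addr0.
  case: p q e ha hb => [|p] [|q] //= _ _ _.
  by rewrite !wedge00 !derivation_nil mul0r mulr0 addr0.
have hsa := form_skewsym ha; have hsb := form_skewsym hb.
have hDa := is_form_derivation A ha; have hDb := is_form_derivation A hb.
have hsDa := form_skewsym hDa; have hsDb := form_skewsym hDb.
rewrite derivation_cons contract_wedge // derivationDr !derivationZr !wedge_cons //.
have e c : contract u (derivation A c) = fun s => derivation A (contract u c) s +
  (-1) * contract (u *m A) c s.
  by apply/funext => t; rewrite /contract derivation_cons mulN1r.
rewrite !e !wedgeDl !wedgeDr !wedgeZl !wedgeZr {e}.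
have -> : (0 < p)%N%:R * derivation A (wedge p.-1 q (contract u a) b) s =
  (0 < p)%N%:R * (wedge p.-1 q (derivation A (contract u a)) b s +
    wedge p.-1 q (contract u a) (derivation A b) s).
  case: p ha {hsa hDa hsDa} => [|p] ha; first by rewrite !mul0r.
  by rewrite (IH p q) //; exact: form_contract.
have -> : (0 < q)%N%:R * ((-1) ^+ p * derivation A (wedge p q.-1 a (contract u b)) s) =
  (0 < q)%N%:R * ((-1) ^+ p * (wedge p q.-1 (derivation A a) (contract u b) s +
    wedge p q.-1 a (derivation A (contract u b)) s)).
  case: q hb {hsb hDb hsDb} => [|q] hb; first by rewrite !mul0r.
  by rewrite (IH p q) //; exact: form_contract.
by move: ((-1) ^+ p) ((0 < p)%N%:R) ((0 < q)%N%:R) => x y z; ring.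
Qed.

End Forms.

(** * Metric and Hodge star *)

Section Metric.
Variables (R : realType) (m : nat) (G : 'M[R]_m).
Local Notation V := 'rV[R]_m.
Implicit Types (a b c : covariant V R) (A : 'M[R]_m) (e : 'I_m -> V).

Lemma dot_linl v : lin1 (dot G ^~ v).
Proof. by move=> k u w; rewrite /dot !mulmxDl -!scalemxAl !mxE. Qed.

Lemma dot_linr u : lin1 (dot G u).
Proof. by move=> k v w; rewrite /dot linearD linearZ /= mulmxDr -scalemxAr !mxE. Qed.

Variables (E : 'I_m -> V) (oE : orthonormal_basis G E).

Let P : 'M[R]_m := \matrix_i E i.

Lemma frame_gram : P *m G *m P^T = 1%:M.
Proof.
apply/matrixP => i j; rewrite [RHS]mxE -oE /dot.
rewrite -[(E i *m G *m (E j)^T)]/(_ *m _).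
have -> : E i *m G *m (E j)^T = row i (P *m G) *m col j P^T.
  by rewrite row_mul rowK -tr_row rowK.
by rewrite -row_mul !mxE; apply: eq_bigr => k _; rewrite !mxE.
Qed.

(** The Gram identity exhibits a one-sided inverse; for square matrices it is two-sided, so [m]
    orthonormal vectors already span. *)
Lemma frame_expand u : u = \sum_i dot G u (E i) *: E i.
Proof.
have /mulmx1C h : P *m (G *m P^T) = 1%:M by rewrite mulmxA frame_gram.
rewrite -[LHS]mulmx1 -h mulmxA mulmx_sum_row; apply: eq_bigr => i _.
rewrite rowK; congr (_ *: _); rewrite mulmxA /dot !mxE; apply: eq_bigr => k _.
by rewrite !mxE.
Qed.

(** In the coordinates of the frame [dot G] is the standard inner product. *)
Lemma dot_sym u v : dot G u v = dot G v u.
Proof.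
rewrite [in LHS](frame_expand u) [in LHS](frame_expand v).
rewrite [in RHS](frame_expand u) [in RHS](frame_expand v).
have e w z : dot G (\sum_i dot G w (E i) *: E i) (\sum_i dot G z (E i) *: E i) =
   \sum_i dot G w (E i) * dot G z (E i).
  rewrite (lin1_sum _ (dot_linl _)); apply: eq_bigr => i _.
  rewrite (lin1Z _ _ (dot_linl _)) (lin1_sum _ (dot_linr _)) (bigD1 i) //=.
  rewrite (lin1Z _ _ (dot_linr _)) oE eqxx mulr1 big1 ?addr0 // => j ne.
  by rewrite (lin1Z _ _ (dot_linr _)) oE eq_sym (negPf ne) mulr0.
by rewrite !e; apply: eq_bigr => i _; rewrite mulrC.
Qed.

Lemma lin1_expand (f : V -> R) u : lin1 f -> f u = \sum_i dot G u (E i) * f (E i).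
Proof.
move=> h; rewrite {1}(frame_expand u) (lin1_sum _ h).
by apply: eq_bigr => i _; rewrite (lin1Z _ _ h).
Qed.

Lemma parseval u v : dot G u v = \sum_i dot G u (E i) * dot G v (E i).
Proof.
by rewrite (lin1_expand u (dot_linl v)); apply: eq_bigr => i _;
  rewrite [dot G v _]dot_sym.
Qed.

Definition bilin (f : V -> V -> R) := (forall v, lin1 (f ^~ v)) /\
  (forall u, lin1 (f u)).

(** A skew endomorphism has an antisymmetric matrix in an orthonormal frame, so it changes sign when
    moved to the other argument of a trace. *)
Lemma sum_bilin_skew (f : V -> V -> R) A : bilin f -> Defs.skew G A ->
  \sum_i f (E i *m A) (E i) = - \sum_i f (E i) (E i *m A).
Proof.
move=> [h1 h2] sA.
under eq_bigr => i _ do rewrite (lin1_expand (E i *m A) (h1 _)).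
under [X in - X]eq_bigr => i _ do rewrite (lin1_expand (E i *m A) (h2 _)).
rewrite exchange_big -sumrN; apply: eq_bigr => i _; rewrite -sumrN.
apply: eq_bigr => j _; rewrite -mulNr; congr (_ * _).
by have /eqP := sA (E i) (E j); rewrite addrC addr_eq0 dot_sym => /eqP.
Qed.

End Metric.

Section Frames.
Variables (R : realType) (m : nat) (G : 'M[R]_m).
Local Notation V := 'rV[R]_m.
Variables (E : 'I_m -> V) (oE : orthonormal_basis G E).
Implicit Types (a b c : covariant V R) (A : 'M[R]_m) (e : 'I_m -> V).

(** Metric traces do not depend on the frame. Besides making [fdot] intrinsic, this allows a frame
    to be replaced by its image under I. *)
Lemma sum_bilin_frame (f : V -> V -> R) e : bilin f -> orthonormal_basis G e ->
  \sum_i f (e i) (e i) = \sum_i f (E i) (E i).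
Proof.
move=> [h1 h2] oe.
transitivity (\sum_i \sum_j \sum_k (dot G (e i) (E j) * dot G (e i) (E k)) * f (E j)
  (E k)).
  apply: eq_bigr => i _; rewrite (lin1_expand oE (e i) (h1 _)); apply: eq_bigr => j _.
  by rewrite (lin1_expand oE (e i) (h2 _)) mulr_sumr; apply: eq_bigr => k _;
    rewrite mulrA.
have d j k : \sum_i dot G (e i) (E j) * dot G (e i) (E k) = (j == k)%:R.
  rewrite -oE (parseval oe); apply: eq_bigr => i _.
  by rewrite [dot G (E j) _](dot_sym oE) [dot G (E k) _](dot_sym oE).
rewrite exchange_big; apply: eq_bigr => j _; rewrite exchange_big /= (bigD1 j) //=.
rewrite -mulr_suml d eqxx mul1r big1 ?addr0 // => k ne.
by rewrite -mulr_suml d eq_sym (negPf ne) mul0r.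
Qed.

Lemma bilin_fdot p a b : is_form p.+1 a -> is_form p.+1 b ->
  bilin (fun u v => fdot E p (contract u a) (contract v b)).
Proof.
move=> ha hb; split=> [v k u w|u k v w].
  by rewrite -fdotZl -fdotDl; apply: eq_fdot => // s _;
    exact: (form_lin1_hd s ha k u w).
by rewrite -fdotZr -fdotDr; apply: eq_fdot => // s _; exact: (form_lin1_hd s hb k v w).
Qed.

Lemma form_ext p a b : is_form p a -> is_form p b ->
  (forall t : seq 'I_m, a (map E t) = b (map E t)) -> a = b.
Proof.
move=> ha hb h; apply/funext => s; elim: p a b ha hb h s => [|p IH] a b ha hb h [|u s].
- exact: (h [::]).
- by rewrite (form_of_degree ha) ?(form_of_degree hb).
- by rewrite (form_of_degree ha) ?(form_of_degree hb).
rewrite (lin1_expand oE u (form_lin1_hd s ha)) (lin1_expand oE u (form_lin1_hd s hb)).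
apply: eq_bigr => i _; congr (_ * _).
apply: (IH (contract (E i) a) (contract (E i) b)); try exact: form_contract.
by move=> t; apply: (h (i :: t)).
Qed.

(** Pigeonhole: more than [m] arguments taken from a frame repeat a vector. *)
Lemma form_vanish p a : is_form p a -> (m < p)%N -> a = fun=> 0.
Proof.
move=> ha lt; apply: (form_ext ha (is_form_cst _ _ p)) => t.
have [e|/eqP ne] := eqVneq (size t) p; last first.
  by apply: (form_of_degree ha); rewrite size_map.
have nu : ~~ uniq t.
  apply/negP => /card_uniqP; rewrite e => h.
  by move: (max_card (mem t)); rewrite h card_ord leqNgt lt.
clear e lt; elim: t nu p a ha => //= i t IH; rewrite negb_and negbK => /orP[it|nu] p a
  ha.
  by case/splitPr: it => t1 t2; rewrite map_cat /=; case: ha => _ _ h; exact: (h [::]).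
case: p ha => [|p] ha; first by rewrite (form_of_degree ha).
exact: (IH nu p (contract (E i) a) (form_contract _ ha)).
Qed.

Lemma fdot_frame p a b e : is_form p a -> is_form p b -> orthonormal_basis G e ->
  fdot e p a b = fdot E p a b.
Proof.
move=> + + oe; elim: p a b => [|p IH] a b ha hb; first by rewrite !fdot0.
rewrite !fdotS; congr (_ * _).
rewrite -(sum_bilin_frame (bilin_fdot ha hb) oe); apply: eq_bigr => i _.
by apply: IH; exact: form_contract.
Qed.

Lemma fdot_eq0 p a : is_form p a -> fdot E p a a = 0 -> a = fun=> 0.
Proof.
move=> ha h; apply: (form_ext ha (is_form_cst _ _ p)) => t.
have [e|/eqP ne] := eqVneq (size t) p; last first.
  by apply: (form_of_degree ha); rewrite size_map.
have ge0 q b : 0 <= fdot E q b b.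
  elim: q b => [|q IH] b; first by rewrite fdot0 -expr2 sqr_ge0.
  by rewrite fdotS mulr_ge0 ?invr_ge0 ?ler0n // sumr_ge0.
elim: p t a {ha} e h => [|p IH] [|i t] a //=; first by rewrite fdot0 => _ /eqP;
  rewrite mulf_eq0 orbb => /eqP.
move=> [e]; rewrite fdotS => /eqP; rewrite mulf_eq0 invr_eq0 pnatr_eq0 /=
  psumr_eq0 // => /allP h.
by apply: (IH t (contract (E i) a)) => //; apply/eqP/h; rewrite mem_index_enum.
Qed.

Lemma form_dotE p a b : form_dot E p a b = fdot E p a b.
Proof.
rewrite /form_dot /fdot; apply: congr1.
elim: p a b => [|p IH] a b /=.
  rewrite (big_pred1 [tuple]) // => t; apply/esym/eqP; exact: tuple0.
rewrite (reindex (fun u : 'I_m * p.-tuple 'I_m => [tuple of u.1 :: u.2])) /=;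
  last first.
  exists (fun t => (thead t, [tuple of behead t])) => [[i t] _|t _] /=.
    by congr (_, _); apply: val_inj.
  by rewrite -tuple_eta.
rewrite -(pair_big xpredT xpredT (fun i (t : p.-tuple 'I_m) => a (E i :: map E t) * b
  (E i :: map E t))) /=.
by apply: eq_bigr => i _; rewrite (IH (contract (E i) a) (contract (E i) b)).
Qed.

(** The p + 1 slots on which [A] can act contribute equally, and their number cancels the
    normalisation in [fdotS]. Pairings with the torsion thus become single sums of products of
    contractions. *)
Lemma fdot_derivation p A a b : is_form p.+1 a -> is_form p.+1 b ->
  fdot E p.+1 (derivation A a) b = - \sum_i fdot E p (contract (E i *m A) a)
    (contract (E i) b).
Proof.
elim: p a b => [|p IH] a b ha hb; rewrite fdotS.
  rewrite invr1 mul1r -sumrN; apply: eq_bigr => i _.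
  by rewrite !fdot0 /contract derivation_cons derivation_nil sub0r mulNr.
apply: (canLR (mulKf _)); first by rewrite pnatr_eq0.
transitivity (\sum_i fdot E p.+1 (derivation A (contract (E i) a)) (contract (E i) b) -
              \sum_i fdot E p.+1 (contract (E i *m A) a) (contract (E i) b)).
  rewrite -sumrB; apply: eq_bigr => i _; rewrite -fdotNl -fdotDl.
  by apply: eq_fdot => // s _; rewrite {1}/contract derivation_cons.
under eq_bigr => i _ do rewrite (IH _ _ (form_contract _ ha) (form_contract _ hb)).
rewrite sumrN exchange_big /=.
rewrite -[p.+2]add1n natrD mulrDl mul1r addrC mulrN mulr_sumr; congr (_ - _).
apply: eq_bigr => i _; rewrite -sum_fdot_contract; apply: eq_bigr => k _.
by rewrite (contract_swap (E i *m A) (E k) (form_skewsym ha))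
  (contract_swap (E i) (E k) (form_skewsym hb)) fdotNl fdotNr opprK.
Qed.

Lemma fdot_derivation_skew p A a b : is_form p a -> is_form p b -> Defs.skew G A ->
  fdot E p (derivation A a) b = - fdot E p a (derivation A b).
Proof.
case: p => [|p] ha hb sA; first by rewrite !fdot0 !derivation_nil mul0r mulr0 oppr0.
rewrite [fdot _ _ a _]fdotC !fdot_derivation // opprK.
rewrite (sum_bilin_skew oE (bilin_fdot ha hb) sA) opprK.
by apply: eq_bigr => i _; rewrite fdotC.
Qed.

End Frames.

Section AltCat.
Variables (V : zmodType) (F : numFieldType).
Implicit Types (a b c : covariant V F) (f : V -> covariant V F).

Lemma skewsym_catr c s : skewsym c -> skewsym (fun t => c (t ++ s)).
Proof. by move=> hc s1 u v s2; rewrite -!catA /=; apply: hc. Qed.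

(** The alternated slot lies in [t] or in [s]; in the second case its signs start at (-1)^(p+1). *)
Lemma alt1_cat p q N f t s : N = (p.+1 + q)%N -> (forall v, of_degree N (f v)) ->
    size t = p.+1 -> size s = q.+1 ->
  alt1 N f (t ++ s) = alt1 p (fun v r => f v (r ++ s)) t
    + (-1) ^+ p.+1 * alt1 q (fun v r => f v (t ++ r)) s.
Proof.
move=> ->; elim: p f t => [|p IH] f [|x t] // hf [ht] hs; rewrite /= alt1_cons // mul1r.
  case: t ht => // _; rewrite alt1_cons; last first.
    by move=> v r hr; apply: hf; rewrite size_cat hs; lia.
  by rewrite mul0r subr0 expr1 mulN1r.
rewrite alt1_cons; last by move=> v r hr; apply: hf; rewrite size_cat hs; lia.
rewrite mul1r /= IH //; last by move=> v; exact: (of_degree_contract (p := p.+2 + q)).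
rewrite [in RHS]exprS mulN1r mulNr opprD addrA; congr (_ + _ - _).
Qed.

End AltCat.

(** * The Hodge star as contraction with the volume form *)

Section Star.
Variables (R : realType) (m : nat) (G : 'M[R]_m).
Local Notation V := 'rV[R]_m.
Variables (E : 'I_m -> V) (oE : orthonormal_basis G E).
Variables (vol : covariant V R) (hv : is_form m vol) (nv : fdot E m vol vol = 1).
Implicit Types (a b c : covariant V R).

(** The Hodge star in closed form: [b] inserted into the first slots of [vol]. Here [vol] is any
    unit form of top degree; the Kaehler volume is substituted later. *)
Definition frame_star p b : covariant V R :=
  fun s => fdot E p b (fun t => vol (t ++ s)).

Lemma is_form_frame_star p b : (p <= m)%N -> is_form (m - p) (frame_star p b).
Proof.
move=> le; have [h1 h2 h3] := hv; split => [s hs|s1 s2 k u v hs|s1 s2 s3 u].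
- have -> : frame_star p b s = fdot E p b (fun=> 0).
    apply: eq_fdot => // t ht; apply: h1; rewrite size_cat ht; lia.
  exact: fdot0r.
- rewrite /frame_star -fdotZr -fdotDr; apply: eq_fdot => // t ht; rewrite !catA.
  by apply: h2; rewrite size_cat ht; lia.
have -> : frame_star p b (s1 ++ u :: s2 ++ u :: s3) = fdot E p b (fun=> 0).
  by apply: eq_fdot => // t ht; rewrite catA; apply: h3.
exact: fdot0r.
Qed.

Lemma is_form_dot_tensor p u b : is_form p b ->
  (forall v, is_form p (fun r => dot G u v * b r)) /\
  (forall s, lin1 (fun v => dot G u v * b s)).
Proof.
move=> hb; split=> [v|s k v w]; first exact: is_formZ.
by rewrite (dot_linr G u) mulrDl mulrA.
Qed.

(* Pairing [b] with [u /\ vol = 0], a form of degree [m + 1]. *)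
Lemma frame_star_contract p b u s : (p < m)%N -> is_form p.+1 b -> size s = (m - p)%N ->
  frame_star p (contract u b) s =
  (-1) ^+ p * alt1 (m - p.+1) (fun v r => dot G u v * frame_star p.+1 b r) s.
Proof.
move=> lt hb hs; set q := (m - p.+1)%N.
have em : (p.+1 + q)%N = m by rewrite subnKC.
have hsq : size s = q.+1 by rewrite hs /q; lia.
have [hF lF] := is_form_dot_tensor u hv.
have z : alt1 m (fun v r => dot G u v * vol r) = fun=> 0.
  by apply: (form_vanish oE (is_form_alt1 hF lF)).
have : fdot E p.+1 b (fun t => alt1 m (fun v r => dot G u v * vol r) (t ++ s)) = 0.
  by rewrite z fdot0r.
rewrite (@eq_fdot _ _ _ E p.+1 b b _
  (fun t => alt1 p (fun v r => dot G u v * vol (r ++ s)) t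
    + (-1) ^+ p.+1 * alt1 q (fun v r => dot G u v * vol (t ++ r)) s)) //; last first.
  by move=> t ht; rewrite (@alt1_cat _ _ p q) // => v; apply: form_of_degree.
rewrite fdotDr fdotZr fdotC fdot_alt1; last exact: (form_skewsym hb).
  move=> /eqP; rewrite addr_eq0 exprS mulN1r mulNr opprK => /eqP h.
  transitivity (\sum_i dot G u (E i) * frame_star p (contract (E i) b) s).
    apply: (lin1_expand oE u (f := fun v => frame_star p (contract v b) s)) => k v w.
    rewrite /frame_star -fdotZl -fdotDl; apply: eq_fdot => // t _.
    exact: (form_lin1_hd t hb k v w).
  transitivity (\sum_i fdot E p (fun r => dot G u (E i) * vol (r ++ s))
    (contract (E i) b)).
    by apply: eq_bigr => i _; rewrite fdotZl fdotC.
  rewrite h; congr (_ * _).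
  rewrite /alt1 hsq eqxx fdot_sumr; apply: eq_bigr => i _.
  by rewrite fdotZr fdotZr.
move=> v r hr; rewrite (form_of_degree hv) ?mulr0 // size_cat hsq; lia.
Qed.

(** Each step of the induction trades one slot of [b]. With [u] expanded over the frame inside
    [vol], the double star at [u] becomes a pairing with the exterior product of [u] and the star of
    [b], and [frame_star_contract] identifies that product, up to sign, with the star of u _| b. *)
Lemma frame_starK p b : (p <= m)%N -> is_form p b ->
  frame_star (m - p) (frame_star p b) = fun s => (-1) ^+ (p * (m - p)) * b s.
Proof.
elim: p b => [|p IH] b le hb; apply/funext => s.
  rewrite mul1r subn0; have z t : frame_star 0 b t = b [::] * vol t by rewrite
    /frame_star fdot0.
  have -> : frame_star 0 b = fun t => b [::] * vol t by apply/funext.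
  have [->|hs] := eqVneq s [::].
    rewrite /frame_star fdotZl (@eq_fdot _ _ _ E m vol vol _ vol) ?nv ?mulr1 // => t _.
    by rewrite cats0.
  have ns : size s <> 0%N by move/size0nil => e; rewrite e eqxx in hs.
  rewrite (form_of_degree hb ns).
  have hv' := is_form_frame_star (fun t => b [::] * vol t) (leqnn m).
  by rewrite (form_of_degree hv') // subnn.
have hb1 := is_form_frame_star b le.
have [hs|/eqP hs] := eqVneq (size s) p.+1; last first.
  have hb2 := is_form_frame_star (frame_star p.+1 b) (leq_subr p.+1 m).
  by rewrite (form_of_degree hb2) ?subKn // (form_of_degree hb) // mulr0.
case: s hs => // u s [hs]; set q := (m - p.+1)%N.
have mp : (m - p)%N = q.+1 by rewrite /q; lia.
transitivity ((-1) ^+ q * fdot E q (frame_star p.+1 b) (fun t => vol (u :: t ++ s))).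
  rewrite -fdotZr; apply: eq_fdot => // t ht.
  by rewrite (skewsym_front _ _ _ (form_skewsym hv)) ht.
have -> : fdot E q (frame_star p.+1 b) (fun t => vol (u :: t ++ s)) =
    \sum_i dot G u (E i) * fdot E q (frame_star p.+1 b) (fun t => vol (E i :: t ++ s)).
  apply: (lin1_expand oE u
    (f := fun v => fdot E q (frame_star p.+1 b) (fun t => vol (v :: t ++ s)))).
  move=> k v w; rewrite -fdotZr -fdotDr; apply: eq_fdot => // t _.
  exact: (form_lin1_hd (t ++ s) hv k v w).
have -> : \sum_i dot G u (E i) * fdot E q (frame_star p.+1 b)
  (fun t => vol (E i :: t ++ s))
   = fdot E q.+1 (alt1 q (fun v r => dot G u v * frame_star p.+1 b r))
     (fun t => vol (t ++ s)).
  rewrite fdot_alt1; last exact: (skewsym_catr _ (form_skewsym hv)).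
    by apply: eq_bigr => i _; rewrite [RHS]fdotZl.
  by move=> v r hr; rewrite (form_of_degree hb1) ?mulr0.
have -> : fdot E q.+1 (alt1 q (fun v r => dot G u v * frame_star p.+1 b r))
  (fun t => vol (t ++ s))
  = frame_star q.+1 (fun r => (-1) ^+ p * frame_star p (contract u b) r) s.
  apply: eq_fdot => // r hr; rewrite frame_star_contract ?mp //.
  by rewrite mulrA -expr2 sqrr_sign mul1r.
have -> : frame_star q.+1 (fun r => (-1) ^+ p * frame_star p (contract u b) r) s =
   (-1) ^+ p * frame_star q.+1 (frame_star p (contract u b)) s by rewrite /frame_star
     fdotZl.
rewrite -mp IH; [|exact: ltnW|exact: form_contract].
rewrite mp !mulrA -!exprD /contract; congr (_ * _).
(* The exponents collected: q from moving [u] across [vol], p from [frame_star_contract], p(q + 1)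
   from the induction hypothesis. Modulo 2 they add up to (p + 1)q. *)
have -> : (q + p + p * q.+1 = p.+1 * q + p.*2)%N by rewrite -addnn; lia.
by rewrite exprD -mul2n [(-1) ^+ (2 * p)]exprM sqrrN !expr1n mulr1.
Qed.

(** For p = m the double star is the identity, and the inner star is the number <c, vol>. *)
Lemma top_form c : is_form m c -> c = fun s => fdot E m c vol * vol s.
Proof.
move=> hc; apply/funext => s; have := frame_starK (leqnn m) hc.
rewrite subnn muln0 => /(congr1 (fun f => f s)); rewrite mul1r => <-.
rewrite {1}/frame_star fdot0; congr (_ * _); apply: eq_fdot => // t _; by rewrite cats0.
Qed.

Lemma fdot_wedge_vol p a c : (p <= m)%N -> is_form p a -> is_form (m - p) c ->
  fdot E m (wedge p (m - p) a c) vol =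
  (-1) ^+ (p * (m - p)) * fdot E p a (frame_star (m - p) c).
Proof.
move=> le ha hc.
have := fdot_wedge E p (m - p) (form_skewsym ha) (form_skewsym hc) (form_skewsym hv).
rewrite subnKC // => ->; rewrite -fdotZr; apply: eq_fdot => // s hs.
rewrite -fdotZr; apply: eq_fdot => // t ht.
by rewrite (skewsym_block _ _ (form_skewsym hv)) hs ht.
Qed.

(** The product of [a] with the star of [b] is a multiple of [vol], whose coefficient pairs [a] with
    the double star of [b]; the two signs (-1)^(p(m-p)) cancel. *)
Lemma is_hodge_frame_star p b : (p <= m)%N -> is_form p b ->
  is_hodge G vol p b (frame_star p b).
Proof.
move=> le hb; have hs := is_form_frame_star b le; split=> // e oe a ha.
have hw : is_form m (wedge p (m - p) a (frame_star p b)).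
  by have := is_form_wedge ha hs; rewrite subnKC.
rewrite (top_form hw) fdot_wedge_vol // frame_starK // fdotZr mulrA -expr2 sqrr_sign
  mul1r.
by rewrite form_dotE (fdot_frame oE ha hb oe).
Qed.

(** The defining property, tested on the difference [d] of the stars of the two candidates, says
    that [d] has norm zero; a second star recovers the candidates. *)
Lemma is_hodge_uniq p b c : (p <= m)%N -> is_form p b -> is_hodge G vol p b c ->
  c = frame_star p b.
Proof.
move=> le hb [hc hw]; have [hs hw'] := is_hodge_frame_star le hb.
have leq := leq_subr p m.
have h1 := is_form_frame_star c leq; have h2 := is_form_frame_star (frame_star p b) leq.
rewrite subKn // in h1 h2.
have e : frame_star (m - p) c = frame_star (m - p) (frame_star p b).
  set d := fun s => frame_star (m - p) c s + - frame_star (m - p) (frame_star p b) s.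
  have hd : is_form p d by apply: is_formD => //; apply: is_formN.
  have : fdot E p d d = 0.
    rewrite {2}/d fdotDr fdotNr; apply/eqP; rewrite subr_eq0; apply/eqP.
    have := hw E oE d hd; rewrite -(hw' E oE d hd) => e.
    have := fdot_wedge_vol le hd hc; rewrite e fdot_wedge_vol //.
    by move=> /(can_inj (signrMK _)).
  move=> /(fdot_eq0 oE hd) d0; apply/funext => s.
  by have := congr1 (fun f => f s) d0; rewrite /d => /eqP; rewrite subr_eq0 => /eqP.
have e2 := frame_starK leq hc; rewrite e (frame_starK leq hs) in e2.
apply/funext => s; have /esym := congr1 (fun f => f s) e2.
by move=> /(can_inj (signrMK _)).
Qed.

(** Removes the choice in [hodge]: from here on the star is computed in any convenient orthonormal
    basis. *)
Lemma hodgeE p b : (p <= m)%N -> is_form p b -> hodge G vol p b = frame_star p b.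
Proof.
move=> le hb; apply: is_hodge_uniq => //; rewrite /hodge.
by apply: (xgetPex 0 (P := [set c | is_hodge G vol p b c])); exists (frame_star p b);
  exact: is_hodge_frame_star.
Qed.

(** Inserting the star of [b] into [vol] first produces the double star of [b], into which [a] is
    then inserted. The (-1)^k moves [u] in front of the k slots of [a]; the rest of the sign is that
    of the double star. *)
Lemma frame_star_wedge_frame_star d k a b u : is_form d b -> is_form k a -> d = k.+1 ->
  (d <= m)%N ->
  frame_star (m - d + k) (wedge (m - d) k (frame_star d b) a) [:: u] =
  (-1) ^+ (d * (m - d) + k) * fdot E k a (contract u b).
Proof.
move=> hb ha ed le; rewrite /frame_star fdot_wedge;
  last exact: (skewsym_catr _ (form_skewsym hv)).
- rewrite fdot_exchange -fdotZr; apply: eq_fdot => // t ht.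
  transitivity (frame_star (m - d) (frame_star d b) (t ++ [:: u])).
    by apply: eq_fdot => // s hs; rewrite catA.
  rewrite frame_starK // exprD -mulrA (skewsym_front t u [::] (form_skewsym hb)).
  by rewrite ht cats0.
- exact: (form_skewsym (is_form_frame_star _ le)).
- exact: (form_skewsym ha).
Qed.

End Star.

(** * The Kaehler form and its powers *)

Section Kaehler.
Variables (R : realType) (n : nat).
Local Notation m := (2 * n)%N.
Local Notation V := 'rV[R]_m.
Variables (G J : 'M[R]_m) (E : 'I_m -> V).
Hypothesis oE : orthonormal_basis G E.
Hypothesis JJ : J *m J = - 1%:M.
Hypothesis oJ : forall u v : V, dot G (u *m J) (v *m J) = dot G u v.
Implicit Types (a b c : covariant V R).

Lemma mulJJ (u : V) : u *m J *m J = - u.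
Proof. by rewrite -mulmxA JJ mulmxN mulmx1. Qed.

Lemma dotJ (u v : V) : dot G (u *m J) v = - dot G u (v *m J).
Proof. by rewrite -[in RHS]oJ mulJJ (lin1N _ (dot_linr G _)) opprK. Qed.

Lemma dot_u_uJ (u : V) : dot G u (u *m J) = 0.
Proof.
have := dotJ u u; rewrite (dot_sym oE) => /eqP.
by rewrite -addr_eq0 -mulr2n mulrn_eq0 /= => /eqP.
Qed.

Definition omega : covariant V R :=
  fun s => if s is [:: u; v] then dot G u (v *m J) else 0.

Lemma is_form_omega : is_form 2 omega.
Proof.
apply: is_form_cons.
- by case=> [|u [|v [|w s]]].
- move=> u; apply: is_form_cons.
  + by case=> [|v [|w s]].
  + by move=> v; apply: is_form0 => -[].
  + move=> [|w s] k v v'; last by rewrite /contract /= mulr0 addr0.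
    by rewrite /contract /= mulmxDl -scalemxAl (dot_linr G).
  + by move=> v s.
- move=> [|v [|w s]] k u u'; rewrite /= ?mulr0 ?addr0 //; exact: dot_linl.
- by move=> u [|v s] //=; exact: dot_u_uJ.
Qed.

(** The dual Lefschetz operator: by [fdot_omega] it is the contraction with [omega], hence adjoint
    to wedging with [omega]. The star of omega and the norms of its powers come down to it. *)
Definition Lambda b : covariant V R := fun s =>
  - (2^-1 * \sum_i b (E i :: E i *m J :: s)).

Lemma fdot_omega p c s : is_form p c ->
  fdot E 2 omega (fun t => c (t ++ s)) = Lambda c s.
Proof.
move=> hc; rewrite /Lambda fdotS -mulrN -sumrN; congr (_ * _).
apply: eq_bigr => i _; rewrite fdotS invr1 mul1r.
rewrite (lin1_expand oE (E i *m J) (form_lin1_snd (E i) s hc)) -sumrN.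
by apply: eq_bigr => j _; rewrite fdot0 /contract /= -mulNr dotJ opprK.
Qed.

(* The commutator of [Lambda] with the wedge product by [omega] is [n - degree]. *)
Lemma Lambda_wedge q b s : is_form q.+2 b -> Lambda (wedge 2 q.+2 omega b) s =
  (n%:R - q.+2%:R) * b s + wedge 2 q omega (Lambda b) s.
Proof.
move=> hb; have so := form_skewsym is_form_omega; have sb := form_skewsym hb.
have db := form_of_degree hb.
have db' v : of_degree q.+1 (contract v b) by exact: (of_degree_contract (p := q.+2)).
have e u v : wedge 2 q.+2 omega b (u :: v :: s) =
    omega [:: u; v] * b s - alt1 q.+1 (fun w t => omega [:: u; w] * b (v :: t)) s
    + alt1 q.+1 (fun w t => omega [:: v; w] * b (u :: t)) s
    + wedge 2 q omega (contract v (contract u b)) s.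
  rewrite !wedge_cons //=; try exact: skewsym_contract.
  rewrite wedge0l //; try by do 2?[apply: skewsym_contract].
  rewrite !wedge_alt1 //; try exact: skewsym_contract.
  by rewrite /contract expr1 mulN1r sqrrN expr1n !mul1r addrA.
rewrite /Lambda; under eq_bigr => i _ do rewrite e.
rewrite !big_split /= sumrN -mulr_suml.
(* With the factor -1/2 of [Lambda], the trace -2n gives n, and the two mixed terms, each
   contributing (q + 2) b by Euler's identity, give minus the degree. *)
have -> : \sum_i omega [:: E i; E i *m J] = - m%:R.
  rewrite -[m in RHS]card_ord -sumr_const -sumrN; apply: eq_bigr => i _.
  by rewrite /omega /= mulJJ (lin1N _ (dot_linr G _)) oE eqxx.
have -> : \sum_i alt1 q.+1 (fun w t => omega [:: E i; w] * b (E i *m J :: t)) s =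
    - (q.+2%:R * b s).
  rewrite -alt1_sum -alt1_contract // -mulN1r -alt1Z; apply: eq_alt1 => w t.
  have lJ : lin1 (fun v => b (v *m J :: t)).
    by move=> k u v; rewrite mulmxDl -scalemxAl; exact: (form_lin1_hd t hb).
  transitivity (b (w *m J *m J :: t)).
    rewrite (lin1_expand oE (w *m J) lJ); apply: eq_bigr => i _.
    by rewrite /omega (dot_sym oE).
  by rewrite mulJJ (lin1N _ (form_lin1_hd t hb)) mulN1r.
have -> : \sum_i alt1 q.+1 (fun w t => omega [:: E i *m J; w] * b (E i :: t)) s =
    q.+2%:R * b s.
  rewrite -alt1_sum -alt1_contract //; apply: eq_alt1 => w t.
  rewrite [RHS](lin1_expand oE w (form_lin1_hd t hb)); apply: eq_bigr => i _.
  by rewrite /omega oJ (dot_sym oE).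
have -> : wedge 2 q omega (fun t => - (2^-1 * \sum_i b (E i :: E i *m J :: t))) s =
    - (2^-1 * \sum_i wedge 2 q omega (contract (E i *m J) (contract (E i) b)) s).
  by rewrite wedgeNr wedgeZr wedge_sumr.
rewrite natrM; move: (\sum_i wedge _ _ _ _ _) => x.
by field.
Qed.

Definition omega_exp k : covariant V R := wedge_exp 2 omega k.

Lemma is_form_form1 : is_form 0 (@form1 V R).
Proof. by apply: is_form0 => -[]. Qed.

Lemma is_form_omega_exp k : is_form (2 * k) (omega_exp k).
Proof.
elim: k => [|k IH]; first exact: is_form_form1.
by rewrite mulnS; apply: is_form_wedge => //; exact: is_form_omega.
Qed.

(** The constant is the sum of the commutators n - 2j for j = 0, ..., k. The case k = 0 is done by
    hand because [Lambda_wedge] starts in degree 2. *)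
Lemma Lambda_omega_exp k s :
  Lambda (omega_exp k.+1) s = k.+1%:R * (n%:R - k%:R) * omega_exp k s.
Proof.
elim: k s => [|k IH] s.
  have so := form_skewsym is_form_omega; have s1 := form_skewsym is_form_form1.
  rewrite mul1r subr0 /Lambda.
  have -> : \sum_i omega_exp 1 (E i :: E i *m J :: s) = - m%:R * @form1 V R s.
    have -> : - m%:R = \sum_(i < m) -1 :> R by rewrite sumrN sumr_const card_ord.
    rewrite mulr_suml; apply: eq_bigr => i _.
    rewrite /omega_exp /= !wedge_cons //=; try exact: skewsym_contract.
    rewrite wedge0l //; try by do 2?[apply: skewsym_contract].
      rewrite /contract /= mulJJ (lin1N _ (dot_linr G _)) oE eqxx.
      by rewrite !mul0r !addr0 !mul1r.
    exact: (form_of_degree is_form_form1).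
  by rewrite natrM /omega_exp /=; field.
have hf := is_form_omega_exp k.+1.
have e : (2 * k.+1 = (2 * k).+2)%N by rewrite mulnS.
rewrite e in hf.
have -> : omega_exp k.+2 = wedge 2 (2 * k).+2 omega (omega_exp k.+1).
  by rewrite -e.
rewrite Lambda_wedge //.
have -> : Lambda (omega_exp k.+1) = fun t => k.+1%:R * (n%:R - k%:R) * omega_exp k t.
  exact/funext.
rewrite wedgeZr -[wedge 2 _ _ _]/(omega_exp k.+1) -e natrM.
by rewrite -[k.+2%:R]natr1 -[k.+1%:R]natr1; ring.
Qed.

(** By adjointness each factor [omega] contributes one constant of [Lambda_omega_exp]. For k = n the
    value is the square of n!, which the factor in [volume] normalises to 1. *)
Lemma fdot_omega_exp k : (k <= n)%N ->
  fdot E (2 * k) (omega_exp k) (omega_exp k) = (k`! * n ^_ k)%:R.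
Proof.
elim: k => [|k IH] le; first by rewrite fdot0 /omega_exp /form1 /= mulr1.
have hf := is_form_omega_exp k.+1.
have -> : fdot E (2 * k.+1) (omega_exp k.+1) (omega_exp k.+1) =
   fdot E (2 + 2 * k) (wedge 2 (2 * k) omega (omega_exp k)) (omega_exp k.+1).
  by rewrite mulnS.
rewrite fdot_wedge; [|exact: (form_skewsym is_form_omega)|
  exact: (form_skewsym (is_form_omega_exp k))|exact: (form_skewsym hf)].
rewrite fdot_exchange.
transitivity (fdot E (2 * k) (omega_exp k) (fun t =>
   k.+1%:R * (n%:R - k%:R) * omega_exp k t)).
  by apply: eq_fdot => // t _; rewrite (fdot_omega t hf) Lambda_omega_exp.
rewrite fdotZr IH ?(ltnW le) // -natrB ?(ltnW le) // -!natrM factS ffactnSr.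
by congr (_%:R); ring.
Qed.

Definition volume : covariant V R := fun s =>
  (-1) ^+ (n * n.+1)./2 / n`!%:R * omega_exp n s.

Lemma is_form_volume : is_form m volume.
Proof. exact/is_formZ/is_form_omega_exp. Qed.

Lemma fdot_volume : fdot E m volume volume = 1.
Proof.
rewrite fdotZl fdotZr fdot_omega_exp // ffactnn natrM.
have h : n`!%:R != 0 :> R by rewrite pnatr_eq0 -lt0n fact_gt0.
have := sqrr_sign R (n * n.+1)./2; rewrite expr2.
move: ((-1) ^+ _) (n`!%:R) h => x y h e.
transitivity (x * x); last by [].
by field.
Qed.

Lemma frame_star_omega s : (0 < n)%N ->
  frame_star E volume 2 omega s =
  (-1) ^+ (n * n.+1)./2 / n`!%:R * n%:R * omega_exp n.-1 s.
Proof.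
move=> n0; rewrite /frame_star (fdot_omega s is_form_volume).
have -> : Lambda volume s = (-1) ^+ (n * n.+1)./2 / n`!%:R * Lambda (omega_exp n) s.
  by rewrite /Lambda -mulr_sumr; ring.
rewrite -[in Lambda _](prednK n0) Lambda_omega_exp prednK // -[n%:R - _]natrB
  ?leq_pred //.
have -> : (n - n.-1 = 1)%N by lia.
by rewrite mulr1 mulrA.
Qed.

End Kaehler.

(** * The complex volume form *)

Section ComplexVolume.
Variables (R : realType) (n : nat).
Local Notation m := (2 * n)%N.
Local Notation V := 'rV[R]_m.
Local Notation C := R[i].
Variables (G J : 'M[R]_m) (E : 'I_m -> V).
Hypothesis oE : orthonormal_basis G E.
Hypothesis JJ : J *m J = - 1%:M.
Hypothesis oJ : forall u v : V, dot G (u *m J) (v *m J) = dot G u v.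
Implicit Types (b c : covariant V C) (es : seq V).

Local Notation alpha := (adapted_one_form G J).

Definition clin1 (f : V -> C) : Prop :=
  forall k u v, f (k *: u + v) = (k%:C)%C * f u + f v.

Lemma clin1_expand (f : V -> C) u : clin1 f ->
  f u = \sum_i (dot G u (E i))%:C%C * f (E i).
Proof.
move=> h; have h0 : f 0 = 0.
  by have := h (-1) 0 0; rewrite scaler0 addr0 rmorphN rmorph1 mulN1r addNr.
rewrite {1}(frame_expand oE u) (big_morph f (id1 := 0) (op1 := +%R)) //.
  by apply: eq_bigr => i _; have := h (dot G u (E i)) (E i) 0; rewrite addr0 h0 addr0.
by move=> x y; have := h 1 x y; rewrite scale1r rmorph1 mul1r.
Qed.

Lemma alphaE e u : alpha e [:: u] = ((dot G u e)%:C + 'i * (dot G u (e *m J))%:C)%C.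
Proof. by rewrite [LHS]complexE. Qed.

Lemma of_degree_alpha e : of_degree 1 (alpha e).
Proof. by case=> [|u [|v s]]. Qed.

Lemma skewsym_alpha e : skewsym (alpha e).
Proof. by move=> s1 u v s2; rewrite !of_degree_alpha ?oppr0 // size_cat /= !addnS. Qed.

Lemma clin1_alpha e : clin1 (fun u => alpha e [:: u]).
Proof.
move=> k u v; rewrite !alphaE !(dot_linl G) !rmorphD !rmorphM /=; ring.
Qed.

Lemma alpha_J e u : alpha e [:: u *m J] = ('i%C : C) * alpha e [:: u].
Proof.
rewrite !alphaE oJ (dotJ JJ oJ) rmorphN mulrDr mulrA -expr2 sqr_i.
by rewrite mulN1r addrC.
Qed.

(** Taken over an arbitrary list, so that the norm computations can remove one vector of the frame
    at a time. *)
Definition Psi es : covariant V C := wedge_oneforms [seq alpha e | e <- es].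

Lemma of_degree_Psi es : of_degree (size es) (Psi es).
Proof.
case: es => [|e es]; first by case.
by move=> s hs; apply: of_degree_wedge; rewrite size_map.
Qed.

Lemma skewsym_Psi es : skewsym (Psi es).
Proof.
elim: es => [|e es IH] /=; last exact: skewsym_wedge (@skewsym_alpha e) IH.
by case=> [|? ?] u v s2; rewrite /Psi /= /form1 /= oppr0.
Qed.

Lemma Psi_cons e es u s : Psi (e :: es) (u :: s) =
  alpha e [:: u] * Psi es s - wedge 1 (size es).-1 (alpha e) (contract u (Psi es)) s.
Proof.
have sP := @skewsym_Psi es; have sa := @skewsym_alpha e.
rewrite {1}/Psi /= size_map wedge_cons //= mul1r expr1 mulN1r.
rewrite wedge0l //; [|exact: of_degree_Psi|exact: skewsym_contract].
congr (_ + _); case: es sP => [|f es] sP /=; last by rewrite mul1r.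
have -> : contract u (Psi [::]) = fun=> 0 by apply/funext.
by rewrite wedge0r mul0r oppr0.
Qed.

Lemma clin1_Psi es s : clin1 (fun u => Psi es (u :: s)).
Proof.
elim: es s => [|e es IH] s k u v; first by rewrite mulr0 addr0.
rewrite !Psi_cons (clin1_alpha e k u v).
have -> : contract (k *: u + v) (Psi es) = fun t => k%:C%C * contract u (Psi es) t +
  contract v (Psi es) t.
  by apply/funext => t; apply: IH.
by rewrite wedgeDr wedgeZr; ring.
Qed.

Lemma Psi_J es u s : Psi es (u *m J :: s) = ('i%C : C) * Psi es (u :: s).
Proof.
elim: es s => [|e es IH] s; first by rewrite mulr0.
rewrite !Psi_cons alpha_J.
have -> : contract (u *m J) (Psi es) = fun t => ('i%C : C) * contract u (Psi es) t.
  by apply/funext => t; apply: IH.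
by rewrite wedgeZr mulrBr mulrA.
Qed.

Lemma Psi_eq0 es u s : {in es, forall f, alpha f [:: u] = 0} -> Psi es (u :: s) = 0.
Proof.
elim: es s => [|e es IH] s // h; rewrite Psi_cons h ?mem_head // mul0r.
have -> : contract u (Psi es) = fun=> 0.
  by apply/funext => t; apply: IH => f fs; apply: h; rewrite inE fs orbT.
by rewrite wedge0r subr0.
Qed.

(** Up to conjugation the sum is f(e) - i f(Ie), which complex linearity turns into 2 f(e). The
    powers of two in the theorem originate here. *)
Lemma sum_alpha e (f : V -> C) : clin1 f -> (forall u, f (u *m J) = 'i%C * f u) ->
  \sum_i alpha e [:: E i] * (conjc (f (E i))) = 2 * conjc (f e).
Proof.
move=> hf fJ; transitivity (conjc (\sum_i conjc (alpha e [:: E i]) * f (E i))).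
  by rewrite rmorph_sum; apply: eq_bigr => i _; rewrite rmorphM /= opprK.
have -> : \sum_i conjc (alpha e [:: E i]) * f (E i) = f e - 'i%C * f (e *m J).
  rewrite (clin1_expand e hf) (clin1_expand (e *m J) hf) mulr_sumr -sumrB.
  apply: eq_bigr => i _; rewrite (dot_sym oE e) (dot_sym oE (e *m J)).
  have -> : conjc (alpha e [:: E i]) =
      ((dot G (E i) e)%:C - 'i * (dot G (E i) (e *m J))%:C)%C.
    by apply/eqP; rewrite eq_complex /=; apply/andP; split; apply/eqP; ring.
  by rewrite mulrBl mulrA.
by rewrite fJ mulrA -expr2 sqr_i mulN1r opprK rmorphD mulr_natl mulr2n.
Qed.

(** Against forms that are complex linear in the first slot, the Hermitian adjoint of wedging with
    [alpha e] is twice the contraction by [e]. *)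
Lemma fdot_alpha e q b c : skewsym b -> skewsym c ->
  (forall s, clin1 (fun u => c (u :: s))) ->
  (forall u s, c (u *m J :: s) = 'i%C * c (u :: s)) ->
  fdot E q.+1 (wedge 1 q (alpha e) b) (conjc \o c) =
  2 * fdot E q b (conjc \o contract e c).
Proof.
move=> hb hc lc cJ.
have hcc : skewsym (conjc \o c : covariant V C).
  by move=> s1 u v s2 /=; rewrite (hc s1 u v) rmorphN.
have := fdot_wedge E 1 q (@skewsym_alpha e) hb hcc; rewrite add1n => ->.
rewrite fdot_exchange -fdotZr; apply: eq_fdot => // s _.
rewrite fdotS invr1 mul1r.
under eq_bigr => i _ do rewrite fdot0 /contract /=.
by rewrite (sum_alpha e (lc s)) // => u; apply: cJ.
Qed.

Definition unitary es := uniq es /\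
  {in es &, forall e f, alpha e [:: f] = (e == f)%:R}.

Lemma unitary_cons e es : unitary (e :: es) -> unitary es /\
  alpha e [:: e] = 1 /\ {in es, forall f, alpha f [:: e] = 0}.
Proof.
case=> /= /andP[ne u] h; split; [|split].
- by split=> // f g fs gs; apply: h; rewrite inE ?fs ?gs orbT.
- by rewrite h ?mem_head // eqxx.
move=> f fs; rewrite h ?mem_head ?inE ?fs ?orbT //.
by have [e1|] := eqVneq f e; [rewrite e1 (negPf ne) in fs | ].
Qed.

Lemma contract_Psi e es : unitary (e :: es) -> contract e (Psi (e :: es)) = Psi es.
Proof.
case/unitary_cons => _ [h1 h2]; apply/funext => s; rewrite /contract Psi_cons h1 mul1r.
have -> : contract e (Psi es) = fun=> 0 by apply/funext => t; apply: Psi_eq0.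
by rewrite wedge0r subr0.
Qed.

Lemma fdot_Psi es : unitary es ->
  fdot E (size es) (Psi es) (conjc \o Psi es) = 2 ^+ size es.
Proof.
elim: es => [|e es IH] ue.
  by rewrite fdot0 mul1r; apply/eqP; rewrite eq_complex /= oppr0 !eqxx.
have [u' _] := unitary_cons ue.
rewrite [size _]/= {1}/Psi /= size_map fdot_alpha.
- by rewrite (contract_Psi ue) -/(Psi es) IH // exprS.
- exact: skewsym_Psi.
- exact: skewsym_Psi.
- by move=> s; exact: clin1_Psi.
by move=> u s; exact: Psi_J.
Qed.

(** Writing Psi' for the product without [e], X _| Psi is alpha(X) Psi' minus alpha /\ (X _| Psi').
    The cross terms vanish since e _| Psi' = 0, the first pair is a norm given by [fdot_Psi], and
    the second pair is twice the induction hypothesis. *)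
Lemma fdot_contract_Psi e es X Y : unitary (e :: es) ->
  fdot E (size es) (contract X (Psi (e :: es))) (conjc \o contract Y (Psi (e :: es))) =
  2 ^+ size es * \sum_(f <- e :: es) alpha f [:: X] * conjc (alpha f [:: Y]).
Proof.
elim: es e => [|e' es IH] e ue.
  rewrite fdot0 /= mul1r big_seq1 /contract !Psi_cons.
  have z u : contract u (Psi [::]) = fun=> 0 by apply/funext.
  have e1 : Psi [::] [::] = 1 by [].
  by rewrite !z !wedge0r !subr0 e1 !mulr1.
set es' := e' :: es; have [u' [he h0]] := unitary_cons ue.
have z : contract e (Psi es') = fun=> 0 by apply/funext => t; apply: Psi_eq0.
have sP' := @skewsym_Psi es'.
have ePsi u : contract u (Psi (e :: es')) = fun s =>
    alpha e [:: u] * Psi es' s + (-1) * wedge 1 (size es) (alpha e)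
      (contract u (Psi es')) s.
  by apply/funext => s; rewrite mulN1r; apply: Psi_cons.
(* Hermitian symmetry, so that the formulas for the left argument also serve to expand the right
   one. *)
have fconj q b c : fdot E q b (conjc \o c) = conjc (fdot E q c (conjc \o b)).
  elim: q b c => [|q IHq] b c; first by rewrite !fdot0 /= rmorphM /= conjcK mulrC.
  rewrite !fdotS rmorphM fmorphV rmorph_nat rmorph_sum; congr (_ * _).
  by apply: eq_bigr => i _; apply: IHq.
have cross u : fdot E (size es).+1 (wedge 1 (size es) (alpha e) (contract u (Psi es')))
     (conjc \o Psi es') = 0.
  rewrite fdot_alpha; last first.
  - by move=> w s; exact: Psi_J.
  - by move=> s; exact: clin1_Psi.
  - by [].
  - exact: skewsym_contract.
  have -> : conjc \o contract e (Psi es') = fun=> 0 by apply/funext => t;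
    rewrite z /comp rmorph0.
  by rewrite fdot0r mulr0.
have sPe := @skewsym_Psi (e :: es').
have sw w s : Psi (e :: es') (Y :: w :: s) = - Psi (e :: es') (w :: Y :: s).
  exact: (sPe [::] Y w s).
rewrite (ePsi X) fdotDl !fdotZl mulN1r.
have -> : fdot E (size es).+1 (Psi es') (conjc \o contract Y (Psi (e :: es'))) =
    conjc (alpha e [:: Y]) * 2 ^+ size es'.
  rewrite fconj (ePsi Y) fdotDl !fdotZl cross mulr0 addr0.
  have -> : fdot E (size es).+1 (Psi es') (conjc \o Psi es') = 2 ^+ size es'
    by exact: (fdot_Psi u').
  by rewrite rmorphM rmorphXn rmorph_nat.
rewrite fdot_alpha; last first.
- by move=> u s; rewrite /contract !sw Psi_J mulrN.
- by move=> s k u v; rewrite /contract !sw (clin1_Psi (e :: es') (Y :: s) k u v) mulrN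
  opprD.
- exact: skewsym_contract.
- exact: skewsym_contract.
rewrite (contract_swap e Y sPe) (contract_Psi ue).
have -> : fdot E (size es) (contract X (Psi es'))
  (conjc \o (fun s => - contract Y (Psi es') s)) =
   - fdot E (size es) (contract X (Psi es')) (conjc \o contract Y (Psi es')).
  by rewrite -fdotNr; apply: eq_fdot => // s _ /=; rewrite rmorphN.
rewrite (IH e' u') !big_cons /= exprS; ring.
Qed.

End ComplexVolume.

(** * Real and imaginary parts of complex linear forms *)

Section ConjugatePairs.
Variables (R : realType) (m : nat).
Local Notation V := 'rV[R]_m.
Variables (G J : 'M[R]_m) (E : 'I_m -> V).
Hypothesis oE : orthonormal_basis G E.
Hypothesis JJ : J *m J = - 1%:M.
Hypothesis oJ : forall u v : V, dot G (u *m J) (v *m J) = dot G u v.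
Implicit Types (a b c : covariant V R) (A : 'M[R]_m).

(* a + i a' is complex linear in its first slot *)
Definition cplx_pair a a' : Prop :=
  (forall u s, a (u *m J :: s) = - a' (u :: s)) /\
  (forall u s, a' (u *m J :: s) = a (u :: s)).

Lemma cplx_pair_contract a a' u : skewsym a -> skewsym a' -> cplx_pair a a' ->
  cplx_pair (contract u a) (contract u a').
Proof.
move=> ha ha' [h1 h2]; split=> v s; rewrite /contract.
  by rewrite (ha [::] u) (ha' [::] u) /= h1.
by rewrite (ha [::] u) (ha' [::] u) /= h2.
Qed.

Lemma sum_bilinJ (f : V -> V -> R) : bilin f ->
  \sum_i f (E i *m J) (E i *m J) = \sum_i f (E i) (E i).
Proof.
move=> hf; apply: (sum_bilin_frame oE (e := fun i => E i *m J) hf) => i j.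
by rewrite oJ oE.
Qed.

(** Rotating the frame by I in the first slot turns (a, a') into (-a', a), and likewise (b, b'). A
    slot has to exist, whence the degree p + 1; this is how n >= 2 and n >= 3 enter. *)
Lemma cplx_pair_fdot p a a' b b' : is_form p.+1 a -> is_form p.+1 a' ->
    is_form p.+1 b -> is_form p.+1 b' -> cplx_pair a a' -> cplx_pair b b' ->
  fdot E p.+1 a b = fdot E p.+1 a' b' /\ fdot E p.+1 a b' = - fdot E p.+1 a' b.
Proof.
move=> fa fa' fb fb' [h1 h2] [g1 g2].
have ea i : contract (E i *m J) a = fun s => - contract (E i) a' s by apply/funext => s;
  apply: h1.
have eb i : contract (E i *m J) b = fun s => - contract (E i) b' s by apply/funext => s;
  apply: g1.
have eb' i : contract (E i *m J) b' = contract (E i) b by apply/funext => s; apply: g2.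
split; rewrite !fdotS -?mulrN; congr (_ * _).
  rewrite -(sum_bilinJ (bilin_fdot E fa fb)); apply: eq_bigr => i _.
  by rewrite ea eb fdotNl fdotNr opprK.
rewrite -(sum_bilinJ (bilin_fdot E fa fb')) -sumrN; apply: eq_bigr => i _.
by rewrite ea eb' fdotNl.
Qed.

(** Each of the p slots multiplies [a + i a'] by -i, so I acts on it by -ip. *)
Lemma derivation_cplx_pair p a a' s : is_form p a -> is_form p a' -> cplx_pair a a' ->
  derivation J a s = p%:R * a' s /\ derivation J a' s = - (p%:R * a s).
Proof.
move=> fa fa'; elim: p a a' fa fa' s => [|p IH] a a' fa fa' s h.
  case: s => [|u s]; first by rewrite !derivation_nil !mul0r oppr0.
  have d0 c : of_degree 0 c -> of_degree 0 (derivation J c)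
    by exact: of_degree_derivation.
  by rewrite !mul0r oppr0 !(d0 _ (form_of_degree _)).
case: s => [|u s].
  by rewrite !derivation_nil (form_of_degree fa) // (form_of_degree fa') // mulr0 oppr0.
have hi := cplx_pair_contract u (form_skewsym fa) (form_skewsym fa') h.
have [e1 e2] := IH _ _ (form_contract u fa) (form_contract u fa') s hi.
rewrite !derivation_cons e1 e2; case: h => -> ->; rewrite /contract -natr1; split; ring.
Qed.

(* F (v J) (w J) = F v w and A J = - J A force the sum to be its own opposite *)
Lemma sum_anti (f : V -> V -> R) A : bilin f -> A *m J = - (J *m A) ->
  (forall v w, f (v *m J) (w *m J) = f v w) -> \sum_i f (E i *m A) (E i) = 0.
Proof.
move=> [h1 h2] AJ fJ.
have hb : bilin (fun v w => f (v *m A) w).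
  by split=> [w k u v|u]; [rewrite mulmxDl -scalemxAl; exact: h1 | exact: h2].
have /eqP := sum_bilinJ hb; rewrite -[X in X == _]opprK -sumrN.
under eq_bigr => i _.
  rewrite -(lin1N _ (h1 _)) -mulmxA -mulmxN -AJ mulmxA fJ; over.
by rewrite eq_sym -addr_eq0 -mulr2n mulrn_eq0 /= => /eqP.
Qed.

(** Each combination is minus the trace of a bilinear form invariant under rotating both arguments
    by I, and [sum_anti] kills it. *)
Lemma anti_fdot p a a' b b' A : is_form p.+1 a -> is_form p.+1 a' ->
    is_form p.+1 b -> is_form p.+1 b' -> cplx_pair a a' -> cplx_pair b b' ->
    A *m J = - (J *m A) ->
  fdot E p.+1 (derivation A a) b + fdot E p.+1 (derivation A a') b' = 0 /\
  fdot E p.+1 (derivation A a) b' - fdot E p.+1 (derivation A a') b = 0.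
Proof.
move=> fa fa' fb fb' [h1 h2] [g1 g2] AJ.
have ea v : contract (v *m J) a = fun s => - contract v a' s by apply/funext => s;
  apply: h1.
have ea' v : contract (v *m J) a' = contract v a by apply/funext => s; apply: h2.
have eb v : contract (v *m J) b = fun s => - contract v b' s by apply/funext => s;
  apply: g1.
have eb' v : contract (v *m J) b' = contract v b by apply/funext => s; apply: g2.
have [l1 r1] := bilin_fdot E fa fb; have [l2 r2] := bilin_fdot E fa' fb'.
have [l3 r3] := bilin_fdot E fa fb'; have [l4 r4] := bilin_fdot E fa' fb.
split; rewrite !fdot_derivation // -opprD -?sumrN -?big_split /= ?opprK.
  apply/eqP; rewrite oppr_eq0; apply/eqP.
  apply: (@sum_anti (fun v w => fdot E p (contract v a) (contract w b) +
    fdot E p (contract v a') (contract w b'))) => //.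
    by split=> [w k u v|w k u v]; [rewrite l1 l2 | rewrite r1 r2]; ring.
  by move=> v w; rewrite ea ea' eb eb' fdotNl fdotNr opprK addrC.
apply/eqP; rewrite oppr_eq0; apply/eqP.
apply: (@sum_anti (fun v w => fdot E p (contract v a) (contract w b') -
    fdot E p (contract v a') (contract w b))) => //.
  by split=> [w k u v|w k u v]; [rewrite l3 l4 | rewrite r3 r4]; ring.
by move=> v w; rewrite ea ea' eb eb' fdotNl fdotNr opprK addrC.
Qed.

(** After [fdot_derivation] has used one slot, the contractions still have degree p > 0, and
    [cplx_pair_fdot] applies to them term by term. For the forms u _| psi, where p = n - 2, this is
    the condition n >= 3. *)
Lemma anti_fdot_eq p a a' b b' A : (0 < p)%N -> is_form p.+1 a -> is_form p.+1 a' ->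
    is_form p.+1 b -> is_form p.+1 b' -> cplx_pair a a' -> cplx_pair b b' ->
  fdot E p.+1 (derivation A a) b = fdot E p.+1 (derivation A a') b' /\
  fdot E p.+1 (derivation A a) b' = - fdot E p.+1 (derivation A a') b.
Proof.
case: p => // p _ fa fa' fb fb' ha hb; rewrite !fdot_derivation // opprK.
have h v w := cplx_pair_fdot (form_contract v fa) (form_contract v fa')
  (form_contract w fb)
  (form_contract w fb') (cplx_pair_contract v (form_skewsym fa) (form_skewsym fa') ha)
  (cplx_pair_contract w (form_skewsym fb) (form_skewsym fb') hb).
split; first by congr (- _); apply: eq_bigr => i _; case: (h (E i *m A) (E i)).
by rewrite -sumrN; apply: eq_bigr => i _; case: (h (E i *m A) (E i)) => _ ->;
  rewrite opprK.
Qed.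

Lemma fdot_contract_alt1 p (f : V -> covariant V R) a u :
    (forall v, is_form p.+1 (f v)) -> is_form p.+1 a ->
  fdot E p.+1 a (contract u (alt1 p.+1 f)) =
  fdot E p.+1 a (f u) - \sum_i fdot E p (contract (E i) a) (contract u (f (E i))).
Proof.
move=> hf ha.
have -> : contract u (alt1 p.+1 f) = fun s => f u s +
  - alt1 p (fun v => contract u (f v)) s.
  by apply/funext => s; rewrite /contract alt1_cons ?mul1r // => v;
    apply: form_of_degree.
rewrite fdotDr fdotNr [fdot E p.+1 a (alt1 _ _)]fdotC fdot_alt1;
  last exact: form_skewsym ha.
  by congr (_ - _); apply: eq_bigr => i _; rewrite fdotC.
by move=> v; apply: form_of_degree; exact: form_contract.
Qed.

End ConjugatePairs.

(** * Adapted frames and the real forms psi *)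

Section AdaptedBasis.
Variables (R : realType) (n : nat).
Local Notation m := (2 * n)%N.
Local Notation V := 'rV[R]_m.
Variables (G J : 'M[R]_m) (psip psim : covariant V R) (e : 'I_n -> V).
Hypothesis ae : adapted_frame G J psip psim e.
Hypothesis JJ : J *m J = - 1%:M.
Hypothesis oJ : forall u v : V, dot G (u *m J) (v *m J) = dot G u v.

Lemma double_ord : m = (n + n)%N.
Proof. by rewrite mul2n addnn. Qed.

Definition adapted_basis (i : 'I_m) : V :=
  match fintype.split (cast_ord double_ord i) with
  | inl j => e j
  | inr j => e j *m J
  end.

Lemma adapted_basis_on : orthonormal_basis G adapted_basis.
Proof.
case: ae => h1 h2 h3 _ i j.
have h3' k l : dot G (e k *m J) (e l) = 0.
  have := oJ (e k *m J) (e l); rewrite -mulmxA JJ mulmxN mulmx1.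
  by rewrite (lin1N _ (dot_linl G _)) h3 oppr0.
have -> : (i == j) = (fintype.split (cast_ord double_ord i) == fintype.split
  (cast_ord double_ord j)).
  rewrite (inj_eq (can_inj (@splitK _ _))) // (inj_eq (@cast_ord_inj _ _ _)) //.
rewrite /adapted_basis; case: (fintype.split _) => k; case: (fintype.split _) => l.
- by rewrite h1 (inj_eq (@inl_inj _ _)).
- by rewrite h3.
- by rewrite h3'.
by rewrite h2 (inj_eq (@inr_inj _ _)).
Qed.

Lemma sum_adapted_basis (f : V -> R) :
  \sum_i f (adapted_basis i) = \sum_i (f (e i) + f (e i *m J)).
Proof.
rewrite big_split /= (reindex (cast_ord (esym double_ord))) /=; last first.
  by exists (cast_ord double_ord) => i _; rewrite ?cast_ordK ?cast_ordKV.
rewrite big_split_ord /= /adapted_basis; congr (_ + _); apply: eq_bigr => i _.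
  by rewrite cast_ordKV (unsplitK (inl i)).
by rewrite cast_ordKV (unsplitK (inr i)).
Qed.

Lemma adapted_unitary : unitary G J [seq e i | i <- enum 'I_n].
Proof.
have oE := adapted_basis_on; case: ae => h1 h2 h3 _; split.
  rewrite map_inj_uniq ?enum_uniq // => i j eij; apply/eqP.
  by have := h1 i j; rewrite -eij h1 eqxx; case: (i == j) => // /eqP; rewrite oner_eq0.
have einj i j : (e i == e j) = (i == j).
  apply/eqP/eqP => [eij|-> //]; apply/eqP.
  by have := h1 i j; rewrite -eij h1 eqxx; case: (i == j) => // /eqP; rewrite oner_eq0.
move=> _ _ /mapP[i _ ->] /mapP[j _ ->].
rewrite einj /adapted_one_form h1 h3 eq_sym.
by case: (i == j); apply/eqP; rewrite eq_complex /= !eqxx.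
Qed.

Lemma adapted_Psi s : (psip s +i* psim s)%C = Psi G J [seq e i | i <- enum 'I_n] s.
Proof. by case: ae => _ _ _ ->; rewrite /Psi -map_comp. Qed.

Lemma adapted_cplx_pair : cplx_pair J psip psim.
Proof.
split=> u s; have := Psi_J JJ oJ [seq e i | i <- enum 'I_n] u s; rewrite -!adapted_Psi;
  move=> /eqP; rewrite eq_complex /= => /andP[/eqP h1 /eqP h2].
  by rewrite h1; ring.
by rewrite h2; ring.
Qed.

Lemma ReZ (k : R) (z : R[i]) : complex.Re (k%:C%C * z) = k * complex.Re z.
Proof. by case: z => z w /=; ring. Qed.

Lemma Re_sum (I : Type) (r : seq I) (f : I -> R[i]) :
  complex.Re (\sum_(i <- r) f i) = \sum_(i <- r) complex.Re (f i).
Proof. by apply: (big_morph (@complex.Re R)) => // -[? ?] [? ?]. Qed.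

Lemma Re_fdot (E : 'I_m -> V) p (a b : covariant V R[i]) :
  complex.Re (fdot E p a (conjc \o b)) =
  fdot E p (@complex.Re R \o a) (@complex.Re R \o b) +
  fdot E p (@complex.Im R \o a) (@complex.Im R \o b).
Proof.
elim: p a b => [|p IH] a b.
  rewrite !fdot0 /=; case: (a _) => x y; case: (b _) => z w /=; ring.
rewrite !fdotS -mulrDr -big_split /=.
have -> : p.+1%:R^-1 = (p.+1%:R^-1 : R)%:C%C by rewrite fmorphV rmorph_nat.
rewrite ReZ Re_sum; congr (_ * _).
apply: eq_bigr => i _; exact: IH.
Qed.

(** The real part of [fdot_contract_Psi]: its sum becomes <X, e><Y, e> + <X, Ie><Y, Ie> over the
    frame, which is Parseval's identity in the adapted basis. *)
Lemma fdot_contract_psi (E : 'I_m -> V) X Y : orthonormal_basis G E -> (0 < n)%N ->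
  fdot E n.-1 (contract X psip) (contract Y psip) + fdot E n.-1 (contract X psim)
    (contract Y psim) =
  2 ^+ n.-1 * dot G X Y.
Proof.
move=> oE n0; set es := [seq e i | i <- enum 'I_n].
have sz : size es = n by rewrite size_map size_enum_ord.
have := @fdot_contract_Psi _ _ G J E oE JJ oJ.
have := adapted_unitary; rewrite -/es.
case ees : es => [|f es']; first by move: n0; rewrite -[X in (_ < X)%N]sz ees.
move=> ue /(_ f es' X Y ue) /(congr1 (@complex.Re R)).
have -> : size es' = n.-1 by move: sz; rewrite ees => sz; exact: (congr1 predn sz).
rewrite Re_fdot -ees.
have e1 Z : (@complex.Re R \o contract Z (Psi G J es)) = contract Z psip.
  by apply/funext => s; rewrite /= /contract -adapted_Psi.
have e2 Z : (@complex.Im R \o contract Z (Psi G J es)) = contract Z psim.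
  by apply/funext => s; rewrite /= /contract -adapted_Psi.
rewrite !e1 !e2 => ->.
have -> : 2 ^+ n.-1 = (2 ^+ n.-1 : R)%:C%C by rewrite rmorphXn rmorph_nat.
rewrite ReZ Re_sum; congr (_ * _); rewrite big_map big_enum /=.
rewrite (parseval adapted_basis_on)
  (sum_adapted_basis (fun u => dot G X u * dot G Y u)).
by apply: eq_bigr => i _; rewrite mulrN opprK.
Qed.

End AdaptedBasis.

Section DerivationCat.
Variables (R : realType) (m : nat).
Local Notation V := 'rV[R]_m.
Implicit Types (a b c : covariant V R) (A : 'M[R]_m).

Lemma derivation_cat A a (s t : seq V) :
  derivation A a (s ++ t) = derivation A (fun r => a (r ++ t)) s +
    derivation A (fun r => a (s ++ r)) t.
Proof.
elim: s a => [|u s IH] a; first by rewrite derivation_nil add0r.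
by rewrite /= !derivation_cons IH addrAC.
Qed.

Lemma derivation1 A a (u : V) : derivation A a [:: u] = - a [:: u *m A].
Proof. by rewrite derivation_cons derivation_nil sub0r. Qed.

End DerivationCat.

(** * The torsion at a point *)

Section TorsionSums.
Variables (R : realType) (k : nat).
Local Notation n := k.+2.
Local Notation m := (2 * n)%N.
Local Notation V := 'rV[R]_m.
Variables (G J : 'M[R]_m) (E : 'I_m -> V).
Hypothesis oE : orthonormal_basis G E.
Hypothesis JJ : J *m J = - 1%:M.
Hypothesis oJ : forall u v : V, dot G (u *m J) (v *m J) = dot G u v.
Variables (psip psim : covariant V R).
Hypothesis fp : is_form n psip.
Hypothesis fm : is_form n psim.
Hypothesis cp : cplx_pair J psip psim.
Hypothesis hS : forall X Y,
  fdot E k.+1 (contract X psip) (contract Y psip) + fdot E k.+1 (contract X psim)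
    (contract Y psim) =
  2 ^+ k.+1 * dot G X Y.

Let cpi X : cplx_pair J (contract X psip) (contract X psim).
Proof. exact: cplx_pair_contract (form_skewsym fp) (form_skewsym fm) cp. Qed.

Let pair_fdot X Y := cplx_pair_fdot oE oJ (form_contract X fp) (form_contract X fm)
  (form_contract Y fp) (form_contract Y fm) (cpi X) (cpi Y).

(** The contractions have degree n - 1 = k + 1 > 0, so the two terms of [hS] are equal and each is
    half of the right-hand side. *)
Lemma fdot_contract_pp X Y : fdot E k.+1 (contract X psip) (contract Y psip) =
  2 ^+ k * dot G X Y.
Proof.
have := hS X Y; rewrite -(pair_fdot X Y).1 exprS -mulrA.
by move: (fdot _ _ _ _) (2 ^+ k * _) => x y; lra.
Qed.

Lemma fdot_contract_mm X Y : fdot E k.+1 (contract X psim) (contract Y psim) =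
  2 ^+ k * dot G X Y.
Proof. by rewrite -(pair_fdot X Y).1 fdot_contract_pp. Qed.

Lemma fdot_contract_pm X Y :
  fdot E k.+1 (contract X psip) (contract Y psim) = 2 ^+ k * dot G (X *m J) Y.
Proof.
have -> : contract Y psim = fun s => - contract (Y *m J) psip s.
  by apply/funext => s; rewrite /contract cp.1 opprK.
by rewrite fdotNr fdot_contract_pp dotJ // mulrN.
Qed.

Lemma fdot_contract_mp X Y :
  fdot E k.+1 (contract X psim) (contract Y psip) = - (2 ^+ k * dot G (X *m J) Y).
Proof. by rewrite -fdot_contract_pm (pair_fdot X Y).2 opprK. Qed.

Let n_neq0 : n%:R != 0 :> R. Proof. by rewrite pnatr_eq0. Qed.

Let sum_dot : \sum_i dot G (E i) (E i) = m%:R.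
Proof.
rewrite (eq_bigr (fun=> 1)) ?sumr_const ?card_ord // => i _.
by rewrite oE eqxx.
Qed.

Let sum_dotJ : \sum_i dot G (E i *m J) (E i) = 0.
Proof. by apply: big1 => i _; rewrite (dot_sym oE) (dot_u_uJ oE JJ oJ). Qed.

Lemma fdot_pp : fdot E n psip psip = 2 ^+ k.+1.
Proof.
apply: (mulfI n_neq0); rewrite -sum_fdot_contract.
under eq_bigr => i _ do rewrite fdot_contract_pp.
by rewrite -mulr_sumr sum_dot exprS natrM; ring.
Qed.

Lemma fdot_mm : fdot E n psim psim = 2 ^+ k.+1.
Proof.
apply: (mulfI n_neq0); rewrite -sum_fdot_contract.
under eq_bigr => i _ do rewrite fdot_contract_mm.
by rewrite -mulr_sumr sum_dot exprS natrM; ring.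
Qed.

Lemma fdot_pm : fdot E n psip psim = 0.
Proof.
apply: (mulfI n_neq0); rewrite -sum_fdot_contract mulr0.
under eq_bigr => i _ do rewrite fdot_contract_pm.
by rewrite -mulr_sumr sum_dotJ mulr0.
Qed.

Variables (h : V -> R) (xi : V -> 'M[R]_m).
Hypothesis lh : lin1 h.
Hypothesis sxi : forall v, Defs.skew G (xi v).
Hypothesis axi : forall v, xi v *m J = - (J *m xi v).

(* [h] stands for [I eta]. *)
Definition tau v := h v *: J + xi v.

(** The exterior derivative of a form [b] parallel for nabla + tau, expressed by the torsion alone;
    [ext_d_psi] makes the identification. *)
Definition dpsi (b : covariant V R) :=
  alt1 n (fun v s => - derivation (tau v) b s).

Lemma fdot_xi_pp v : fdot E n psip (derivation (xi v) psip) = 0.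
Proof.
have := fdot_derivation_skew oE fp fp (sxi v); rewrite fdotC => /eqP.
by rewrite -addr_eq0 -mulr2n mulrn_eq0 /= => /eqP.
Qed.

Lemma fdot_xi_mm v : fdot E n psim (derivation (xi v) psim) = 0.
Proof.
have := fdot_derivation_skew oE fm fm (sxi v); rewrite fdotC => /eqP.
by rewrite -addr_eq0 -mulr2n mulrn_eq0 /= => /eqP.
Qed.

(** By [fdot_derivation] this is a multiple of the trace of xi composed with I, which vanishes
    because the two anticommute. *)
Lemma fdot_xi_pm v : fdot E n psip (derivation (xi v) psim) = 0.
Proof.
rewrite fdotC fdot_derivation //.
under eq_bigr => i _ do rewrite fdot_contract_mp.
rewrite sumrN opprK -mulr_sumr.
rewrite (@sum_anti _ _ G J E oE oJ (fun v w => dot G (v *m J) w)) ?mulr0 //.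
by split=> [w c u x|u]; [rewrite mulmxDl -scalemxAl; exact: dot_linl | exact: dot_linr].
Qed.

Lemma fdot_xi_mp v : fdot E n psim (derivation (xi v) psip) = 0.
Proof. by rewrite fdotC (fdot_derivation_skew oE fp fm (sxi v)) fdot_xi_pm oppr0. Qed.

Definition xi_cross a b u : R :=
  \sum_i fdot E k.+1 (contract (E i) a) (derivation (xi (E i)) (contract u b)).

(** Only the xi part of tau is commuted with u _|. The part h I is left as the derivation of [b] by
    I, which for psi is known explicitly. *)
Lemma fdot_contract_dpsi a b u : is_form n a -> is_form n b ->
  fdot E n a (contract u (dpsi b)) =
  - (h u * fdot E n a (derivation J b))
  + \sum_i h (E i) * fdot E k.+1 (contract (E i) a) (contract u (derivation J b))
  - fdot E n a (derivation (xi u) b)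
  + (xi_cross a b u - \sum_i fdot E k.+1 (contract (E i) a)
    (contract (u *m xi (E i)) b)).
Proof.
move=> fa fb; have fD v : is_form n (fun s => - derivation (tau v) b s).
  by apply: is_formN; exact: is_form_derivation.
rewrite fdot_contract_alt1 //.
have -> : fdot E n a (fun s => - derivation (tau u) b s) =
   - (h u * fdot E n a (derivation J b)) - fdot E n a (derivation (xi u) b).
  rewrite fdotNr -fdotZr -opprD -fdotDr; congr (- _); apply: eq_fdot => // s _.
  exact: derivation_lin fb _ _ _.
have e i : fdot E k.+1 (contract (E i) a)
  (contract u (fun s => - derivation (tau (E i)) b s)) =
    - (h (E i) * fdot E k.+1 (contract (E i) a) (contract u (derivation J b)))
    - fdot E k.+1 (contract (E i) a) (derivation (xi (E i)) (contract u b))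
    + fdot E k.+1 (contract (E i) a) (contract (u *m xi (E i)) b).
  rewrite -fdotZr -!fdotNr -!fdotDr; apply: eq_fdot => // s _.
  rewrite /contract (derivation_lin _ fb) opprD [X in _ - X = _]derivation_cons.
  by rewrite opprB addrA addrAC.
under eq_bigr => i _ do rewrite e.
by rewrite !big_split /= !sumrN /xi_cross; ring.
Qed.

Definition xi_trace u : R := \sum_i dot G (E i) (u *m xi (E i)).
Definition xi_trace_J u : R := \sum_i dot G (E i *m J) (u *m xi (E i)).

Let sum_h u : \sum_i h (E i) * dot G (E i) u = h u.
Proof.
by rewrite (lin1_expand oE u lh); apply: eq_bigr => i _; rewrite mulrC (dot_sym oE).
Qed.

Let sum_hJ u : \sum_i h (E i) * dot G (E i *m J) u = - h (u *m J).
Proof.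
by rewrite -sum_h -sumrN; apply: eq_bigr => i _; rewrite dotJ // mulrN.
Qed.

Let DJp : derivation J psip = fun s => n%:R * psim s.
Proof. by apply/funext => s; rewrite (derivation_cplx_pair s fp fm cp).1. Qed.

Let DJm : derivation J psim = fun s => - (n%:R * psip s).
Proof. by apply/funext => s; rewrite (derivation_cplx_pair s fp fm cp).2. Qed.

Lemma fdot_dpsi_pp u : fdot E n psip (contract u (dpsi psip)) =
  - (n%:R * 2 ^+ k * h (u *m J)) + xi_cross psip psip u - 2 ^+ k * xi_trace u.
Proof.
rewrite fdot_contract_dpsi // fdot_xi_pp DJp fdotZr fdot_pm.
have -> : \sum_i h (E i) * fdot E k.+1 (contract (E i) psip)
  (contract u (fun s => n%:R * psim s)) =
    n%:R * 2 ^+ k * - h (u *m J).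
  rewrite -sum_hJ mulr_sumr; apply: eq_bigr => i _.
  by rewrite [fdot _ _ _ _]fdotZr fdot_contract_pm; ring.
under [X in _ + (_ - X)]eq_bigr => i _ do rewrite fdot_contract_pp.
by rewrite -mulr_sumr -/(xi_trace u); ring.
Qed.

Lemma fdot_dpsi_mm u : fdot E n psim (contract u (dpsi psim)) =
  - (n%:R * 2 ^+ k * h (u *m J)) + xi_cross psim psim u - 2 ^+ k * xi_trace u.
Proof.
rewrite fdot_contract_dpsi // fdot_xi_mm DJm fdotNr fdotZr fdotC fdot_pm.
have -> : \sum_i h (E i) * fdot E k.+1 (contract (E i) psim)
  (contract u (fun s => - (n%:R * psip s))) =
    n%:R * 2 ^+ k * - h (u *m J).
  rewrite -sum_hJ mulr_sumr; apply: eq_bigr => i _.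
  by rewrite [fdot _ _ _ _]fdotNr fdotZr fdot_contract_mp; ring.
under [X in _ + (_ - X)]eq_bigr => i _ do rewrite fdot_contract_mm.
by rewrite -mulr_sumr -/(xi_trace u); ring.
Qed.

(** Unlike in the (++) case the uncontracted term survives: it gives -n 2^(k+1) h(u), of which the
    contracted sum returns n 2^k h(u). *)
Lemma fdot_dpsi_mp u : fdot E n psim (contract u (dpsi psip)) =
  - (n%:R * 2 ^+ k * h u) + xi_cross psim psip u + 2 ^+ k * xi_trace_J u.
Proof.
rewrite fdot_contract_dpsi // fdot_xi_mp DJp fdotZr fdot_mm.
have -> : \sum_i h (E i) * fdot E k.+1 (contract (E i) psim)
  (contract u (fun s => n%:R * psim s)) =
    n%:R * 2 ^+ k * h u.
  rewrite -sum_h mulr_sumr; apply: eq_bigr => i _.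
  by rewrite [fdot _ _ _ _]fdotZr fdot_contract_mm; ring.
under [X in _ + (_ - X)]eq_bigr => i _ do rewrite fdot_contract_mp.
by rewrite sumrN -mulr_sumr -/(xi_trace_J u) exprS; ring.
Qed.

Lemma fdot_dpsi_pm u : fdot E n psip (contract u (dpsi psim)) =
  n%:R * 2 ^+ k * h u + xi_cross psip psim u - 2 ^+ k * xi_trace_J u.
Proof.
rewrite fdot_contract_dpsi // fdot_xi_pm DJm fdotNr fdotZr fdot_pp.
have -> : \sum_i h (E i) * fdot E k.+1 (contract (E i) psip)
  (contract u (fun s => - (n%:R * psip s))) =
    - (n%:R * 2 ^+ k * h u).
  rewrite -sum_h mulr_sumr -sumrN; apply: eq_bigr => i _.
  by rewrite [fdot _ _ _ _]fdotNr fdotZr fdot_contract_pp; ring.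
under [X in _ + (_ - X)]eq_bigr => i _ do rewrite fdot_contract_pm.
by rewrite -mulr_sumr -/(xi_trace_J u) exprS; ring.
Qed.

Lemma xi_cross_sum u : xi_cross psip psip u + xi_cross psim psim u = 0 /\
  xi_cross psim psip u - xi_cross psip psim u = 0.
Proof.
have h1 i := anti_fdot oE oJ (form_contract u fp) (form_contract u fm)
  (form_contract (E i) fp) (form_contract (E i) fm) (cpi u) (cpi (E i)) (axi (E i)).
split; rewrite /xi_cross -?sumrB -?big_split /=; apply: big1 => i _.
  by have [+ _] := h1 i; rewrite ![fdot _ _ (derivation _ _) _]fdotC.
by have [_ +] := h1 i; rewrite ![fdot _ _ (derivation _ _) _]fdotC.
Qed.

Lemma fdot_dpsi_sum u :
  fdot E n psip (contract u (dpsi psip)) + fdot E n psim (contract u (dpsi psim)) =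
  - (n%:R * 2 ^+ k.+1 * h (u *m J) + 2 ^+ k.+1 * xi_trace u).
Proof.
rewrite fdot_dpsi_pp fdot_dpsi_mm !exprS; have [+ _] := xi_cross_sum u.
by move=> /eqP; rewrite addr_eq0 => /eqP ->; ring.
Qed.

Lemma fdot_dpsi_diff u :
  fdot E n psim (contract u (dpsi psip)) - fdot E n psip (contract u (dpsi psim)) =
  - (n%:R * 2 ^+ k.+1 * h u - 2 ^+ k.+1 * xi_trace_J u).
Proof.
rewrite fdot_dpsi_mp fdot_dpsi_pm !exprS; have [_ +] := xi_cross_sum u.
by move=> /eqP; rewrite subr_eq0 => /eqP ->; ring.
Qed.

Lemma fdot_dpsi_ge3 u : (0 < k)%N ->
  fdot E n psip (contract u (dpsi psip)) = fdot E n psim (contract u (dpsi psim)) /\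
  fdot E n psim (contract u (dpsi psip)) = - fdot E n psip (contract u (dpsi psim)).
Proof.
move=> k0; rewrite fdot_dpsi_pp fdot_dpsi_mm fdot_dpsi_mp fdot_dpsi_pm.
have h1 i : fdot E k.+1 (contract (E i) psip)
  (derivation (xi (E i)) (contract u psip)) =
    fdot E k.+1 (contract (E i) psim) (derivation (xi (E i)) (contract u psim)) /\
    fdot E k.+1 (contract (E i) psim) (derivation (xi (E i)) (contract u psip)) =
    - fdot E k.+1 (contract (E i) psip) (derivation (xi (E i)) (contract u psim)).
  rewrite ![fdot _ _ _ (derivation _ _)]fdotC.
  by apply: anti_fdot_eq => //; exact: form_contract.
have -> : xi_cross psip psip u = xi_cross psim psim u by apply: eq_bigr => i _;
  rewrite (h1 i).1.
have -> : xi_cross psim psip u = - xi_cross psip psim u.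
  by rewrite /xi_cross -sumrN; apply: eq_bigr => i _; rewrite (h1 i).2.
by split; ring.
Qed.

Local Notation vol := (volume G J).

(** The result is a multiple of [vol], and a skew operator on forms sends [vol] to something
    orthogonal to it. *)
Lemma derivation_volume A s : Defs.skew G A -> derivation A vol s = 0.
Proof.
move=> sA; have fv := is_form_volume oE JJ oJ; have nv := fdot_volume oE JJ oJ.
have -> := top_form oE fv nv (is_form_derivation A fv).
suff -> : fdot E m (derivation A vol) vol = 0 by rewrite mul0r.
have := fdot_derivation_skew oE fv fv sA; rewrite [X in _ = - X]fdotC => /eqP.
by rewrite -addr_eq0 -mulr2n mulrn_eq0 /= => /eqP.
Qed.

Lemma skew_tau v : Defs.skew G (tau v).
Proof.
move=> x y; rewrite /tau !mulmxDr -!scalemxAr (dot_linl G) (dot_linr G).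
by rewrite addrACA sxi addr0 dotJ // mulrN addNr.
Qed.

(** Since skew derivations kill [vol], tau acting on the star of omega can be moved to the two
    remaining arguments of [vol], where the double star gives back omega. The h I part cancels
    between these arguments and the xi parts coincide, hence the factor 2. *)
Lemma frame_star_d_frame_star_omega u :
  frame_star E vol (m - 2).+1 (alt1 (m - 2)
    (fun v s => - derivation (tau v) (frame_star E vol 2 (omega G J)) s)) [:: u] =
  - (2 * xi_trace_J u).
Proof.
have fv := is_form_volume oE JJ oJ; have nv := fdot_volume oE JJ oJ.
have fo := is_form_omega oE JJ oJ.
set phi := frame_star E vol 2 (omega G J).
have le2 : (2 <= m)%N by rewrite mulnS.
have fphi : is_form (m - 2) phi by exact: is_form_frame_star.
(* The signs of the double star and of moving [x] across m - 2 slots both have even exponents. *)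
have ss x y : fdot E (m - 2) phi (fun t => vol (x :: t ++ [:: y])) = omega G J
  [:: x; y].
  have := frame_starK oE fv nv le2 fo => /(congr1 (fun f => f [:: x; y])).
  rewrite exprM sqrrN !expr1n mul1r => <-; apply: eq_fdot => // t ht.
  rewrite (skewsym_front t x [:: y] (form_skewsym fv)) ht.
  have -> : (m - 2 = 2 * k.+1)%N by rewrite mulnS addKn.
  by rewrite exprM sqrrN !expr1n mul1r.
rewrite /frame_star fdot_alt1; last first.
- exact: (skewsym_catr [:: u] (form_skewsym fv)).
- by move=> v; apply: form_of_degree; apply: is_formN; exact: is_form_derivation.
have e i : fdot E (m - 2) (fun s => - derivation (tau (E i)) phi s)
     (contract (E i) (fun t => vol (t ++ [:: u]))) =
   omega G J [:: E i *m tau (E i); u] + omega G J [:: E i; u *m tau (E i)].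
  have fc : is_form (m - 2) (contract (E i) (fun t => vol (t ++ [:: u]))).
    split=> [s hs|s1 s2 c x y hs|s1 s2 s3 x]; rewrite /contract.
    - by apply: (form_of_degree fv); rewrite /= size_cat /=; lia.
    - by rewrite /= -!catA /=; exact: (form_lin1 (E i :: s1) (s2 ++ [:: u]) fv c x y).
    case: fv => _ _ hh; have := hh (E i :: s1) s2 (s3 ++ [:: u]) x.
    by rewrite /= -!catA /= -!catA.
  rewrite fdotNl (fdot_derivation_skew oE fphi fc (skew_tau (E i))) opprK.
  rewrite -!ss -fdotDr; apply: eq_fdot => // t _.
  have := derivation_volume (E i :: t ++ [:: u]) (skew_tau (E i)).
  rewrite derivation_cons derivation_cat derivation1 /contract => /eqP.
  rewrite -addrA addrC.
  move: (derivation _ _ _) => z; rewrite -opprD addrC subr_eq0 => /eqP -> .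
  by rewrite addrC.
under eq_bigr => i _ do rewrite e.
rewrite /xi_trace_J mulr_sumr -sumrN; apply: eq_bigr => i _.
rewrite /omega /tau !mulmxDr -!scalemxAr mulmxDl -scalemxAl.
rewrite (dot_linl G) !(dot_linr G).
(* One sign from skewness of xi and one from anticommuting with I cancel, so both arguments give the
   same xi term. *)
have h1 : dot G (E i *m xi (E i)) (u *m J) = dot G (E i) (u *m xi (E i) *m J).
  have /eqP := sxi (E i) (E i) (u *m J); rewrite addr_eq0 => /eqP ->.
  by rewrite -!mulmxA axi mulmxN (lin1N _ (dot_linr G _)).
by rewrite h1 !dotJ //; ring.
Qed.

End TorsionSums.

(** * Calculus in charts *)

Section Calculus.
Variables (R : realType) (W : normedModType R).
Implicit Types (x v : W).

Lemma is_derive_bigsum (I : finType) (h : I -> W -> R) (dh : I -> R) x v :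
  (forall i, is_derive x v (h i) (dh i)) ->
  is_derive x v (fun y => \sum_i h i y) (\sum_i dh i).
Proof.
move=> H; have -> : (fun y => \sum_i h i y) = \sum_i h i.
  by apply/funext => y; rewrite fct_sumE.
by elim/big_ind2 : _ => // [|] *; [exact: is_derive_cst|exact: is_deriveD].
Qed.

Lemma is_derive_mulR (f g : W -> R) (df dg : R) x v :
  is_derive x v f df -> is_derive x v g dg ->
  is_derive x v (fun y => f y * g y) (df * g x + f x * dg).
Proof.
move=> hf hg; have := is_deriveM hf hg.
by move/is_derive_eq; apply; rewrite /GRing.scale /= addrC mulrC [f x * _]mulrC mulrC
  [dg * _]mulrC.
Qed.

Lemma is_derive_mulC (f : W -> R) (df k : R) x v :
  is_derive x v f df -> is_derive x v (fun y => k * f y) (k * df).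
Proof. by move=> hf; exact: (is_deriveZ k hf). Qed.

Lemma is_derive_wedge (V : zmodType) p q (a b : W -> covariant V R)
    (a' b' : covariant V R) x v s :
  (forall t, is_derive x v (fun y => a y t) (a' t)) ->
  (forall t, is_derive x v (fun y => b y t) (b' t)) ->
  is_derive x v (fun y => wedge p q (a y) (b y) s)
    (wedge p q a' (b x) s + wedge p q (a x) b' s).
Proof.
move=> ha hb; rewrite /wedge; case: ifP => _; last first.
  by rewrite addr0; exact: is_derive_cst.
rewrite -mulrDr; apply: is_derive_mulC; rewrite -big_split /=.
apply: is_derive_bigsum => sigma; rewrite -mulrDr; apply: is_derive_mulC.
exact: is_derive_mulR.
Qed.

End Calculus.

Section MatrixCalculus.
Variables (R : realType) (m : nat).
Local Notation V := 'rV[R]_m.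
Implicit Types (x v u : V) (A : V -> 'M[R]_m).

Lemma lin1_derive (f : V -> R) x : differentiable f x -> lin1 (fun v => 'D_v f x).
Proof. by move=> df k u v; rewrite !deriveE // linearP. Qed.

Lemma is_derive_entry A x v i j : differentiable A x ->
  is_derive x v (fun y => A y i j) ('D_v A x i j).
Proof.
move=> /diff_derivable dA; have {}dA := dA v; rewrite derive_mx // mxE;
  apply: derivableP.
exact: (derivable_mxP A x v).1.
Qed.

Lemma derive_mulmx_cst A (B : V -> 'M[R]_m) (C : 'M[R]_m) x v :
  differentiable A x -> differentiable B x -> (\near x, A x *m B x = C) ->
  'D_v A x *m B x + A x *m 'D_v B x = 0.
Proof.
move=> dA dB hC; apply/matrixP => i j; rewrite !mxE -big_split /=.
have h : is_derive x v (fun y => \sum_k A y i k * B y k j)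
    (\sum_k ('D_v A x i k * B x k j + A x i k * 'D_v B x k j)).
  by apply: is_derive_bigsum => k; apply: is_derive_mulR; exact: is_derive_entry.
have h0 : 'D_v (fun y => \sum_k A y i k * B y k j) x = 'D_v (cst (C i j)) x.
  by apply: near_eq_derive; apply: filterS hC => y /matrixP /(_ i j); rewrite mxE.
by have := h; case=> _; rewrite h0 derive_cst => <-.
Qed.

Lemma derive_tr_sym A x v i j : differentiable A x -> (\near x, (A x)^T = A x) ->
  'D_v A x i j = 'D_v A x j i.
Proof.
move=> dA hs; have [_ <-] := is_derive_entry v i j dA.
have [_ <-] := is_derive_entry v j i dA; apply: near_eq_derive.
by apply: filterS hs => y /matrixP /(_ j i); rewrite mxE.
Qed.

End MatrixCalculus.

(** * Torsion-freeness of the Levi-Civita connection *)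

Section SymmetricConnection.
Variables (R : realType) (m : nat).
Local Notation V := 'rV[R]_m.
Implicit Types (a : covariant V R) (A : 'M[R]_m).

Lemma set_nth_take (s : seq V) i u : (i < size s)%N ->
  set_nth 0 s i u = take i s ++ u :: drop i.+1 s.
Proof. by move=> h; rewrite set_nthE h. Qed.

Lemma alt1_contract_mulmx p a A s : is_form p.+1 a ->
  alt1 p (fun v => contract (v *m A) a) s = - derivation A a s.
Proof.
move=> fa; rewrite /alt1; case: eqP => [e|ne]; last first.
  by rewrite (of_degree_derivation A (form_of_degree fa) ne) oppr0.
rewrite /derivation opprK -e; apply: eq_bigr => i _.
by rewrite set_nth_take // (skewsym_front _ _ _ (form_skewsym fa)) size_takel // ltnW.
Qed.

(* A torsion-free connection does not contribute to the exterior derivative. *)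
Lemma alt1_symmetric p a (B : V -> 'M[R]_m) s : is_form p a ->
  (forall u v, u *m B v = v *m B u) ->
  alt1 p (fun v => derivation (B v) a) s = 0.
Proof.
move=> fa hB; elim: p a fa s => [|p IH] a fa [|u s].
- by rewrite of_degree_alt1.
- rewrite alt1_cons ?mul0r ?subr0; last first.
    by move=> v; exact: (of_degree_derivation (B v) (form_of_degree fa)).
  case: s => [|w s]; first exact: derivation_nil.
  exact: (of_degree_derivation (B u) (form_of_degree fa)).
- by rewrite of_degree_alt1.
rewrite alt1_cons; last first.
  by move=> v; exact: (of_degree_derivation (B v) (form_of_degree fa)).
rewrite mul1r /=.
have -> : alt1 p (fun v => contract u (derivation (B v) a)) s =
  alt1 p (fun v t => derivation (B v) (contract u a) t + (-1) * contract (v *m B u) a t)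
    s.
  apply: eq_alt1 => v t; rewrite {1}/contract derivation_cons (hB u v).
  by rewrite mulN1r.
rewrite alt1D alt1Z (IH _ (form_contract u fa)) add0r (alt1_contract_mulmx (B u) s fa).
by rewrite mulN1r opprK subrr.
Qed.

(** The Koszul formula in coordinates. In the closed form [e] the first two terms are exchanged with
    y and z, and the last is symmetric because [D] takes symmetric values. *)
Lemma koszul_sym (D : V -> 'M[R]_m) u v : (forall i j, lin1 (fun w => D w i j)) ->
  (forall w i j, D w i j = D w j i) ->
  u *m (\matrix_(j, k) (2^-1 * (D v j k + (v *m D (delta_mx 0 j)) 0 k
      - (v *m D (delta_mx 0 k)) 0 j))) =
  v *m (\matrix_(j, k) (2^-1 * (D u j k + (u *m D (delta_mx 0 j)) 0 k
      - (u *m D (delta_mx 0 k)) 0 j))).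
Proof.
move=> lD sD.
have e (y z : V) k : (y *m (\matrix_(j, k) (2^-1 * (D z j k
      + (z *m D (delta_mx 0 j)) 0 k - (z *m D (delta_mx 0 k)) 0 j)))) 0 k =
   2^-1 * ((y *m D z) 0 k + (z *m D y) 0 k -
     \sum_j \sum_l y 0 j * (z 0 l * D (delta_mx 0 k) l j)).
  have -> : (z *m D y) 0 k = \sum_j y 0 j * (z *m D (delta_mx 0 j)) 0 k.
    rewrite mxE; under [RHS]eq_bigr => j _ do rewrite mxE mulr_sumr.
    rewrite exchange_big /=; apply: eq_bigr => j _.
    rewrite {1}(row_sum_delta y) (lin1_sum _ (lD j k)) mulr_sumr.
    by apply: eq_bigr => l _; rewrite (lin1Z _ _ (lD j k)); ring.
  rewrite [LHS]mxE [(y *m D z) 0 k]mxE -big_split -sumrB mulr_sumr /=.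
  apply: eq_bigr => j _; rewrite mxE [(z *m D (delta_mx 0 k)) 0 j]mxE -mulr_sumr.
  by ring.
apply/rowP => k; rewrite !e; congr (_ * (_ - _)); first exact: addrC.
rewrite exchange_big /=; apply: eq_bigr => i _; apply: eq_bigr => j _.
by rewrite sD; ring.
Qed.

End SymmetricConnection.

Section Charts.
Variables (R : realType) (m : nat) (M : smooth_manifold R m).
Local Notation V := 'rV[R]_m.
Variables (c : chart_index M) (x : V).
Hypothesis hx : img c x.

Lemma near_img : \near x, img c x.
Proof. by apply: open_nbhs_nbhs; split; [exact: img_open | ]. Qed.

Lemma smooth_differentiable (W : normedModType R) (f : V -> W) :
  smooth_on (img c) f -> differentiable f x.
Proof. by move=> /(_ 1%N) [h _]; exact: h. Qed.

Lemma christoffel_sym (g : matrix_field M) u v : riemannian_metric g ->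
  u *m christoffel g c x v = v *m christoffel g c x u.
Proof.
case=> hs hp _; have dg := smooth_differentiable (hs c).
have lg i j : lin1 (fun w => 'D_w (g c) x i j).
  move=> k y z; rewrite !deriveE // linearP; by rewrite !mxE.
have gs : \near x, (g c x)^T = g c x.
  by apply: filterS near_img => y hy; case: (hp c y hy).
have sg w i j : 'D_w (g c) x i j = 'D_w (g c) x j i by exact: derive_tr_sym.
rewrite /christoffel !mulmxA; congr (_ *m _).
exact: (koszul_sym (D := fun w => 'D_w (g c) x)).
Qed.

Lemma ext_d_alt1 p (a : tensor_field M) : ext_d p a c x =
  alt1 p (fun v s => 'D_v (fun y => a c y s : R) x).
Proof. by []. Qed.

Lemma ext_d_torsion p (a : tensor_field M) (B tau : V -> 'M[R]_m) : is_form p (a c x) ->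
  (forall u v, u *m B v = v *m B u) ->
  (forall v s, 'D_v (fun y => a c y s : R) x = - derivation (B v + tau v) (a c x) s) ->
  ext_d p a c x = alt1 p (fun v s => - derivation (tau v) (a c x) s).
Proof.
move=> fa hB hD; apply/funext => s; rewrite ext_d_alt1.
have -> : alt1 p (fun v s => 'D_v (fun y => a c y s : R) x) s =
    alt1 p (fun v t => (-1) * derivation (B v) (a c x) t + - derivation (tau v) (a c x)
      t) s.
  apply: eq_alt1 => v t; rewrite hD -[B v]scale1r (derivation_lin _ fa).
  by rewrite scale1r mul1r opprD mulN1r.
by rewrite alt1D alt1Z (alt1_symmetric s fa hB) mulr0 add0r.
Qed.

Lemma is_form_ext_d p (a : tensor_field M) : differential_form p a ->
  (forall v, is_form p (fun s => 'D_v (fun y => a c y s : R) x)) ->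
  is_form p.+1 (ext_d p a c x).
Proof.
case=> _ hs _ hD; rewrite ext_d_alt1; apply: is_form_alt1 => // s.
by apply: lin1_derive; apply: smooth_differentiable; exact: hs.
Qed.

End Charts.

(** * The structure in a chart: xi and the powers of omega *)

Section SUChart.
Variables (R : realType) (k : nat).
Local Notation n := k.+2.
Local Notation m := (2 * n)%N.
Local Notation V := 'rV[R]_m.
Variables (M : smooth_manifold R m) (S : SU_structure M).
Variables (c : chart_index M) (x : V).
Hypothesis hx : img c x.
Local Notation G := (metric S c x).
Local Notation J := (acs S c x).

Lemma acs_sq y : img c y -> acs S c y *m acs S c y = - 1%:M.
Proof. by case: (acs_almost_complex S) => _ + _; apply. Qed.

Lemma acs_iso y : img c y -> forall u v : V,
  dot (metric S c y) (u *m acs S c y) (v *m acs S c y) = dot (metric S c y) u v.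
Proof. exact: acs_orthogonal. Qed.

Lemma differentiable_metric : differentiable (metric S c) x.
Proof. by case: (metric_riemannian S) => h _ _; exact: (smooth_differentiable hx (h c)).
  Qed.

Lemma differentiable_acs : differentiable (acs S c) x.
Proof. by case: (acs_almost_complex S) => h _ _;
  exact: (smooth_differentiable hx (h c)). Qed.

Lemma differentiable_bigsum (h : 'I_m -> V -> R) :
  (forall i, differentiable (h i) x) -> differentiable (fun y => \sum_i h i y) x.
Proof.
move=> H; have -> : (fun y => \sum_i h i y) = \sum_i h i.
  by apply/funext => y; rewrite fct_sumE.
exact: differentiable_sum.
Qed.

Lemma differentiable_entry (A : V -> 'M[R]_m) i j :
  differentiable A x -> differentiable (fun y => A y i j : R) x.
Proof.
move=> dA; apply: (@differentiable_comp _ _ _ _ A (fun N : 'M[R]_m => N i j)) => //.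
exact: differentiable_coord.
Qed.

(** Smoothness of omega is not a field of [SU_structure]; it comes from the expression of omega in
    the entries of the metric and of I. *)
Lemma differentiable_kaehler s : differentiable (fun y => kaehler S c y s : R) x.
Proof.
case: s => [|u [|v [|w s]]]; try exact: differentiable_cst.
rewrite /kaehler /dot.
have -> : (fun y => (u *m metric S c y *m (v *m acs S c y)^T) 0 0) =
    fun y => \sum_j (\sum_i u 0 i * metric S c y i j) * (\sum_l v 0 l * acs S c y l j).
  apply/funext => y; rewrite mxE; apply: eq_bigr => j _; rewrite !mxE.
  by congr (_ * _); apply: eq_bigr => i _.
apply: differentiable_bigsum => j; apply: differentiableM;
  apply: differentiable_bigsum => i; apply: differentiableZ;
    apply: differentiable_entry.
  exact: differentiable_metric.
exact: differentiable_acs.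
Qed.

(** Differentiating I^2 = -1 shows that the coordinate derivative of I anticommutes with I; so does
    the commutator of I with the Christoffel matrix, again because I^2 = -1. The extra factor I in
    xi preserves this. *)
Lemma xi_anti v : xi_tensor S c x v *m J = - (J *m xi_tensor S c x v).
Proof.
have anti (D K A : 'M[R]_m) : K *m K = - 1%:M -> D *m K + K *m D = 0 ->
    (D + (K *m A - A *m K)) *m K = - (K *m (D + (K *m A - A *m K))).
  move=> KK /eqP; rewrite addr_eq0 => /eqP e.
  have e1 : A *m K *m K = - A by rewrite -mulmxA KK mulmxN mulmx1.
  have e2 : K *m K *m A = - A by rewrite KK mulNmx mul1mx.
  rewrite !mulmxDl !mulmxDr mulmxN mulNmx e !mulmxA e1 e2 !opprD !opprK.
  by congr (_ + _); rewrite addrC.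
have hC := anti _ _ (levi_civita S c x v) (acs_sq hx) (derive_mulmx_cst v
  differentiable_acs differentiable_acs
    (filterS (fun y hy => acs_sq hy) (near_img hx))).
rewrite /xi_tensor -scalemxAl -scalemxAr -scalerN mulmxA -mulNmx -hC.
by [].
Qed.

Variable B : endo_one_form M.
Hypothesis hB : SU_connection S B.

Lemma parallel_derive (a : tensor_field M) v s : covariant_derivative B a =M 0 ->
  'D_v (fun y => a c y s : R) x = - derivation (B c x v) (a c x) s.
Proof.
move=> h; have /(congr1 (fun f => f (v :: s))) := h c x hx.
by move=> /eqP; rewrite /covariant_derivative addr_eq0 => /eqP.
Qed.

Lemma is_derive_kaehler v s : is_derive x v (fun y => kaehler S c y s : R)
  (- derivation (B c x v) (kaehler S c x) s).
Proof.
rewrite -parallel_derive; last by case: hB.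
exact/derivableP/diff_derivable/differentiable_kaehler.
Qed.

(** The type of [B] carries no linearity in [v], but on omega it acts as minus a directional
    derivative, which is linear. *)
Lemma lin1_derivation_kaehler s :
  lin1 (fun v => derivation (B c x v) (kaehler S c x) s).
Proof.
have e v : derivation (B c x v) (kaehler S c x) s = - 'D_v (fun y => kaehler S c y s :
  R) x.
  by rewrite parallel_derive ?opprK //; case: hB.
move=> l u v; rewrite !e (lin1_derive (differentiable_kaehler s)) opprD mulrN //.
Qed.

Lemma is_form_kaehler : is_form 2 (kaehler S c x).
Proof.
have [e ae] := adapted_frame_exists S hx.
exact: (is_form_omega (adapted_basis_on ae (acs_sq hx) (acs_iso hx)) (acs_sq hx)
  (acs_iso hx)).
Qed.

Lemma is_form_wedge_exp j : is_form (2 * j) (wedge_exp 2 (kaehler S c x) j).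
Proof.
elim: j => [|j IH]; first by apply: is_form0 => -[].
by rewrite (mulnS 2 j); apply: is_form_wedge => //; exact: is_form_kaehler.
Qed.

Lemma derivation_wedge_exp A j s : derivation A (wedge_exp 2 (kaehler S c x) j.+1) s =
  wedge 2 (2 * j) (derivation A (kaehler S c x)) (wedge_exp 2 (kaehler S c x) j) s +
  wedge 2 (2 * j) (kaehler S c x) (derivation A (wedge_exp 2 (kaehler S c x) j)) s.
Proof. exact: derivation_wedge is_form_kaehler (is_form_wedge_exp j). Qed.

(** Parallelism passes to powers by the two Leibniz rules, of the derivative and of [derivation].
    Stating it with [is_derive] keeps the derivability that the next step of the induction uses. *)
Lemma is_derive_wedge_exp v j s :
  is_derive x v (fun y => wedge_exp 2 (kaehler S c y) j s : R)
    (- derivation (B c x v) (wedge_exp 2 (kaehler S c x) j) s).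
Proof.
elim: j s => [|j IH] s.
  rewrite [derivation _ _ _](_ : _ = 0) ?oppr0; first exact: is_derive_cst.
  case: s => [|u s]; first exact: derivation_nil.
  by apply: (of_degree_derivation (B c x v) (p := 0)) => // -[].
rewrite derivation_wedge_exp opprD.
have := is_derive_wedge 2 (2 * j) s (is_derive_kaehler v) IH.
move/is_derive_eq; apply; congr (_ + _).
  exact: (wedgeNl _ _ (derivation (B c x v) (kaehler S c x))).
exact: (wedgeNr _ _ _ (derivation (B c x v) (wedge_exp 2 (kaehler S c x) j))).
Qed.

Lemma lin1_derivation_wedge_exp j s :
  lin1 (fun v => derivation (B c x v) (wedge_exp 2 (kaehler S c x) j) s).
Proof.
elim: j s => [|j IH] s l u v.
  have z A : derivation A (wedge_exp 2 (kaehler S c x) 0) s = 0.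
    case: s => [|w s]; first exact: derivation_nil.
    by apply: (of_degree_derivation A (p := 0)) => // -[].
  by rewrite !z mulr0 addr0.
rewrite !derivation_wedge_exp.
have -> : derivation (B c x (l *: u + v)) (kaehler S c x) = fun t =>
    l * derivation (B c x u) (kaehler S c x) t + derivation (B c x v) (kaehler S c x) t.
  by apply/funext => t; apply: lin1_derivation_kaehler.
have -> : derivation (B c x (l *: u + v)) (wedge_exp 2 (kaehler S c x) j) = fun t =>
    l * derivation (B c x u) (wedge_exp 2 (kaehler S c x) j) t +
    derivation (B c x v) (wedge_exp 2 (kaehler S c x) j) t.
  by apply/funext => t; apply: IH.
rewrite (wedgeDl _ _ (fun t => l * derivation (B c x u) _ t)) wedgeZl.
rewrite (wedgeDr _ _ _ (fun t => l * derivation (B c x u) _ t)) wedgeZr mulrDr.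
by rewrite addrACA.
Qed.

End SUChart.

Section StarKaehler.
Variables (R : realType) (k : nat).
Local Notation n := k.+2.
Local Notation m := (2 * n)%N.
Local Notation V := 'rV[R]_m.
Variables (M : smooth_manifold R m) (S : SU_structure M) (c : chart_index M).

Lemma vol_volume y : vol S c y = volume (metric S c y) (acs S c y).
Proof. by []. Qed.

Lemma hodge_frame_star (E : 'I_m -> V) y p b : img c y ->
  orthonormal_basis (metric S c y) E -> (p <= m)%N -> is_form p b ->
  hodge (metric S c y) (vol S c y) p b =
  frame_star E (volume (metric S c y) (acs S c y)) p b.
Proof.
move=> hy oE le fb; rewrite vol_volume; apply: hodgeE => //.
  exact: is_form_volume oE (acs_sq S hy) (acs_iso S hy).
exact: fdot_volume oE (acs_sq S hy) (acs_iso S hy).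
Qed.

Definition star_coef : R := (-1) ^+ (n * n.+1)./2 / n`!%:R * n%:R.

(** The adapted frame is chosen at [y] but disappears from the result, which therefore holds
    throughout the chart and can be differentiated. *)
Lemma star_kaehler y : img c y ->
  star S 2 (kaehler S) c y = fun s => star_coef * wedge_exp 2 (kaehler S c y) k.+1 s.
Proof.
move=> hy; have [e ae] := adapted_frame_exists S hy.
have oE := adapted_basis_on ae (acs_sq S hy) (acs_iso S hy).
rewrite /star (hodge_frame_star hy oE) //; last exact: is_form_kaehler.
by apply/funext => s; apply: (frame_star_omega oE (acs_sq S hy) (acs_iso S hy)).
Qed.

Lemma derive_star_kaehler B x v s : img c x -> SU_connection S B ->
  'D_v (fun y => star S 2 (kaehler S) c y s : R) x =
  - derivation (B c x v) (star S 2 (kaehler S) c x) s.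
Proof.
move=> hx hB; rewrite (star_kaehler hx) derivationZr -mulrN.
(* A derivative depends on the germ only, and near [x] the pointwise chosen stars are a fixed
   multiple of a power of omega. *)
have h : \near x, star S 2 (kaehler S) c x s = star_coef * wedge_exp 2 (kaehler S c x)
  k.+1 s.
  by apply: filterS (near_img hx) => y hy; rewrite star_kaehler.
rewrite (near_eq_derive v h).
by have [_ ->] := is_derive_mulC star_coef (is_derive_wedge_exp hx hB v k.+1 s).
Qed.

End StarKaehler.

Lemma derivationZl (R : realType) m p k (A : 'M[R]_m) a s : is_form p a ->
  derivation (k *: A) a s = k * derivation A a s.
Proof.
move=> fa; have z : derivation 0 a s = 0.
  have := derivation_lin s fa 1 0 0; rewrite scaler0 addr0 mul1r => /eqP.
  by rewrite eq_sym -subr_eq0 addrK => /eqP.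
by have := derivation_lin s fa k A 0; rewrite addr0 z addr0.
Qed.

Lemma eq_form1 (R : realType) m (a b : covariant 'rV[R]_m R) : is_form 1 a ->
  is_form 1 b -> (forall u, a [:: u] = b [:: u]) -> a = b.
Proof.
move=> fa fb h; apply/funext => s; have [e|/eqP ne] := eqVneq (size s) 1%N.
  by case: s e => [|u [|v s]].
by rewrite (form_of_degree fa) // (form_of_degree fb).
Qed.

(** * The identities of the theorem at a point of a chart *)

Section AtPoint.
Variables (R : realType) (k : nat).
Local Notation n := k.+2.
Local Notation m := (2 * n)%N.
Local Notation V := 'rV[R]_m.
Variables (M : smooth_manifold R m) (S : SU_structure M).
Variables (c : chart_index M) (x : V).
Hypothesis hx : img c x.
Local Notation G := (metric S c x).
Local Notation J := (acs S c x).
Local Notation psip := (psi_plus S c x).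
Local Notation psim := (psi_minus S c x).
Local Notation vol := (volume G J).

Lemma psi_plus_is_form : is_form n psip.
Proof. by case: (psi_plus_form S) => h _ _; exact: h. Qed.

Lemma psi_minus_is_form : is_form n psim.
Proof. by case: (psi_minus_form S) => h _ _; exact: h. Qed.

Lemma psi_cplx_pair : cplx_pair J psip psim.
Proof.
have [e ae] := adapted_frame_exists S hx.
exact: adapted_cplx_pair ae (acs_sq S hx) (acs_iso S hx).
Qed.

Lemma I_one_form mu : is_form 1 (mu c x) -> is_form 1 (I_one S mu c x).
Proof.
case=> h1 h2 h3; split=> [s hs|s1 s2 l u v hs|s1 s2 s3 u].
- by rewrite /I_one h1 ?oppr0 // size_map.
- rewrite /I_one !map_cat /= mulmxDl -scalemxAl h2 ?size_map //; ring.
by rewrite /I_one !map_cat /= map_cat /= h3 oppr0.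
Qed.

Lemma act_eta_plus mu : is_form 1 (mu c x) ->
  act (eta_tensor S mu) (psi_plus S) c x =
  fun s => n%:R * tensor_one (I_one S mu) (psi_minus S) c x s.
Proof.
move=> /I_one_form fh; apply/funext => -[|X s]; rewrite /tensor_one /=.
  by rewrite (form_of_degree fh) // mul0r mulr0.
rewrite (derivationZl _ _ _ psi_plus_is_form) take0 drop0.
by rewrite (derivation_cplx_pair s psi_plus_is_form psi_minus_is_form psi_cplx_pair).1
  mulrCA.
Qed.

Lemma act_eta_minus mu : is_form 1 (mu c x) ->
  act (eta_tensor S mu) (psi_minus S) c x =
  fun s => - (n%:R * tensor_one (I_one S mu) (psi_plus S) c x s).
Proof.
move=> /I_one_form fh; apply/funext => -[|X s]; rewrite /tensor_one /=.
  by rewrite (form_of_degree fh) // mul0r mulr0 oppr0.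
rewrite (derivationZl _ _ _ psi_minus_is_form) take0 drop0.
by rewrite (derivation_cplx_pair s psi_plus_is_form psi_minus_is_form psi_cplx_pair).2
  mulrN mulrCA.
Qed.

Lemma I_one_inj mu nu : is_form 1 (mu c x) -> is_form 1 (nu c x) ->
  (forall X, I_one S mu c x [:: X] = I_one S nu c x [:: X]) -> mu c x = nu c x.
Proof.
move=> fm fn h; apply: eq_form1 => // u.
have := h (u *m J); rewrite /I_one /= (mulJJ (acs_sq S hx)).
rewrite (lin1N u (form_lin1_hd [::] fm)) (lin1N u (form_lin1_hd [::] fn)).
by rewrite !opprK.
Qed.

(** Both squared norms are 2^(n-1). Nonvanishing allows psi to be cancelled when eta is recovered
    from its tensor product with psi. *)
Lemma psi_neq0 : (exists s, psip s != 0) /\ (exists s, psim s != 0).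
Proof.
have [e ae] := adapted_frame_exists S hx.
have oE := adapted_basis_on ae (acs_sq S hx) (acs_iso S hx).
have hS X Y := fdot_contract_psi ae (acs_sq S hx) (acs_iso S hx) X Y oE (ltn0Sn k.+1).
have p0 : 2 ^+ k.+1 != 0 :> R by rewrite expf_neq0 // pnatr_eq0.
have z E a : (forall s, a s = 0) -> @fdot V R m E n a a = 0.
  move=> h; rewrite -[RHS](mul0r (fdot E n a a)) -fdotZl.
  by apply: eq_fdot => // s _; rewrite h mul0r.
split; apply/not_existsP => h.
  have := fdot_pp oE (acs_iso S hx) psi_plus_is_form psi_minus_is_form psi_cplx_pair hS.
  rewrite z => [/esym/eqP|s]; first by rewrite (negPf p0).
  by apply/eqP; apply: contrapT => /negP; exact: h.
have := fdot_mm oE (acs_iso S hx) psi_plus_is_form psi_minus_is_form psi_cplx_pair hS.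
rewrite z => [/esym/eqP|s]; first by rewrite (negPf p0).
by apply/eqP; apply: contrapT => /negP; exact: h.
Qed.

Lemma tensor_one_inj mu nu : is_form 1 (mu c x) -> is_form 1 (nu c x) ->
  (tensor_one (I_one S mu) (psi_plus S) c x = tensor_one (I_one S nu) (psi_plus S) c x
    \/
   tensor_one (I_one S mu) (psi_minus S) c x = tensor_one (I_one S nu) (psi_minus S) c
     x) ->
  mu c x = nu c x.
Proof.
move=> fm fn h; apply: I_one_inj => // X; have [[s hs] [t ht]] := psi_neq0.
case: h => [/(congr1 (fun f => f (X :: s)))|/(congr1 (fun f => f (X :: t)))];
  rewrite /tensor_one /= take0 drop0; exact: mulIf.
Qed.

Variable eta : tensor_field M.
Hypothesis heta : W5_part S eta.

Let h X := I_one S eta c x [:: X].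
Let xi v := xi_tensor S c x v.

Lemma eta_is_form : is_form 1 (eta c x).
Proof. by case: heta => -[hf _ _] _; exact: hf. Qed.

Lemma lin1_I_eta : lin1 h.
Proof. exact: form_lin1_hd [::] (I_one_form eta_is_form). Qed.

(** The whole torsion is skew by [W5_part], and so is its part (I eta)(v) I; the rest is therefore
    skew as well. *)
Lemma skew_xi v : Defs.skew G (xi v).
Proof.
have [_ /(_ c x v hx) [sk _]] := heta.2.
have [e ae] := adapted_frame_exists S hx.
have oE := adapted_basis_on ae (acs_sq S hx) (acs_iso S hx).
move=> u w; have := sk u w.
have -> : (eta_tensor S eta + xi_tensor S) c x v = h v *: J + xi v by [].
rewrite !mulmxDr -!scalemxAr (dot_linl G) (dot_linr G) addrACA.
by rewrite (dotJ (acs_sq S hx) (acs_iso S hx)) mulrN addNr add0r.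
Qed.

Let B := levi_civita S + (eta_tensor S eta + xi_tensor S).

Lemma ext_d_psi (a : tensor_field M) : differential_form n a ->
  covariant_derivative B a =M 0 ->
  ext_d n a c x = dpsi J h xi (a c x) /\ is_form n.+1 (ext_d n a c x).
Proof.
move=> fa pa; have [hf _ _] := fa; have fax := hf c x hx.
have hD v s := parallel_derive hx v s pa.
split.
  apply: (@ext_d_torsion _ _ _ c x n a (levi_civita S c x) (tau J h xi)) => //.
  by move=> u v; apply: christoffel_sym => //; exact: metric_riemannian.
apply: (is_form_ext_d hx fa) => v.
have -> : (fun s => 'D_v (fun y => a c y s : R) x) = fun s => - derivation (B c x v)
  (a c x) s.
  by apply/funext => s; apply: hD.
by apply: is_formN; exact: is_form_derivation.
Qed.

Lemma parallel_psi : covariant_derivative B (psi_plus S) =M 0 /\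
  covariant_derivative B (psi_minus S) =M 0.
Proof. by case: heta => _ [[_ _]]. Qed.

Let dp := ext_d_psi (psi_plus_form S) parallel_psi.1.
Let dm := ext_d_psi (psi_minus_form S) parallel_psi.2.

(** Equal to 2n - 1, kept in the unreduced form in which the theorem gives the degree of the wedge
    product. *)
Local Notation deg := (m - n.+1 + n)%N.

Lemma deg_sub : (m - deg = 1)%N. Proof. by lia. Qed.

Lemma leq_deg : (deg <= m)%N. Proof. by lia. Qed.

Section Frame.
Variables (e : 'I_n -> V) (ae : adapted_frame G J psip psim e).
Local Notation E := (adapted_basis J e).
Let oE := adapted_basis_on ae (acs_sq S hx) (acs_iso S hx).
Let fv := is_form_volume oE (acs_sq S hx) (acs_iso S hx).
Let nv := fdot_volume oE (acs_sq S hx) (acs_iso S hx).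

Lemma star_deg (a : tensor_field M) : is_form deg (a c x) ->
  star S deg a c x = frame_star E vol deg (a c x).
Proof. by move=> fa; apply: hodge_frame_star => //; exact: leq_deg. Qed.

Lemma star_form1 (a : tensor_field M) : is_form deg (a c x) ->
  is_form 1 (star S deg a c x).
Proof.
by move=> fa; rewrite star_deg //; have := is_form_frame_star E fv (a c x) leq_deg;
  rewrite deg_sub.
Qed.

Local Notation w a b := (wedge_field (m - n.+1) n (star S n.+1 (ext_d n a)) b).

Lemma is_form_star_d (a : tensor_field M) : is_form n.+1 (ext_d n a c x) ->
  is_form (m - n.+1) (star S n.+1 (ext_d n a) c x).
Proof.
move=> fa; rewrite /star (hodge_frame_star hx oE) //; last by lia.
by apply: is_form_frame_star => //; lia.
Qed.

Lemma star_w (a b : tensor_field M) u : is_form n (b c x) ->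
  is_form n.+1 (ext_d n a c x) ->
  frame_star E vol deg (w a b c x) [:: u] = - fdot E n (b c x)
    (contract u (ext_d n a c x)).
Proof.
move=> fb fa; have le : (n.+1 <= m)%N by lia.
rewrite /wedge_field /star (hodge_frame_star hx oE) //
  (frame_star_wedge_frame_star oE fv nv) //.
have -> : (m - n.+1 = k.+1)%N by lia.
(* The exponent (n + 1)(n - 1) + n = n(n + 1) - 1 is odd. *)
by rewrite -signr_odd oddD oddM /= !negbK; case: (odd k); rewrite /= expr1 mulN1r.
Qed.

Lemma is_form_w (a b : tensor_field M) : is_form n (b c x) ->
  is_form n.+1 (ext_d n a c x) -> is_form deg (w a b c x).
Proof. by move=> fb fa; apply: is_form_wedge => //; exact: is_form_star_d. Qed.

Lemma codiff_kaehler : is_form 1 (codiff S 2 (kaehler S) c x) /\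
  forall u, codiff S 2 (kaehler S) c x [:: u] = 2 * xi_trace_J G J E xi u.
Proof.
have fk := is_form_kaehler S hx.
have hB : SU_connection S B by case: heta => _ [].
have e2 : star S 2 (kaehler S) c x = frame_star E vol 2 (omega G J).
  by rewrite /star (hodge_frame_star hx oE) //; lia.
have fs : is_form (m - 2) (star S 2 (kaehler S) c x).
  by rewrite e2; apply: is_form_frame_star => //; lia.
have hD v s := derive_star_kaehler v s hx hB.
have ed : ext_d (m - 2) (star S 2 (kaehler S)) c x =
    alt1 (m - 2) (fun v s => - derivation (tau J h xi v) (star S 2 (kaehler S) c x) s).
  apply: (@ext_d_torsion _ _ _ c x _ _ (levi_civita S c x) (tau J h xi)) => //.
  by move=> u v; apply: christoffel_sym => //; exact: metric_riemannian.
have fd : is_form (m - 2).+1 (ext_d (m - 2) (star S 2 (kaehler S)) c x).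
  rewrite ext_d_alt1; apply: is_form_alt1 => [v|s].
    have -> : (fun s => 'D_v (fun y => star S 2 (kaehler S) c y s : R) x) =
        fun s => - derivation (B c x v) (star S 2 (kaehler S) c x) s.
      by apply/funext => s; apply: hD.
    by apply: is_formN; exact: is_form_derivation.
  (* Linearity in the direction is taken from the powers of omega, through the explicit star. *)
  have -> : (fun v => 'D_v (fun y => star S 2 (kaehler S) c y s : R) x) =
      fun v => - (star_coef R k * derivation (B c x v)
        (wedge_exp 2 (kaehler S c x) k.+1) s).
    by apply/funext => v; rewrite hD (star_kaehler S hx) derivationZr.
  apply: lin1_opp; apply: lin1_scale; exact: (lin1_derivation_wedge_exp hx hB).
have ec : codiff S 2 (kaehler S) c x = fun s =>
    - frame_star E vol (m - 2).+1 (ext_d (m - 2) (star S 2 (kaehler S)) c x) s.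
  rewrite -(hodge_frame_star hx oE) //; by lia.
split=> [|u].
  rewrite ec; apply: is_formN.
  have le : ((m - 2).+1 <= m)%N by lia.
  have := is_form_frame_star E fv (ext_d (m - 2) (star S 2 (kaehler S)) c x) le.
  by have -> : (m - (m - 2).+1 = 1)%N by lia.
rewrite ec ed e2 (frame_star_d_frame_star_omega oE (acs_sq S hx) (acs_iso S hx))
  ?opprK //.
- exact: skew_xi.
- by move=> v; exact: xi_anti.
Qed.

Local Notation psi1 := (psi_plus S).
Local Notation psi2 := (psi_minus S).

Let fp := psi_plus_is_form.
Let fm := psi_minus_is_form.
Let hS X Y := fdot_contract_psi ae (acs_sq S hx) (acs_iso S hx) X Y oE (ltn0Sn k.+1).
Let axi v : xi v *m J = - (J *m xi v). Proof. exact: xi_anti. Qed.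

(** Moving I past xi costs a sign and leaves I on both arguments of the inner product, where it is
    an isometry. *)
Lemma I_codiff_kaehler u :
  I_one S (codiff S 2 (kaehler S)) c x [:: u] = 2 * xi_trace G E xi u.
Proof.
rewrite /I_one /= codiff_kaehler.2 -mulrN /xi_trace_J /xi_trace -sumrN; congr (_ * _).
apply: eq_bigr => i _; rewrite -mulmxA.
have -> : J *m xi (E i) = - (xi (E i) *m J) by rewrite axi opprK.
by rewrite mulmxN mulmxA (lin1N _ (dot_linr G _)) opprK (acs_iso S hx).
Qed.

(** Both sides are one-forms, so values at [u] suffice; the 2 in (d^*omega)(u) accounts for the
    passage from the 2^(n-1) of [fdot_dpsi_sum] to 2^(n-2). *)
Lemma star_sum : star S deg (w psi1 psi1 + w psi2 psi2) c x =
  ((n * 2 ^ n.-1)%:R *: eta + (2 ^ (n - 2))%:R *: I_one S (codiff S 2 (kaehler S))) c x.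
Proof.
have f1 := is_form_w fp dp.2; have f2 := is_form_w fm dm.2.
have f12 := is_formD f1 f2.
have fc := codiff_kaehler.1.
apply: eq_form1; first exact: star_form1 f12.
  exact: is_formD (is_formZ _ eta_is_form) (is_formZ _ (I_one_form fc)).
move=> u; transitivity (frame_star E vol deg (w psi1 psi1 c x) [:: u] +
    frame_star E vol deg (w psi2 psi2 c x) [:: u]).
  by rewrite (star_deg f12); exact: fdotDl.
rewrite (star_w u fp dp.2) (star_w u fm dm.2) dp.1 dm.1 -opprD.
rewrite (fdot_dpsi_sum oE (acs_sq S hx) (acs_iso S hx) fp fm psi_cplx_pair hS lin1_I_eta
  skew_xi axi).
transitivity ((n * 2 ^ n.-1)%:R * eta c x [:: u] +
  (2 ^ (n - 2))%:R * I_one S (codiff S 2 (kaehler S)) c x [:: u]); last by [].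
rewrite I_codiff_kaehler opprK subn2 /= natrM !natrX.
(* (I eta)(I u) = -eta(I I u) = eta(u). *)
have -> : h (u *m J) = eta c x [:: u].
  rewrite /h /I_one /= (mulJJ (acs_sq S hx)).
  by rewrite (lin1N u (form_lin1_hd [::] eta_is_form)) opprK.
by rewrite !exprS; ring.
Qed.

Lemma star_diff : star S deg (w psi1 psi2 - w psi2 psi1) c x =
  ((n * 2 ^ n.-1)%:R *: I_one S eta - (2 ^ (n - 2))%:R *: codiff S 2 (kaehler S)) c x.
Proof.
have f1 := is_form_w fm dp.2; have f2 := is_form_w fp dm.2.
have f12 := is_formD f1 (is_formN f2).
have fc := codiff_kaehler.1.
apply: eq_form1; first exact: star_form1 f12.
  exact: is_formD (is_formZ _ (I_one_form eta_is_form)) (is_formN (is_formZ _ fc)).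
move=> u; transitivity (frame_star E vol deg (w psi1 psi2 c x) [:: u] -
    frame_star E vol deg (w psi2 psi1 c x) [:: u]).
  rewrite (star_deg f12); have := fdotDl E deg (w psi1 psi2 c x)
    (fun s => - w psi2 psi1 c x s).
  by move=> e1; apply: etrans (e1 _) _; congr (_ + _); exact: fdotNl.
rewrite (star_w u fm dp.2) (star_w u fp dm.2) dp.1 dm.1 -opprD.
rewrite (fdot_dpsi_diff oE (acs_sq S hx) (acs_iso S hx) fp fm psi_cplx_pair hS
  lin1_I_eta skew_xi axi).
transitivity ((n * 2 ^ n.-1)%:R * h u -
  (2 ^ (n - 2))%:R * codiff S 2 (kaehler S) c x [:: u]); last by [].
by rewrite codiff_kaehler.2 opprK subn2 /= natrM !natrX !exprS; ring.
Qed.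

(** The double star is a sign, so the star is injective in degree 2n - 1, and identities between the
    wedge products can be checked on the one-forms already computed. *)
Lemma frame_star_deg_inj a b : is_form deg a -> is_form deg b ->
  (forall u, frame_star E vol deg a [:: u] = frame_star E vol deg b [:: u]) -> a = b.
Proof.
move=> fa fb hab.
have e1 : frame_star E vol deg a = frame_star E vol deg b.
  have ga := is_form_frame_star E fv a leq_deg; have gb :=
    is_form_frame_star E fv b leq_deg.
  by rewrite deg_sub in ga gb; exact: eq_form1.
have e2 := frame_starK oE fv nv leq_deg fa.
rewrite e1 (frame_starK oE fv nv leq_deg fb) in e2.
apply/funext => s; have /esym := congr1 (fun f => f s) e2.
by move=> /(can_inj (signrMK _)).
Qed.

Lemma w_ge3 : (0 < k)%N -> w psi1 psi1 c x = w psi2 psi2 c x /\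
  w psi1 psi2 c x = fun s => - w psi2 psi1 c x s.
Proof.
move=> k0.
have key u := fdot_dpsi_ge3 oE (acs_sq S hx) (acs_iso S hx) fp fm psi_cplx_pair hS
  lin1_I_eta skew_xi axi u k0.
split.
  apply: (frame_star_deg_inj (is_form_w fp dp.2) (is_form_w fm dm.2)) => u.
  by rewrite (star_w u fp dp.2) (star_w u fm dm.2) dp.1 dm.1 (key u).1.
apply: (frame_star_deg_inj (is_form_w fm dp.2) (is_formN (is_form_w fp dm.2))) => u.
transitivity (- frame_star E vol deg (w psi2 psi1 c x) [:: u]); last exact/esym/fdotNl.
by rewrite (star_w u fm dp.2) (star_w u fp dm.2) dp.1 dm.1 (key u).2.
Qed.

End Frame.

End AtPoint.

Theorem theorem2p6 (R : realType) (n : nat) (hn : (2 <= n)%N)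
  (M : smooth_manifold R (2 * n)) (S : SU_structure M) (eta : tensor_field M)
  (heta : W5_part S eta) :
  let psip := psi_plus S in
  let psim := psi_minus S in
  let sdpsip := star S n.+1 (ext_d n psip) in
  let sdpsim := star S n.+1 (ext_d n psim) in
  let codiff_omega := codiff S 2 (kaehler S) in
  let w := wedge_field (2 * n - n.+1) n in
  let star1 := star S (2 * n - n.+1 + n) in
  [/\ (- act (eta_tensor S eta) psip =M
         - n%:R *: tensor_one (I_one S eta) psim) /\
      (forall mu : tensor_field M, differential_form 1 mu ->
         - act (eta_tensor S mu) psip =M - act (eta_tensor S eta) psip ->
         mu =M eta),
      (- act (eta_tensor S eta) psim =M
         n%:R *: tensor_one (I_one S eta) psip) /\
      (forall mu : tensor_field M, differential_form 1 mu ->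
         - act (eta_tensor S mu) psim =M - act (eta_tensor S eta) psim ->
         mu =M eta),
      star1 (w sdpsip psip + w sdpsim psim) =M
        (n * 2 ^ n.-1)%:R *: eta + (2 ^ (n - 2))%:R *: I_one S codiff_omega,
      star1 (w sdpsip psim - w sdpsim psip) =M
        (n * 2 ^ n.-1)%:R *: I_one S eta - (2 ^ (n - 2))%:R *: codiff_omega
    & (3 <= n)%N ->
        (w sdpsip psip =M w sdpsim psim) /\ (w sdpsip psim =M - w sdpsim psip)].
Proof.
case: n hn M S eta heta => [//|[//|k]] _ M S eta heta.
move=> psip psim sdpsip sdpsim codiff_omega w star1.
have feta c x : img c x -> is_form 1 (eta c x) by move=> hx;
  exact: (eta_is_form hx heta).
have n0 : k.+2%:R != 0 :> R by rewrite pnatr_eq0.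
split.
- split=> [c x hx|mu [fmu _ _] e c x hx].
    apply/funext => s.
    transitivity (- act (eta_tensor S eta) psip c x s); first by [].
    by rewrite (act_eta_plus S hx (feta c x hx)) -mulNr.
  (* Uniqueness: n is invertible and psi is nonzero at the point, so the tensor determines the
     one-form. *)
  have fm := fmu c x hx; have fe := feta c x hx.
  apply: (tensor_one_inj (S := S) hx fm fe); right; apply/funext => s;
    apply: (mulfI n0).
  have := act_eta_plus S hx fm; have := act_eta_plus S hx fe.
  move=> /(congr1 (fun f => f s)) <- /(congr1 (fun f => f s)) <-.
  exact: oppr_inj (congr1 (fun f => f s) (e c x hx)).
- split=> [c x hx|mu [fmu _ _] e c x hx].
    apply/funext => s.
    transitivity (- act (eta_tensor S eta) psim c x s); first by [].
    by rewrite (act_eta_minus S hx (feta c x hx)) opprK.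
  have fm := fmu c x hx; have fe := feta c x hx.
  apply: (tensor_one_inj (S := S) hx fm fe); left; apply/funext => s; apply: (mulfI n0).
  apply: oppr_inj.
  have := act_eta_minus S hx fm; have := act_eta_minus S hx fe.
  move=> /(congr1 (fun f => f s)) <- /(congr1 (fun f => f s)) <-.
  exact: oppr_inj (congr1 (fun f => f s) (e c x hx)).
- move=> c x hx; have [e ae] := adapted_frame_exists S hx.
  exact: (star_sum hx heta ae).
- move=> c x hx; have [e ae] := adapted_frame_exists S hx.
  exact: (star_diff hx heta ae).
move=> k3; split=> c x hx; have [e ae] := adapted_frame_exists S hx.
  exact: (w_ge3 hx heta ae k3).1.
exact: (w_ge3 hx heta ae k3).2.
Qed.
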